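(* Let $d\ge1$, $T>0$, $m>1$, $\mu\in[1,m]$, $p\in[1,\infty)$ and $\sigma_t,\sigma_x\ge0$. Assume that there is a constant $c=c(m,\mu,p,\sigma_t,\sigma_x)>0$ such that $$\|u^{[\mu]}\|_{\dot W^{\sigma_t,p}(0,T;\dot W^{\sigma_x,p}(\mathbb{R}^d))}^p\le c\left(\|u_0\|_{L^1(\mathbb{R}^d)}+\|S\|_{L^1(0,T;L^1(\mathbb{R}^d))}\right)$$ for all (entropy) solutions $u$ of $$\partial_tu-\Delta u^{[m]}=S\ \text{ in }(0,T)\times\mathbb{R}^d,\qquad u(0)=u_0\ \text{ in }\mathbb{R}^d,$$ with $u_0\in L^1(\mathbb{R}^d)$ and $S\in L^1((0,T)\times\mathbb{R}^d)$. Then $$p\le\frac{m}{\mu+(m-1)\sigma_t}\le\frac m\mu,\qquad \sigma_t\le\frac{m-\mu p}{p(m-1)}\le\frac{m-\mu}{m-1},$$ $$\sigma_x=\frac{\mu p-1}{p}\,\frac{2}{m-1}\le\frac{2(\mu-\sigma_t)}{m}\le\frac{2\mu}{m}.$$ In particular, if $\sigma_t=\frac{m-\mu}{m-1}$, then $p=1$ and $\sigma_x=\frac{2(\mu-1)}{m-1}$.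
   Context: Notation: $u^{[\mu]}:=|u|^{\mu-1}u$. Homogeneous Sobolev–Slobodeckij (semi)norms: for a Banach space $X$, an interval $I$, $p\in[1,\infty)$ and non-integer $\sigma=k+r$ with $k\in\mathbb{N}_0$, $r\in(0,1)$, $$\|g\|_{\dot W^{\sigma,p}(I;X)}:=\left(\int_{I\times I}\frac{\|D^kg(t)-D^kg(s)\|_X^p}{|t-s|^{rp+1}}\,ds\,dt\right)^{1/p};$$ for integer $k$, $\|g\|_{\dot W^{k,p}(I;X)}:=\|D^kg\|_{L^p(I;X)}$ (so $\dot W^{0,p}=L^p$). $\dot W^{\sigma,p}(\mathbb{R}^d)$ is defined analogously (with $|x-y|^{rp+d}$). Entropy solution: put $f(t,x,v):=1_{v<u(t,x)}-1_{v<0}$ (the kinetic function of $u$), and for $\psi\in C_c(\mathbb{R})$ let $B^\psi$ be a primitive of $v\mapsto \psi(v)\sqrt{m}\,|v|^{\frac{m-1}{2}}$. A function $u\in C([0,T];L^1(\mathbb{R}^d))$ with $u(0)=u_0$ is an entropy solution if: (1) $\nabla_x B^\psi(u)\in L^2([0,T]\times\mathbb{R}^d)$ for every non-negative $\psi\in C_c^\infty(\mathbb{R})$; (2) for all non-negative $\psi_1,\psi_2\in C_c^\infty(\mathbb{R})$, $\sqrt{\psi_1(u)}\,\nabla_xB^{\psi_2}(u)=\nabla_xB^{\sqrt{\psi_1}\psi_2}(u)$ a.e.; (3) there are non-negative measures $\mathfrak{m},n$ such that, in the sense of distributions on $(0,T)\times\mathbb{R}^d_x\times\mathbb{R}_v$,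 $$\partial_t f-m|v|^{m-1}\Delta_x f=\partial_v(\mathfrak{m}+n)+\delta_{v=u(t,x)}S,$$ where $n$ is determined by $\int\psi(v)\,n(t,x,v)\,dv=|\nabla_xB^{\sqrt{\psi}}(u(t,x))|^2$ for all non-negative $\psi\in C_c^\infty(\mathbb{R})$; (4) $\int(\mathfrak{m}+n)\,dx\,dt\le\mu_0(v)$ for some $\mu_0\in L^\infty(\mathbb{R})$ with $\mu_0(v)\to0$ as $|v|\to\infty$. It is known that for all $u_0\in L^1(\mathbb{R}^d)$, $S\in L^1((0,T)\times\mathbb{R}^d)$ there is a unique entropy solution. *)

(* Defs.v *)
From HB Require Import structures.
From mathcomp Require Import all_boot all_order all_algebra.
From mathcomp Require Import all_classical all_reals all_analysis.

Set Implicit Arguments.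
Unset Strict Implicit.
Unset Printing Implicit Defensive.

Import Order.TTheory GRing.Theory Num.Theory.
Import numFieldNormedType.Exports.

Local Open Scope classical_set_scope.
Local Open Scope ring_scope.

(* The sigma-algebra on R^d generated by the coordinates, i.e. the Borel one;
   same construction as the library's instance on tuples. *)
Section measurable_rV.
Context {R : realType} (d : nat).

Definition rV_coord (i : 'I_d) (x : 'rV[R]_d) : measurableTypeR R := x 0 i.

Let rV_set0 : g_sigma_preimage rV_coord set0.
Proof. exact: sigma_algebra0. Qed.

Let rV_setC A : g_sigma_preimage rV_coord A -> g_sigma_preimage rV_coord (~` A).
Proof. exact: sigma_algebraC. Qed.

Let rV_bigcup (F : (set 'rV[R]_d)^nat) :
  (forall i, g_sigma_preimage rV_coord (F i)) ->
  g_sigma_preimage rV_coord (\bigcup_i (F i)).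
Proof. exact: sigma_algebra_bigcup. Qed.

HB.instance Definition _ := @isMeasurable.Build default_measure_display
  'rV[R]_d (g_sigma_preimage rV_coord) rV_set0 rV_setC rV_bigcup.

Lemma measurable_rV_coord (i : 'I_d) : measurable_fun setT (rV_coord i).
Proof.
move=> _ A mA; rewrite setTI; apply: sub_sigma_algebra => /=.
rewrite -bigcup_seq/=; exists i => /=; first by rewrite mem_index_enum.
by exists A => //; rewrite setTI.
Qed.

Lemma measurable_fun_rV dT (T : measurableType dT) (f : T -> 'rV[R]_d) :
  (forall i, measurable_fun setT (rV_coord i \o f)) -> measurable_fun setT f.
Proof.
move=> mf _ A mA; rewrite setTI.
suff: preimage_set_system setT f (g_sigma_preimage rV_coord) `<=` measurable.
  by apply; exists A => //; rewrite setTI.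
rewrite -g_sigma_preimage_comp.
apply: smallest_sub; first exact: sigma_algebra_measurable.
rewrite -bigcup_seq => B [i _ [C mC <-]].
exact: mf.
Qed.

End measurable_rV.

(* Canonical structure inference only finds this instance of the library for
   products of subprobabilities, hence an explicit lemma. *)
Lemma sigma_finite_product_measure1 d1 d2 (T1 : measurableType d1)
    (T2 : measurableType d2) (R : realType)
    (m1 : {sigma_finite_measure set T1 -> \bar R})
    (m2 : {sigma_finite_measure set T2 -> \bar R}) :
  sigma_finite setT (m1 \x m2)%E.
Proof.
have /sigma_finiteP[F [TF ndF Foo]] := sigma_finiteT m1.
have /sigma_finiteP[G [TG ndG Goo]] := sigma_finiteT m2.
exists (fun n => F n `*` G n).
  rewrite -setXTT TF TG predeqE => -[x y]; split.
    move=> [/= [n _ Fnx] [k _ Gky]]; exists (maxn n k) => //; split.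
    - by move: x Fnx; exact/subsetPset/ndF/leq_maxl.
    - by move: y Gky; exact/subsetPset/ndG/leq_maxr.
  by move=> [n _ []/= ? ?]; split; exists n.
move=> k; have [? ?] := Foo k; have [? ?] := Goo k.
split; first exact: measurableX.
by rewrite product_measure1E// lte_mul_pinfty// ge0_fin_numE.
Qed.

Section lebesgue_rV.
Context {R : realType}.

Definition rV_cons (d : nat) (z : measurableTypeR R * 'rV[R]_d) : 'rV[R]_d.+1 :=
  \row_i oapp (fun j => z.2 0 j) z.1 (unlift ord0 i).

Lemma rV_cons0 d z : @rV_cons d z 0 ord0 = z.1.
Proof. by rewrite mxE unlift_none. Qed.

Lemma rV_consS d z j : @rV_cons d z 0 (lift ord0 j) = z.2 0 j.
Proof. by rewrite mxE liftK. Qed.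

Lemma measurable_rV_cons d : measurable_fun setT (@rV_cons d).
Proof.
apply: measurable_fun_rV => i.
have [j ->|->] := unliftP ord0 i.
- have -> : rV_coord (lift ord0 j) \o @rV_cons d = rV_coord j \o snd.
    by rewrite funeqE => z; exact: rV_consS.
  by apply: measurableT_comp => //; exact: measurable_rV_coord.
- have -> : rV_coord ord0 \o @rV_cons d = fst; last by [].
  by rewrite funeqE => z; exact: rV_cons0.
Qed.

Section push.
Variables (d : nat) (mu : {sigma_finite_measure set 'rV[R]_d -> \bar R}).

Definition lebesgue_rV_succ : set 'rV[R]_d.+1 -> \bar R :=
  pushforward (@lebesgue_measure R \x mu)%E (@rV_cons d).

Let succ0 : lebesgue_rV_succ set0 = 0%E.
Proof. by rewrite /lebesgue_rV_succ /pushforward preimage_set0 measure0. Qed.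

Let succ_ge0 A : (0 <= lebesgue_rV_succ A)%E.
Proof. by rewrite /lebesgue_rV_succ /pushforward measure_ge0. Qed.

Let succ_sigma_additive : semi_sigma_additive lebesgue_rV_succ.
Proof.
have mpre A : measurable A -> measurable (@rV_cons d @^-1` A).
  by move=> mA; rewrite -[X in measurable X]setTI; exact: measurable_rV_cons.
move=> F mF tF mUF; rewrite /lebesgue_rV_succ /pushforward preimage_bigcup.
apply: measure_semi_sigma_additive; first by move=> n; exact: mpre.
- apply/trivIsetP => /= i j _ _ ij; rewrite -preimage_setI.
  by move/trivIsetP : tF => /(_ _ _ _ _ ij) ->//; rewrite preimage_set0.
- by rewrite -preimage_bigcup; exact: mpre.
Qed.

HB.instance Definition _ := isMeasure.Build _ _ _ lebesgue_rV_succ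
  succ0 succ_ge0 succ_sigma_additive.

Let succ_sigma_finite : sigma_finite setT lebesgue_rV_succ.
Proof.
have [F TF Foo] := sigma_finite_product_measure1 (@lebesgue_measure R) mu.
pose g (x : 'rV[R]_d.+1) : measurableTypeR R * 'rV[R]_d :=
  (x 0 ord0, \row_j x 0 (lift ord0 j)).
have consK : cancel (@rV_cons d) g.
  move=> [a y]; rewrite /g rV_cons0; congr (_, _).
  by apply/rowP => j; rewrite mxE rV_consS.
have mg : measurable_fun setT g.
  apply/measurable_fun_pairP; split.
    exact: (measurable_rV_coord (ord0 : 'I_d.+1)).
  apply: measurable_fun_rV => j.
  rewrite (_ : _ \o _ = rV_coord (lift ord0 j)); last first.
    by rewrite funeqE => x; rewrite /rV_coord /= mxE.
  exact: measurable_rV_coord.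
exists (fun n => g @^-1` F n).
  by rewrite -preimage_bigcup -TF preimage_setT.
move=> n; have [mFn Fnoo] := Foo n; split.
  by rewrite -[X in measurable X]setTI; exact: mg.
rewrite /lebesgue_rV_succ /pushforward -comp_preimage.
by rewrite (_ : g \o _ = id) ?preimage_id// funeqE => x /=; rewrite consK.
Qed.

HB.instance Definition _ := Measure_isSigmaFinite.Build _ _ _ lebesgue_rV_succ
  succ_sigma_finite.

End push.

Fixpoint lebesgue_rV (d : nat) : {sigma_finite_measure set 'rV[R]_d -> \bar R} :=
  match d return {sigma_finite_measure set 'rV[R]_d -> \bar R} with
  | 0 => dirac (0 : 'rV[R]_0)
  | d'.+1 => lebesgue_rV_succ (lebesgue_rV d')
  end.

Lemma lebesgue_rV_box (d : nat) (A : 'I_d -> set (measurableTypeR R)) :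
  (forall i, measurable (A i)) ->
  (lebesgue_rV d [set x : 'rV[R]_d | forall i, A i (x 0%R i)] =
   \prod_i lebesgue_measure (A i))%E.
Proof.
elim: d A => [|d IH] A mA.
  by rewrite big_ord0 /= diracE mem_set//= => -[].
have mbox n (B : 'I_n -> set (measurableTypeR R)) :
    (forall i, measurable (B i)) ->
    measurable [set x : 'rV[R]_n | forall i, B i (x 0 i)].
  move=> mB; rewrite (_ : mkset _ = \bigcap_(i in setT) (rV_coord i @^-1` B i)).
    apply: fin_bigcap_measurable => [|i _]; first exact: finite_finset.
    by rewrite -[X in measurable X]setTI; exact: measurable_rV_coord.
  by apply/seteqP; split => x /= Bx i; [move=> _|]; exact: Bx.
rewrite big_ord_recl /= /lebesgue_rV_succ /pushforward.
rewrite (_ : _ @^-1` _ = A ord0 `*`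
  [set x : 'rV[R]_d | forall i, A (lift ord0 i) (x 0 i)]); last first.
  apply/seteqP; split => [z /= Az|z /= [Az0 Az] i].
    split; first by rewrite -rV_cons0; exact: Az.
    by move=> i; rewrite -rV_consS; exact: Az.
  have [j ->|->] := unliftP ord0 i; first by rewrite rV_consS; exact: Az.
  by rewrite rV_cons0.
rewrite product_measure1E//.
- by congr (_ * _)%E; exact: (IH (fun i => A (lift ord0 i)) (fun i => mA _)).
- exact: (mbox d (fun i => A (lift ord0 i)) (fun i => mA _)).
Qed.

End lebesgue_rV.

Section calculus.
Context {R : realType} {V : normedModType R}.

(* D_{v_1} ... D_{v_k} f *)
Definition iter_deriv (vs : seq V) (f : V -> R) : V -> R :=
  foldr (fun v g => 'D_v g) f vs.

(* f is C^n; only meant for a finite-dimensional V, where the existence and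
   continuity of all iterated directional derivatives is C^n-regularity *)
Fixpoint is_Cn (n : nat) (f : V -> R) : Prop :=
  if n is n'.+1 then
    continuous f /\
    forall v, (forall x, derivable f x v) /\ is_Cn n' ('D_v f)
  else continuous f.

Definition compact_support_in (U : set V) (f : V -> R) : Prop :=
  exists K : set V, [/\ compact K, K `<=` U & forall x, ~ K x -> f x = 0].

(* C_c^oo(U) *)
Definition test_function (U : set V) (f : V -> R) : Prop :=
  (forall n, is_Cn n f) /\ compact_support_in U f.

End calculus.

Section Sobolev.
Context {R : realType} (d : nat).
Local Notation Rd := 'rV[R]_d.
Local Notation leb1 := (@lebesgue_measure R).
Local Notation lebd := (@lebesgue_rV R d).

Definition enorm (I : finType) (h : I -> R) : R :=
  Num.sqrt (\sum_i h i ^+ 2).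

Definition e_ (i : 'I_d) : Rd := delta_mx 0 i.

Definition QT (T : R) : set (R * Rd) := `]0, T[ `*` setT.

Definition loc_integrable_Rd (g : Rd -> R) : Prop :=
  measurable_fun setT g /\
  forall K, compact K -> (\int[lebd]_(x in K) `|g x|%:E < +oo)%E.

Definition loc_integrable_QT (T : R) (g : R -> Rd -> R) : Prop :=
  measurable_fun (QT T : set (measurableTypeR R * Rd)) (fun z => g z.1 z.2) /\
  forall K, K `<=` QT T -> compact K ->
    (\int[leb1 \x lebd]_(z in K) `|g z.1 z.2|%:E < +oo)%E.

(* G = d_{a_1} ... d_{a_k} g in the sense of distributions on R^d *)
Definition weak_deriv_Rd (a : seq 'I_d) (g G : Rd -> R) : Prop :=
  [/\ loc_integrable_Rd g, loc_integrable_Rd G &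
      forall phi : Rd -> R, test_function setT phi ->
        \int[lebd]_x (g x * iter_deriv [seq e_ i | i <- a] phi x) =
        (-1) ^+ size a * \int[lebd]_x (G x * phi x)].

(* G = D_{v_1} ... D_{v_k} g in the sense of distributions on (0,T) x R^d *)
Definition weak_deriv_QT (T : R) (vs : seq (R * Rd)) (g G : R -> Rd -> R) :
    Prop :=
  [/\ loc_integrable_QT T g, loc_integrable_QT T G &
      forall phi : R * Rd -> R, test_function (QT T) phi ->
        \int[(leb1 \x lebd)%E]_(z in QT T) (g z.1 z.2 * iter_deriv vs phi z) =
        (-1) ^+ size vs *
        \int[(leb1 \x lebd)%E]_(z in QT T) (G z.1 z.2 * phi z)].

(* The homogeneous norm of W^{s,p}(R^d), s = k + r with k the integer part of
   s. The tensor D^k g is the family of the partial derivatives indexed by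
   k.-tuple 'I_d, with its Euclidean norm. The infimum is over the versions of
   the weak derivative, on which the value does not depend; it is +oo when D^k g
   is not a locally integrable function. *)
Definition dotW_Rd (s p : R) (g : Rd -> R) : \bar R :=
  let k := Num.truncn s in
  let r := s - k%:R in
  ereal_inf [set
    ((if (r == 0)%R then
        \int[lebd]_x (enorm (G x) `^ p)%:E
      else
        \int[lebd \x lebd]_z
          (enorm (fun a => G z.1 a - G z.2 a) `^ p
           / enorm ((z.1 - z.2) 0) `^ (r * p + d%:R))%:E) `^ p^-1)%E
    | G in [set G : Rd -> k.-tuple 'I_d -> R |
             forall a : k.-tuple 'I_d, weak_deriv_Rd a g (fun x => G x a)]].

(* The homogeneous norm of W^{s,p}(0,T;X), where X stands for the norm of a
   space of functions on R^d; time derivatives are distributional ones on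
   (0,T) x R^d. *)
Definition dotW_time (s p T : R) (X : (Rd -> R) -> \bar R) (g : R -> Rd -> R) :
    \bar R :=
  let k := Num.truncn s in
  let r := s - k%:R in
  ereal_inf [set
    ((if (r == 0)%R then
        \int[leb1]_(t in `]0%R, T[) (X (G t) `^ p)
      else
        \int[leb1 \x leb1]_(z in `]0%R, T[ `*` `]0%R, T[)
          (X (fun x => (G z.1 x - G z.2 x)%R) `^ p
           * ((`|z.1 - z.2| `^ (r * p + 1))^-1)%:E)) `^ p^-1)%E
    | G in [set G : R -> Rd -> R | weak_deriv_QT T (nseq k (1, 0)) g G]].

Definition dotW_tx (st sx p T : R) (g : R -> Rd -> R) : \bar R :=
  dotW_time st p T (dotW_Rd sx p) g.

End Sobolev.

Section porous_medium.
Context {R : realType} (d : nat).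
Local Notation Rd := 'rV[R]_d.
Local Notation leb1 := (@lebesgue_measure R).
Local Notation lebd := (@lebesgue_rV R d).

(* u^{[mu]} *)
Definition spow (mu u : R) : R := `|u| `^ (mu - 1) * u.

Definition kinetic_fun (u v : R) : R := (v < u)%R%:R - (v < 0)%R%:R.

(* The primitive of psi(v) sqrt(m) |v|^((m-1)/2) vanishing at 0; one of the two
   intervals is empty, or both are the single point 0. *)
Definition Bpsi (m : R) (psi : R -> R) (w : R) : R :=
  let b v := psi v * (Num.sqrt m * `|v| `^ ((m - 1) / 2)) in
  \int[leb1]_(v in `[0, w]) b v - \int[leb1]_(v in `[w, 0]) b v.

Definition weak_grad (T : R) (w : R -> Rd -> R) (G : R -> Rd -> Rd) : Prop :=
  forall i, weak_deriv_QT T [:: (0, e_ i)] w (fun t x => G t x 0 i).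

Definition nonneg_test (psi : R -> R) : Prop :=
  test_function setT psi /\ forall v, 0 <= psi v.

(* u belongs to C([0,T]; L^1(R^d)) *)
Definition cont_L1 (T : R) (u : R -> Rd -> R) : Prop :=
  (forall t, t \in `[0, T] -> lebd.-integrable setT (fun x => (u t x)%:E)) /\
  forall t0, t0 \in `[0, T] ->
    (fun t => \int[lebd]_x `|u t x - u t0 x|%:E)%E @ within `[0, T] (nbhs t0)
      --> 0%E.

Local Notation phase := (measurableTypeR R * Rd * measurableTypeR R)%type.
Definition QTv (T : R) : set phase := QT T `*` setT.

(* int psi(v) n(t,x,v) dv = |grad B^{sqrt psi}(u)|^2, as an identity between
   measures in (t,x). *)
Definition parabolic_measure (m T : R) (u : R -> Rd -> R)
    (n : {measure set phase -> \bar R}) : Prop :=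
  forall psi, nonneg_test psi ->
    exists2 G, weak_grad T (fun t x => Bpsi m (Num.sqrt \o psi) (u t x)) G &
      forall A : set (measurableTypeR R * Rd), measurable A -> A `<=` QT T ->
        (\int[n]_(z in A `*` setT) (psi z.2)%:E =
         \int[leb1 \x lebd]_(z in A) (enorm (G z.1 z.2 0) ^+ 2)%:E)%E.

Definition kinetic_equation (m T : R) (u S : R -> Rd -> R)
    (M n : {measure set phase -> \bar R}) : Prop :=
  forall phi : R * Rd * R -> R, test_function (QTv T) phi ->
    - (\int[(leb1 \x lebd \x leb1)%E]_(z in QTv T)
         (kinetic_fun (u z.1.1 z.1.2) z.2 *
          ('D_((1, 0), 0) phi z +
           m * `|z.2| `^ (m - 1) *
           \sum_(i < d) iter_deriv [:: ((0, e_ i), 0); ((0, e_ i), 0)] phi z)))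
    = - (\int[M]_(z in QTv T) 'D_((0, 0), 1) phi z)
      - (\int[n]_(z in QTv T) 'D_((0, 0), 1) phi z)
      + \int[(leb1 \x lebd)%E]_(z in QT T) (S z.1 z.2 * phi (z, u z.1 z.2)).

(* The marginal in v of M + n on (0,T) x R^d is at most mu0(v) dv. *)
Definition defect_bound (T : R) (M n : {measure set phase -> \bar R}) : Prop :=
  exists mu0 : measurableTypeR R -> R,
    [/\ measurable_fun setT mu0,
        ('N[leb1]_+oo [EFin \o mu0] < +oo)%E,
        mu0 v @[v --> +oo] --> 0,
        mu0 v @[v --> -oo] --> 0 &
        forall E : set (measurableTypeR R), measurable E ->
          (M (QT T `*` E) + n (QT T `*` E) <= \int[leb1]_(v in E) (mu0 v)%:E)%E].

(* Elements of C([0,T]; L^1(R^d)) are represented by functions of (t,x) that are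
   jointly measurable; such a representative always exists. *)
Record entropy_solution (m T : R) (u0 : Rd -> R) (S u : R -> Rd -> R) : Prop := {
  entropy_measurable :
    measurable_fun (`[0, T] `*` setT : set (measurableTypeR R * Rd))
      (fun z => u z.1 z.2);
  entropy_cont : cont_L1 T u;
  entropy_init : {ae lebd, forall x, u 0 x = u0 x};
  entropy_grad_L2 : forall psi, nonneg_test psi ->
    exists2 G, weak_grad T (fun t x => Bpsi m psi (u t x)) G &
      (\int[leb1 \x lebd]_(z in QT T) (enorm (G z.1 z.2 0) ^+ 2)%:E < +oo)%E;
  entropy_chain_rule : forall psi1 psi2, nonneg_test psi1 -> nonneg_test psi2 ->
    exists G H,
      [/\ weak_grad T (fun t x => Bpsi m psi2 (u t x)) G,
          weak_grad T
            (fun t x => Bpsi m (fun v => Num.sqrt (psi1 v) * psi2 v) (u t x)) H &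
          {ae (leb1 \x lebd)%E, forall z, QT T z ->
             Num.sqrt (psi1 (u z.1 z.2)) *: G z.1 z.2 = H z.1 z.2}];
  entropy_kinetic : exists M n : {measure set phase -> \bar R},
    [/\ parabolic_measure m T u n, kinetic_equation m T u S M n &
        defect_bound T M n]
}.

End porous_medium.

(* Main.v *)
(* Take a smooth bump U >= 0 on R x R^d whose power U^m is smooth as well. For a
   time scale tau < T/4 and a space scale lam > 0 let a = (lam^2/tau)^(1/(m-1)) and
   u(t,x) = a U((t - T/2)/tau, x/lam). Both terms of S = u_t - Lap u^m then have
   size a/tau, so that |S|_{L^1} <= C a lam^d, and u is an entropy solution with
   u_0 = 0 and vanishing entropy defect. Pairing the weak derivatives of u^mu with
   test functions of the same scales bounds the left-hand side of the estimate from
   below by c a^(mu p) tau^(1 - st p) lam^(d - sx p). Hence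
   a^(mu p - 1) tau^(1 - st p) lam^(- sx p) stays bounded for all lam > 0 and all
   small tau, i.e. a linear function of (ln lam, ln tau) is bounded above on a half
   plane {ln tau < s0}. Its coefficient in ln lam therefore vanishes, which gives
   sx, and the one in ln tau is nonnegative, which is p (mu + (m - 1) st) <= m;
   the remaining inequalities follow from these two relations. *)

From HB Require Import structures.
Require Import Defs.
From mathcomp Require Import all_boot all_order all_algebra.
From mathcomp Require Import all_classical all_reals all_analysis.
From mathcomp Require Import measurable_realfun ess_sup_inf ring lra.

Set Implicit Arguments.
Unset Strict Implicit.
Unset Printing Implicit Defensive.

Import Order.TTheory GRing.Theory Num.Theory.
Import numFieldNormedType.Exports.

Local Open Scope classical_set_scope.
Local Open Scope ring_scope.

(** * Measurability of continuous functions, integrals over boxes *)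

(** The norms are infima over versions of weak derivatives, and nothing is known about the
    measurability of the norms of their time slices. Only pairings with test functions are
    accessible, so |y|^p is minorised by an affine function of |y|, calibrated at the expected size
    eps ~ a^mu tau^-k lam^-l of the derivative, with k and l the integer parts of st and sx. The
    fractional parts of the norms are double integrals of differences; a test function of mean zero
    turns a difference back into a single term. The tests are therefore first derivatives of bumps,
    and the pairing with u^mu puts the orders k+1 and l+1 on these bumps. To exclude cancellation, U
    is localised where those derivatives keep one sign. Its factors are shifted copies of
    exp(-c/(1+s) - c/(1-s)): a power m only multiplies c by m, so U and U^m are smooth together for
    every real m > 1. The kinetic equation is obtained without differentiating the kinetic function:
    the substitution v = r u, with r in [0,1], leaves exact derivatives in (t,x) for each fixed
    r. *)

Lemma le_integral_ge0 d (T : measurableType d) (R : realType)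
    (mu : {measure set T -> \bar R}) (D : set T) (f g : T -> \bar R) :
  (forall x, D x -> 0 <= f x)%E -> (forall x, D x -> f x <= g x)%E ->
  (\int[mu]_(x in D) f x <= \int[mu]_(x in D) g x)%E.
Proof.
move=> f0 fg; rewrite [leLHS]integral_mkcond [leRHS]integral_mkcond.
have fg' x : ((f \_ D) x <= (g \_ D) x)%E.
  by rewrite !patchE; case: ifPn => //; rewrite inE; exact: fg.
have f0' x : (0 <= (f \_ D) x)%E.
  by rewrite patchE; case: ifPn => //; rewrite inE; exact: f0.
(* The integral of a nonnegative function is a supremum over the simple functions below it, so
   monotonicity holds without measurability of either side. The Sobolev norms of arbitrary versions
   are compared in this way. *)
rewrite ge0_integralTE// [leRHS]ge0_integralTE; last first.
  by move=> x; exact: le_trans (fg' x).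
apply: ge_ereal_sup => _ [h hf <-]; apply: ereal_sup_ubound; exists h => //= x.
exact: le_trans (hf x) (fg' x).
Qed.

(* The sigma-algebra of R^d is generated by the coordinates: continuous functions
   are measurable because they are limits of functions of the rounded coordinates. *)
Lemma measurable_fun_countable_cvg d (T : measurableType d) (R : realType)
    (f : T -> R) (I : countType) (q : nat -> T -> I) (g : nat -> I -> T) :
  (forall n i, measurable (q n @^-1` [set i])) ->
  (forall x, f (g n (q n x)) @[n --> \oo] --> f x) ->
  measurable_fun setT f.
Proof.
move=> mq fx.
apply: (@measurable_fun_cvg _ _ _ setT (fun n x => f (g n (q n x)))) => //.
move=> n _ A mA; rewrite setTI.
rewrite (_ : _ @^-1` A = \bigcup_i (if `[< A (f (g n i)) >] then q n @^-1` [set i] else set0)).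
  apply: countable_bigcupT_measurable => // i.
  by case: ifPn => // _; exact: measurable0.
apply/seteqP; split => [x /= Ax|x [i _]].
  by exists (q n x) => //; rewrite asboolT.
by case: asboolP => // Ai /= ->.
Qed.

Lemma continuous_pair_fun (T U V : topologicalType) (f : T -> U) (g : T -> V) :
  continuous f -> continuous g -> continuous (fun t => (f t, g t)).
Proof.
move=> cf cg t.
exact: (@cvg_pair _ _ _ (nbhs t) (nbhs (f t)) (nbhs (g t)) _ _ _ f g (cf t) (cg t)).
Qed.

Lemma continuous_id (T : topologicalType) : continuous (@id T).
Proof. by move=> x; exact: cvg_id. Qed.

Lemma continuous_slicel (T U V : topologicalType) (f : T * U -> V) (y : U) :
  continuous f -> continuous (fun x => f (x, y)).
Proof.
move=> cf x; apply: (@continuous_comp _ _ _ (fun x => (x, y)) f); last exact: cf.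
by apply: continuous_pair_fun => ?; [exact: cvg_id|exact: cvg_cst].
Qed.

Lemma continuous_slicer (T U V : topologicalType) (f : T * U -> V) (x : T) :
  continuous f -> continuous (fun y => f (x, y)).
Proof.
move=> cf y; apply: (@continuous_comp _ _ _ (fun y => (x, y)) f); last exact: cf.
by apply: continuous_pair_fun => ?; [exact: cvg_cst|exact: cvg_id].
Qed.

Section rounding.
Context {R : realType}.

(** Index of the cell of mesh 1/(n+1) that contains x; [urnd] gives back the left end of the cell.
    The index set is countable, as [measurable_fun_countable_cvg] requires. *)
Definition rnd (n : nat) (x : R) : int := Num.floor (n.+1%:R * x).
Definition urnd (n : nat) (k : int) : R := k%:~R / n.+1%:R.

Lemma measurable_rnd n k : measurable ((rnd n : measurableTypeR R -> int) @^-1` [set k]).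
Proof.
rewrite (_ : _ @^-1` _ = `[urnd n k, urnd n (k + 1)[%classic).
  exact: measurable_itv.
apply/seteqP; split => x; rewrite /= in_itv /= /rnd /urnd ler_pdivrMr ?ltr0n//.
  move=> <-; rewrite ltr_pdivlMr ?ltr0n// [x * _]mulrC; apply/andP; split.
    exact: floor_le.
  exact: floorD1_gt.
rewrite ltr_pdivlMr ?ltr0n// => /andP[h1 h2].
by apply: floor_def; rewrite [_ * x]mulrC h1.
Qed.

Lemma rnd_dist n x : `|x - urnd n (rnd n x)| <= n.+1%:R^-1.
Proof.
have n0 : 0 < n.+1%:R :> R by rewrite ltr0n.
rewrite -(ler_pM2l n0) mulfV ?gt_eqF// -{1}(gtr0_norm n0) -normrM mulrBr.
rewrite /urnd mulrCA mulfV ?gt_eqF// mulr1.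
have := floor_le (n.+1%:R * x); have := floorD1_gt (n.+1%:R * x).
rewrite /rnd intrD => h1 h2; rewrite ger0_norm ?subr_ge0//.
by rewrite lerBlDr addrC ltW.
Qed.

Lemma rnd_cvg x : urnd n (rnd n x) @[n --> \oo] --> x.
Proof.
apply/cvgrPdist_le => e e0.
have := @cvg_harmonic R => /cvgrPdist_le /(_ _ e0).
apply: filterS => n; rewrite sub0r normrN /harmonic => h.
by apply: le_trans (rnd_dist n x) (le_trans (ler_norm _) h).
Qed.

Definition rndV d (n : nat) (x : 'rV[R]_d) : {ffun 'I_d -> int} :=
  [ffun i => rnd n (x 0 i)].
Definition urndV d (n : nat) (k : {ffun 'I_d -> int}) : 'rV[R]_d :=
  \row_i urnd n (k i).

Lemma measurable_rndV d n k : measurable (@rndV d n @^-1` [set k]).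
Proof.
rewrite (_ : _ @^-1` _ = \bigcap_(i in setT) (rV_coord i @^-1` (rnd n @^-1` [set k i]))).
  apply: fin_bigcap_measurable => [|i _]; first exact: finite_finset.
  rewrite -[X in measurable X]setTI; apply: (@measurable_rV_coord R d i) => //.
  exact: measurable_rnd.
apply/seteqP; split => [x /= <- i _ |x h] /=; first by rewrite ffunE.
by apply/ffunP => i; rewrite ffunE; exact: h.
Qed.

Lemma rndV_cvg d (x : 'rV[R]_d) : urndV n (rndV n x) @[n --> \oo] --> x.
Proof.
apply/cvgrPdist_le => e e0.
have := @cvg_harmonic R => /cvgrPdist_le /(_ _ e0).
apply: filterS => n; rewrite sub0r normrN /harmonic => h.
rewrite /Num.norm/= mx_normrE; apply: bigmax_le => [|[i j] _]; first exact: ltW.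
rewrite !mxE ffunE (ord1 i).
by apply: le_trans (rnd_dist n _) (le_trans (ler_norm _) h).
Qed.
End rounding.

Section measurable_continuous.
Context {R : realType} {d : nat}.
Local Notation Q := (measurableTypeR R * 'rV[R]_d)%type.
Local Notation phase := (Q * measurableTypeR R)%type.

Lemma continuous_measurable_rV (f : 'rV[R]_d -> R) :
  continuous f -> measurable_fun setT f.
Proof.
move=> cf; apply: (@measurable_fun_countable_cvg _ _ _ _ _ (@rndV R d) (@urndV R d)).
  by move=> n i; exact: measurable_rndV.
by move=> x; apply: continuous_cvg; [exact: cf|exact: rndV_cvg].
Qed.

Lemma continuous_measurable_Q (f : R * 'rV[R]_d -> R) :
  continuous f -> measurable_fun setT (f : Q -> R).
Proof.
move=> cf; apply: (@measurable_fun_countable_cvg _ Q _ _ _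
  (fun n z => (@rnd R n z.1, @rndV R d n z.2)) (fun n k => (urnd n k.1, urndV n k.2))).
  move=> n [i j]; rewrite (_ : _ @^-1` _ =
      ((rnd n : measurableTypeR R -> int) @^-1` [set i]) `*` (@rndV R d n @^-1` [set j])).
    by apply: measurableX; [exact: measurable_rnd|exact: measurable_rndV].
  by apply/seteqP; split => [[x y] /= [-> ->]|[x y] /= [-> ->]].
move=> [x y]; apply: continuous_cvg; first exact: cf.
by apply: (@cvg_pair _ _ _ _ (nbhs x) (nbhs y)); [exact: rnd_cvg|exact: rndV_cvg].
Qed.

Lemma continuous_measurable_phase (f : R * 'rV[R]_d * R -> R) :
  continuous f -> measurable_fun setT (f : phase -> R).
Proof.
move=> cf; apply: (@measurable_fun_countable_cvg _ phase _ _ _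
  (fun n z => ((@rnd R n z.1.1, @rndV R d n z.1.2), @rnd R n z.2))
  (fun n k => ((urnd n k.1.1, urndV n k.1.2), urnd n k.2))).
  move=> n [[i j] l]; rewrite (_ : _ @^-1` _ =
      ((rnd n : measurableTypeR R -> int) @^-1` [set i]) `*` (@rndV R d n @^-1` [set j])
       `*` ((rnd n : measurableTypeR R -> int) @^-1` [set l])).
    apply: measurableX; last exact: measurable_rnd.
    by apply: measurableX; [exact: measurable_rnd|exact: measurable_rndV].
  by apply/seteqP; split => [[[x y] t] /= [-> -> ->]|[[x y] t] /= [[-> ->] ->]].
move=> [[x y] t]; apply: continuous_cvg; first exact: cf.
apply: (@cvg_pair _ _ _ _ (nbhs (x, y)) (nbhs t)); last exact: rnd_cvg.
by apply: (@cvg_pair _ _ _ _ (nbhs x) (nbhs y)); [exact: rnd_cvg|exact: rndV_cvg].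
Qed.

End measurable_continuous.

Lemma compact_continuous_bounded (R : realType) (V : topologicalType) (K : set V)
    (f : V -> R) : compact K -> continuous f ->
  exists2 C, 0 < C & forall x, K x -> `|f x| <= C.
Proof.
move=> cK cf.
have : compact (f @` K) by apply: continuous_compact => //; exact: continuous_subspaceT.
move/compact_bounded => [M [Mr MP]].
exists (`|M| + 1); first by rewrite ltr_wpDl.
move=> x Kx; apply: (MP (`|M| + 1)); last by exists x.
by rewrite (le_lt_trans (ler_norm _))// ltrDl.
Qed.

Section bounded_support.
Context d (T : measurableType d) (R : realType) (mu : {measure set T -> \bar R}).

Lemma bounded_support_integrable (A : set T) (f : T -> R) (C : R) :
  measurable A -> (mu A < +oo)%E -> measurable_fun setT f ->
  (forall x, A x -> `|f x| <= C) -> (forall x, ~ A x -> f x = 0) ->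
  mu.-integrable setT (EFin \o f).
Proof.
move=> mA Aoo mf fC f0.
have -> : EFin \o f = (EFin \o f) \_ A.
  apply/funext => x; rewrite patchE; case: ifPn => //=.
  by rewrite notin_setE => /f0 ->.
apply/(integrable_mkcond _ mA).
apply: measurable_bounded_integrable => //; first exact: measurable_funTS.
by exists C; split; [exact: num_real|move=> D CD x /fC h; exact: le_trans h (ltW CD)].
Qed.

Lemma Rintegral_normr_le (A : set T) (f : T -> R) (C : R) :
  measurable A -> (mu A < +oo)%E -> measurable_fun setT f ->
  (forall x, A x -> `|f x| <= C) -> (forall x, ~ A x -> f x = 0) ->
  `|\int[mu]_x f x| <= C * fine (mu A).
Proof.
move=> mA Aoo mf fC f0.
have intf : mu.-integrable setT (EFin \o f) := bounded_support_integrable mA Aoo mf fC f0.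
apply: le_trans (@le_normr_Rintegral _ _ _ mu setT f measurableT intf) _.
rewrite -(Rintegral_cst mu mA C) [leRHS]Rintegral_mkcond.
apply: le_Rintegral => //.
- exact: integrable_norm.
- have : mu.-integrable A (EFin \o cst C).
    apply: measurable_bounded_integrable => //; exists `|C|.
    by split; [exact: num_real|move=> D /ltW + x _].
  by move/(integrable_mkcond _ mA); rewrite restrict_EFin.
- move=> x _; rewrite patchE; case: ifPn => [|]; rewrite ?inE ?notin_setE.
    exact: fC.
  by move/f0 ->; rewrite normr0.
Qed.

Lemma Rintegral_sumf (I : finType) (F : I -> T -> R) :
  (forall i, mu.-integrable setT (EFin \o F i)) ->
  \int[mu]_x (\sum_i F i x) = \sum_i \int[mu]_x F i x.
Proof.
move=> iF; rewrite /Rintegral sum_fine; last first.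
  by move=> i _; exact: integrable_fin_num (iF i).
rewrite -(@integral_sum _ T R mu setT measurableT I (fun i x => (F i x)%:E) iF); congr fine.
by apply: eq_integral => x _; rewrite sumEFin.
Qed.

End bounded_support.

Section fubini_real.
Context d1 d2 (T1 : measurableType d1) (T2 : measurableType d2) (R : realType).
Variables (m1 : {sigma_finite_measure set T1 -> \bar R}).
Variables (m2 : {sigma_finite_measure set T2 -> \bar R}).
Variable f : T1 * T2 -> R.
Hypothesis intf : (m1 \x m2)%E.-integrable setT (EFin \o f).

Lemma Rfubini12 : (forall x, m2.-integrable setT (fun y => (f (x, y))%:E)) ->
  \int[(m1 \x m2)%E]_z f z = \int[m1]_x \int[m2]_y f (x, y).
Proof.
move=> i2; rewrite /Rintegral -integral12_prod_meas1//; congr fine.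
apply: eq_integral => x _; rewrite /fubini_F /= fineK//.
exact: integrable_fin_num (i2 x).
Qed.

Lemma Rfubini21 : (forall y, m1.-integrable setT (fun x => (f (x, y))%:E)) ->
  \int[(m1 \x m2)%E]_z f z = \int[m2]_y \int[m1]_x f (x, y).
Proof.
move=> i2; rewrite /Rintegral -integral21_prod_meas1//; congr fine.
apply: eq_integral => x _; rewrite /fubini_G /= fineK//.
exact: integrable_fin_num (i2 x).
Qed.

Lemma integrable_Rfubini12 :
  (forall x, m2.-integrable setT (fun y => (f (x, y))%:E)) ->
  m1.-integrable setT (fun x => (\int[m2]_y f (x, y))%:E).
Proof.
move=> i2; have := integrable_fubini_F intf.
apply: eq_integrable => // x _; rewrite /fubini_F /= fineK//.
exact: integrable_fin_num (i2 x).
Qed.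

End fubini_real.

(* (m1 \x m2)%E with the sigma-finite structure that inference does not find *)
Definition sfprod d1 d2 (T1 : measurableType d1) (T2 : measurableType d2)
    (R : realType) (m1 : {sigma_finite_measure set T1 -> \bar R})
    (m2 : {sigma_finite_measure set T2 -> \bar R}) :
    {sigma_finite_measure set (T1 * T2)%type -> \bar R} :=
  HB.pack_for {sigma_finite_measure set (T1 * T2)%type -> \bar R} (m1 \x m2)%E
    (Measure_isSigmaFinite.Build _ _ _ (m1 \x m2)%E (sigma_finite_product_measure1 m1 m2)).

Lemma product_measure1_lty d1 d2 (T1 : measurableType d1) (T2 : measurableType d2)
    (R : realType) (m1 : {sigma_finite_measure set T1 -> \bar R})
    (m2 : {sigma_finite_measure set T2 -> \bar R}) A B : measurable A -> measurable B ->
  (m1 A < +oo)%E -> (m2 B < +oo)%E -> ((m1 \x m2)%E (A `*` B) < +oo)%E.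
Proof.
by move=> mA mB Aoo Boo; rewrite product_measure1E// lte_mul_pinfty// ge0_fin_numE.
Qed.

Section boxes.
Context {R : realType} {d : nat}.
Local Notation Rd := 'rV[R]_d.
Local Notation leb1 := (@lebesgue_measure R).
Local Notation lebd := (@lebesgue_rV R d).

Definition rbox (L : R) : set Rd := [set x | forall i, `[- L, L]%classic (x 0 i)].

Lemma rboxP L x : rbox L x <-> forall i, `|x 0 i| <= L.
Proof. by split => h i; have := h i; rewrite /= in_itv /= ler_norml. Qed.

Lemma rbox_compact L : compact (rbox L).
Proof. exact: (@rV_compact R d (fun=> `[- L, L]%classic) (fun=> @segment_compact R _ _)). Qed.

Lemma measurable_rV_box (A : 'I_d -> set (measurableTypeR R)) :
  (forall i, measurable (A i)) ->
  measurable [set x : Rd | forall i, A i (x 0 i)].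
Proof.
move=> mA; rewrite (_ : mkset _ = \bigcap_(i in setT) (rV_coord i @^-1` A i)).
  apply: fin_bigcap_measurable => [|i _]; first exact: finite_finset.
  by rewrite -[X in measurable X]setTI; exact: measurable_rV_coord.
by apply/seteqP; split => x /= Bx i; [move=> _|]; exact: Bx.
Qed.

Lemma measurable_rbox L : measurable (rbox L).
Proof. by apply: (@measurable_rV_box (fun=> `[- L, L]%classic)) => i; exact: measurable_itv. Qed.

Lemma lebesgue_itv_sym L : 0 <= L -> leb1 `[- L, L]%classic = (2 * L)%:E.
Proof.
move=> L0; rewrite lebesgue_measure_itv /= lte_fin; case: ltP => h.
  by rewrite -EFinB; congr (_%:E); lra.
by congr (_%:E); lra.
Qed.

Lemma lebesgue_rbox L : 0 <= L -> lebd (rbox L) = ((2 * L) ^+ d)%:E.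
Proof.
move=> L0; rewrite (@lebesgue_rV_box R d (fun=> `[- L, L]%classic)); last first.
  by move=> i; exact: measurable_itv.
under eq_bigr do rewrite lebesgue_itv_sym//.
by rewrite prodEFin prodr_const card_ord.
Qed.

Lemma rbox_lty L : (lebd (rbox L) < +oo)%E.
Proof.
have [L0|L0] := leP 0 L; first by rewrite lebesgue_rbox// ltry.
(* For L < 0 the box is empty except when d = 0, where it is the whole one-point space. Comparison
   with [rbox 0] covers both situations. *)
have -> : rbox L = rbox 0 `&` rbox L.
  apply/seteqP; split => [x h|x []//]; split => // i.
  by have := h i; rewrite /= !in_itv /=; move=> /andP[]; lra.
apply: le_lt_trans (_ : lebd (rbox 0) < +oo)%E; last by rewrite lebesgue_rbox// ltry.
apply: le_measure; rewrite ?inE; [|exact: measurable_rbox|by move=> x []].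
by apply: measurableI; exact: measurable_rbox.
Qed.

Definition qbox (a b L : R) : set (R * Rd) := `[a, b]%classic `*` rbox L.

Lemma qbox_compact a b L : compact (qbox a b L).
Proof. by apply: compact_setX; [exact: segment_compact|exact: rbox_compact]. Qed.

Lemma measurable_qbox a b L :
  measurable (qbox a b L : set (measurableTypeR R * Rd)).
Proof. by apply: measurableX; [exact: measurable_itv|exact: measurable_rbox]. Qed.

Lemma qbox_lty a b L : ((leb1 \x lebd)%E (qbox a b L) < +oo)%E.
Proof.
have itvoo : (leb1 `[a, b]%classic < +oo)%E.
  by rewrite lebesgue_measure_itv /=; case: ifP => // _; rewrite -EFinB ltry.
rewrite /qbox product_measure1E//; last exact: measurable_rbox.
by apply: lte_mul_pinfty => //; [rewrite ge0_fin_numE|exact: rbox_lty].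
Qed.

Lemma continuous_qbox_integrable a b L (g : R * Rd -> R) :
  continuous g -> (forall z, ~ qbox a b L z -> g z = 0) ->
  (leb1 \x lebd)%E.-integrable setT (EFin \o g).
Proof.
move=> cg g0; have [C _ gC] := compact_continuous_bounded (@qbox_compact a b L) cg.
apply: (@bounded_support_integrable _ (measurableTypeR R * Rd)%type _
  (leb1 \x lebd)%E (qbox a b L) g C) => //.
- exact: measurable_qbox.
- exact: qbox_lty.
- exact: continuous_measurable_Q.
Qed.

Lemma continuous_rbox_integrable L (g : Rd -> R) :
  continuous g -> (forall z, ~ rbox L z -> g z = 0) ->
  lebd.-integrable setT (EFin \o g).
Proof.
move=> cg g0; have [C _ gC] := compact_continuous_bounded (@rbox_compact L) cg.
apply: (@bounded_support_integrable _ Rd R lebd (rbox L) g C) => //.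
- exact: measurable_rbox.
- exact: rbox_lty.
- exact: continuous_measurable_rV.
Qed.

Lemma lebesgue_itv_lty (a b : R) : (leb1 `[a, b]%classic < +oo)%E.
Proof. by rewrite lebesgue_measure_itv /=; case: ifP => // _; rewrite -EFinB ltry. Qed.

Lemma continuous_itv_integrable a b (g : R -> R) :
  continuous g -> (forall z, ~ `[a, b]%classic z -> g z = 0) ->
  leb1.-integrable setT (EFin \o g).
Proof.
move=> cg g0; have [C _ gC] := compact_continuous_bounded (@segment_compact R a b) cg.
apply: (@bounded_support_integrable _ (measurableTypeR R) R leb1 `[a, b]%classic g C) => //.
- exact: lebesgue_itv_lty.
- exact: continuous_measurable_fun.
Qed.

End boxes.

(** Off a closed set f vanishes in a whole neighbourhood, so derivatives inherit the support. One
    box thus serves for a function and all its derivatives. *)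
Lemma is_derive_closed_support (R : realType) (V : normedModType R) (K : set V)
    (f : V -> R) (v x : V) (l : R) :
  closed K -> (forall y, ~ K y -> f y = 0) -> is_derive x v f l -> ~ K x -> l = 0.
Proof.
move=> cK f0 [df <-] Kx.
rewrite -(derive_cst (0 : R) x v); apply: near_eq_derive.
have : nbhs x (~` K) by apply: open_nbhs_nbhs; split => //; exact: closed_openC.
by apply: filterS => y /f0 ->.
Qed.

(** Restriction to the line through x reduces directional derivatives on any normed space to one
    real variable, where the chain rule and the mean value theorem apply. *)
Lemma is_derive_lineP (R : realType) (V : normedModType R) (f : V -> R) (x v : V) (l : R) :
  is_derive x v f l <-> is_derive (0 : R) 1 (fun h : R => f (x + h *: v)) l.
Proof.
have E : (fun h : R => h^-1 *: ((f \o shift x) (h *: v) - f x)) =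
    (fun h : R => h^-1 *: (((fun k : R => f (x + k *: v)) \o shift 0) (h *: 1) - f (x + 0 *: v))).
  apply/funext => h /=; rewrite scale0r addr0 [h *: v + x]addrC.
  by congr (_ *: (f (x + _ *: v) - _)); rewrite ?addr0 // /GRing.scale /= mulr1.
by split=> -[df ld]; split; move: df ld; rewrite /derivable /derive E.
Qed.

Lemma is_derive_shiftP (R : realType) (V : normedModType R) (f : V -> R) (x v : V) (k l : R) :
  is_derive (x + k *: v) v f l -> is_derive k 1 (fun h : R => f (x + h *: v)) l.
Proof.
move=> /is_derive_lineP h; apply/is_derive_lineP; congr is_derive: h.
by apply/funext => h /=; rewrite -addrA -scalerDl [h *: 1]mulr1.
Qed.

(** * Integrals of derivatives of compactly supported functions vanish *)

Section zero_integral_derivative.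
Context {R : realType}.
Local Notation leb1 := (@lebesgue_measure R).

Lemma Rintegral_derivative_R (f g : R -> R) (a b : R) :
  a < b -> (forall x : R, is_derive x 1 f (g x)) -> continuous g ->
  (forall x, ~ `[a, b]%classic x -> f x = 0) -> \int[leb1]_x g x = 0.
Proof.
move=> ab fg cg f0.
have g0 x : ~ `[a, b]%classic x -> g x = 0.
  apply: (@is_derive_closed_support R R `[a, b]%classic f 1 x (g x)) => //.
  exact: itv_closed.
have cf : continuous f.
  by move=> x; apply: differentiable_continuous; apply/derivable1_diffP; have [] := fg x.
(* The hypothesis allows f to be nonzero at a and b; on the wider interval both end values
   vanish. *)
pose a' := a - 1; pose b' := b + 1.
have ab' : a' < b' by rewrite /a' /b'; lra.
transitivity (\int[leb1]_(x in `[a', b']) g x).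
  rewrite [RHS]Rintegral_mkcond; apply: eq_Rintegral => x _.
  rewrite patchE; case: ifPn => //; rewrite notin_setE => h; apply: g0 => h'.
  by apply: h; move: h'; rewrite /= !in_itv /a' /b' /=; lra.
rewrite /Rintegral (@continuous_FTC2 _ g f a' b')//.
- by rewrite !f0 ?subee//= in_itv /= /a' /b'; lra.
- exact: continuous_subspaceT.
- split; first by move=> x _; have [] := fg x.
    by apply: cvg_at_right_filter; exact: cf.
  by apply: cvg_at_left_filter; exact: cf.
- by move=> x _; rewrite derive1E; have [_ ->] := fg x.
Qed.

(** Induction on the dimension along [rV_cons], which also builds the measure. If i is the first
    coordinate, Fubini puts that variable innermost and the one-variable case applies on each line;
    otherwise the inner integral over the remaining coordinates vanishes by induction. *)
Lemma Rintegral_derivative_rV d (f g : 'rV[R]_d -> R) (i : 'I_d) (L : R) :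
  (forall x, is_derive x (e_ i) f (g x)) -> continuous g ->
  (forall x, ~ rbox L x -> f x = 0) -> \int[@lebesgue_rV R d]_x g x = 0.
Proof.
elim: d f g i L => [|d IH] f g i L; first by case: i.
move=> fg cg f0.
have g0 x : ~ rbox L x -> g x = 0.
  apply: (@is_derive_closed_support _ _ (rbox L) f (e_ i) x (g x)) => //.
  exact: compact_closed (@norm_hausdorff _ _) (@rbox_compact _ _ L).
have cc : continuous (@rV_cons R d).
  move=> z A /nbhs_ballP[e e0 eA]; apply/nbhs_ballP; exists e => // y [yz1 [_ yz2]].
  apply: eA; split => // a b; rewrite !mxE; case: (unlift ord0 b) => [c|]//=.
have mg : measurable_fun setT g by exact: continuous_measurable_rV.
have h0 z : ~ qbox (- L) L L z -> g (rV_cons z) = 0.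
  move=> h; apply: g0 => h'; apply: h; split => [|j] /=.
    by have := h' ord0; rewrite rV_cons0.
  by have := h' (lift ord0 j); rewrite rV_consS.
have ch : continuous (g \o @rV_cons R d).
  by move=> z; apply: continuous_comp; [exact: cc|exact: cg].
have ih := continuous_qbox_integrable ch h0.
have -> : \int[@lebesgue_rV R d.+1]_x g x =
    \int[(leb1 \x @lebesgue_rV R d)%E]_z g (rV_cons z).
  rewrite /Rintegral; congr fine.
  by rewrite (@integral_pushforward _ _ _ _ _ _ (@measurable_rV_cons R d) _ setT (EFin \o g))//;
    exact/measurable_EFinP.
have ir x : (@lebesgue_rV R d).-integrable setT (fun y => (g (rV_cons (x, y)))%:E).
  apply: (@continuous_rbox_integrable _ _ L (fun y => g (rV_cons (x, y)))).
    exact: (continuous_slicer ch).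
  by move=> y h; apply: h0 => -[].
have il y : leb1.-integrable setT (fun x => (g (rV_cons (x, y)))%:E).
  apply: (@continuous_itv_integrable _ (- L) L (fun x => g (rV_cons (x, y)))).
    exact: (continuous_slicel ch).
  by move=> x h; apply: h0 => -[].
have consD x y h (j : 'I_d.+1) : rV_cons (x, y) + h *: e_ j =
    rV_cons (if unlift ord0 j is Some k then (x, y + h *: e_ k) else (x + h, y)) :> 'rV[R]_d.+1.
  have [k ->|->] := unliftP ord0 j.
    apply/rowP => l; have [l' ->|->] := unliftP ord0 l.
      by rewrite !mxE !liftK /= !mxE /= (inj_eq (@lift_inj _ ord0)).
    by rewrite !mxE !unlift_none /= mulr0 addr0.
  apply/rowP => l; have [l' ->|->] := unliftP ord0 l.
    by rewrite !mxE !liftK /= mulr0 addr0.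
  by rewrite !mxE !unlift_none /= mulr1.
have cfI (x : R) (y : 'rV[R]_d) : (rV_cons (x, y) : 'rV[R]_d.+1) 0 ord0 = x by rewrite rV_cons0.
have [j ij|i0] := unliftP ord0 i.
  rewrite Rfubini12//.
  rewrite (@eq_Rintegral _ _ _ leb1 setT (cst 0)) ?Rintegral_cst ?mul0r//=.
  move=> x _; apply: (IH (fun y => f (rV_cons (x, y))) (fun y => g (rV_cons (x, y))) j L).
  - move=> y; apply/is_derive_lineP.
    have /is_derive_lineP := fg (rV_cons (x, y)); congr is_derive.
    by apply/funext => h; rewrite consD ij liftK.
  - exact: (continuous_slicer ch).
  - move=> y h; apply: f0 => h'; apply: h => k.
    by have := h' (lift ord0 k); rewrite rV_consS.
rewrite Rfubini21//.
rewrite (@eq_Rintegral _ _ _ (@lebesgue_rV R d) setT (cst 0)) ?Rintegral_cst ?mul0r//=.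
(* The sign of L is unknown; this interval is nondegenerate and contains [-L, L] in all cases. *)
move=> y _; apply: (@Rintegral_derivative_R (fun x => f (rV_cons (x, y)))
  (fun x => g (rV_cons (x, y))) (- `|L| - 1) (`|L| + 1)).
- by have := normr_ge0 L; lra.
- move=> x; apply/is_derive_lineP.
  have /is_derive_lineP := fg (rV_cons (x, y)); congr is_derive.
  by apply/funext => h; rewrite consD i0 unlift_none [h *: 1]mulr1.
- exact: (continuous_slicel ch).
- move=> x h; apply: f0 => h'; apply: h; have := h' ord0; rewrite cfI /= !in_itv /=.
  by have := ler_norm L; lra.
Qed.

Lemma Rintegral_derivative_Q d (f g : R * 'rV[R]_d -> R) (v : R * 'rV[R]_d) (a b L : R) :
  v = (1, 0) \/ (exists i, v = (0, e_ i)) ->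
  (forall z, is_derive z v f (g z)) -> continuous g ->
  (forall z, ~ qbox a b L z -> f z = 0) ->
  \int[(leb1 \x @lebesgue_rV R d)%E]_z g z = 0.
Proof.
move=> hv fg cg f0.
have g0 z : ~ qbox a b L z -> g z = 0.
  apply: (@is_derive_closed_support _ _ (qbox a b L) f v z (g z)) => //.
  exact: compact_closed (@norm_hausdorff _ _) (@qbox_compact _ _ a b L).
have ih := continuous_qbox_integrable cg g0.
have ir x : (@lebesgue_rV R d).-integrable setT (fun y => (g (x, y))%:E).
  apply: (@continuous_rbox_integrable _ _ L (fun y => g (x, y))).
    exact: continuous_slicer.
  by move=> y h; apply: g0 => -[].
have il y : leb1.-integrable setT (fun x => (g (x, y))%:E).
  apply: (@continuous_itv_integrable _ a b (fun x => g (x, y))).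
    exact: continuous_slicel.
  by move=> x h; apply: g0 => -[].
case: hv => [v1|[i vi]].
  rewrite Rfubini21//.
  rewrite (@eq_Rintegral _ _ _ (@lebesgue_rV R d) setT (cst 0)) ?Rintegral_cst ?mul0r//=.
  move=> y _.
  (* No order between a and b is assumed, so the right end is replaced by a number above both. *)
  apply: (@Rintegral_derivative_R (fun x => f (x, y)) (fun x => g (x, y)) a (`|a| + `|b| + 1)).
  - by have := ler_norm a; have := normr_ge0 b; lra.
  - move=> x; apply/is_derive_lineP.
    have /is_derive_lineP := fg (x, y); congr is_derive.
    apply/funext => h; rewrite v1; congr f; congr (_, _).
    by rewrite /= scaler0 addr0.
  - exact: (continuous_slicel cg).
  - move=> x h; apply: f0 => -[h' _]; apply: h; move: h'; rewrite /= !in_itv /=.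
    by have := ler_norm b; have := normr_ge0 a; lra.
rewrite Rfubini12//.
rewrite (@eq_Rintegral _ _ _ leb1 setT (cst 0)) ?Rintegral_cst ?mul0r//=.
move=> x _.
apply: (@Rintegral_derivative_rV d (fun y => f (x, y)) (fun y => g (x, y)) i L).
- move=> y; apply/is_derive_lineP.
  have /is_derive_lineP := fg (x, y); congr is_derive.
  apply/funext => h; rewrite vi; congr f; congr (_, _).
  by rewrite /= scaler0 addr0.
- exact: (continuous_slicer cg).
- by move=> y h; apply: f0 => -[_].
Qed.

End zero_integral_derivative.

(** * Smooth functions *)

Section smooth.
Context {R : realType}.

Definition smooth (V : normedModType R) (f : V -> R) := forall n, is_Cn n f.

Section closure.
Context {V : normedModType R}.
Implicit Types f g : V -> R.

Lemma is_CnS n f : is_Cn n.+1 f -> is_Cn n f.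
Proof.
elim: n f => [|n IH] f; first by case.
by move=> [cf h]; split => // v; have [d' h'] := h v; split => //; exact: IH.
Qed.

Lemma is_Cn_cst n (c : R) : is_Cn n (fun _ : V => c).
Proof.
elim: n c => [|n IH] c; first by move=> x; exact: cvg_cst.
split; first by move=> x; exact: cvg_cst.
move=> v; split; first by move=> x; exact: derivable_cst.
rewrite (_ : 'D_v _ = fun=> 0); first exact: IH.
by apply/funext => x; exact: derive_cst.
Qed.

Lemma is_CnD n f g : is_Cn n f -> is_Cn n g -> is_Cn n (fun x => f x + g x).
Proof.
elim: n f g => [|n IH] f g.
  by move=> cf cg x; apply: cvgD; [exact: cf|exact: cg].
move=> [cf hf] [cg hg]; split.
  by move=> x; apply: cvgD; [exact: cf|exact: cg].
move=> v; have [df df'] := hf v; have [dg dg'] := hg v; split.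
  by move=> x; exact: derivableD.
rewrite (_ : 'D_v _ = fun x => 'D_v f x + 'D_v g x); first exact: IH.
by apply/funext => x; rewrite deriveD.
Qed.

Lemma is_CnM n f g : is_Cn n f -> is_Cn n g -> is_Cn n (fun x => f x * g x).
Proof.
elim: n f g => [|n IH] f g.
  by move=> cf cg x; apply: cvgM; [exact: cf|exact: cg].
move=> [cf hf] [cg hg]; split.
  by move=> x; apply: cvgM; [exact: cf|exact: cg].
have Cf : is_Cn n f by exact: is_CnS (conj cf hf).
have Cg : is_Cn n g by exact: is_CnS (conj cg hg).
move=> v; have [df df'] := hf v; have [dg dg'] := hg v; split.
  by move=> x; exact: derivableM.
rewrite (_ : 'D_v _ = fun x => f x * 'D_v g x + g x * 'D_v f x).
  by apply: is_CnD; apply: IH.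
by apply/funext => x; rewrite deriveM.
Qed.

Lemma smooth_cst (c : R) : smooth (fun _ : V => c).
Proof. by move=> n; exact: is_Cn_cst. Qed.

Lemma smoothM f g : smooth f -> smooth g -> smooth (fun x => f x * g x).
Proof. by move=> hf hg n; exact: is_CnM. Qed.

Lemma smooth_prod (I : finType) (F : I -> V -> R) :
  (forall i, smooth (F i)) -> smooth (fun x => \prod_i F i x).
Proof.
move=> hF; rewrite (_ : (fun x => _) = \big[*%R/1]_i F i); last first.
  by apply/funext => x; rewrite fct_prodE.
apply: (big_ind (@smooth V)) => // [|f g hf hg]; first exact: smooth_cst.
exact: smoothM.
Qed.

Lemma smooth_continuous f : smooth f -> continuous f.
Proof. by move=> /(_ 0%N). Qed.

Lemma smooth_derivable f x v : smooth f -> derivable f x v.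
Proof. by move=> /(_ 1%N) [_ /(_ v) []]. Qed.

Lemma smooth_is_derive f x v : smooth f -> is_derive x v f ('D_v f x).
Proof. by move=> sf; split => //; exact: smooth_derivable. Qed.

Lemma smooth_derive f v : smooth f -> smooth ('D_v f).
Proof. by move=> sf n; have [_ /(_ v) []] := sf n.+1. Qed.

End closure.

Section affine.
Context {V W : normedModType R} (A : V -> W) (L : V -> W).
Hypothesis cA : continuous A.
Hypothesis AL : forall x h v, A (x + h *: v) = A x + h *: L v.

Lemma is_derive_affine (f : W -> R) x v l :
  is_derive (A x) (L v) f l -> is_derive x v (f \o A) l.
Proof.
move=> /is_derive_lineP h; apply/is_derive_lineP; congr is_derive: h.
by apply/funext => h /=; rewrite AL.
Qed.

(** The derivative of f o A along v is (D_(L v) f) o A, again of the same form, so the induction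
    closes. Projections, coordinates and rescalings are all instances. *)
Lemma is_Cn_affine n (f : W -> R) : is_Cn n f -> is_Cn n (f \o A).
Proof.
elim: n f => [|n IH] f.
  by move=> cf x; apply: continuous_comp; [exact: cA|exact: cf].
move=> [cf hf]; split.
  by move=> x; apply: continuous_comp; [exact: cA|exact: cf].
move=> v; have [df df'] := hf (L v).
have h x : is_derive x v (f \o A) ('D_(L v) f (A x)) by exact: is_derive_affine.
split; first by move=> x; have [] := h x.
by rewrite (_ : 'D_v _ = 'D_(L v) f \o A); [exact: IH|apply/funext => x; have [] := h x].
Qed.

Lemma smooth_affine (f : W -> R) : smooth f -> smooth (f \o A).
Proof. by move=> sf n; exact: is_Cn_affine. Qed.

End affine.

Lemma derive_scale_dir (V : normedModType R) (f : V -> R) x (c : R) v :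
  derivable f x v -> is_derive x (c *: v) f (c * 'D_v f x).
Proof.
move=> df; have /is_derive_lineP h : is_derive x v f ('D_v f x) by split.
apply/is_derive_lineP.
rewrite (_ : (fun h => _) = (fun h => f (x + h *: v)) \o (fun h : R => c * h)); last first.
  by apply/funext => k /=; rewrite scalerA mulrC.
rewrite mulrC; apply: is_derive1_comp; first by rewrite mulr0.
rewrite -[X in is_derive _ _ _ X]mulr1.
exact: is_deriveZ.
Qed.

Lemma derive_dir0 (V : normedModType R) (f : V -> R) x : is_derive x 0 f 0.
Proof.
apply/is_derive_lineP; under eq_fun do rewrite scaler0 addr0.
exact: is_derive_cst.
Qed.

End smooth.

(** * Smooth bumps whose positive powers are smooth *)

Section flat_functions.
Context {R : realType}.
Implicit Types P : {poly R}.

(* e^{-c/x} P(1/x) for 0 < x, extended by 0: a family closed under derivation *)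
Definition flat (c : R) P (x : R) : R :=
  if 0 < x then P.[x^-1] * expR (- (c / x)) else 0.

Lemma horner_growth P :
  exists2 C, 0 <= C & exists k, forall y : R, 1 <= y -> `|P.[y]| <= C * y ^+ k.
Proof.
elim/poly_ind: P => [|P a [C C0 [k hk]]].
  by exists 0 => //; exists 0%N => y _; rewrite horner0 normr0 mul0r.
exists (C + `|a|); first by rewrite addr_ge0.
exists k.+1 => y y1; rewrite hornerMXaddC (le_trans (ler_normD _ _))// mulrDl.
have y0 : 0 <= y by rewrite (le_trans _ y1).
apply: lerD; last by rewrite ler_peMr// exprn_ege1.
by rewrite normrM (ger0_norm y0) exprSr mulrA ler_wpM2r// hk.
Qed.

(** With y = c/x, e^y is the (n+1)-st power of e^(y/(n+1)), which is at least y/(n+1); the claim is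
    the inverse of this inequality. *)
Lemma expRN_decay n (c x : R) : 0 < c -> 0 < x ->
  expR (- (c / x)) <= (n.+1%:R / c * x) ^+ n.+1.
Proof.
move=> c0 x0; have n0 : 0 < n.+1%:R / c by rewrite divr_gt0// ltr0n.
rewrite expRN -[leRHS]invrK lef_pV2 ?posrE ?expR_gt0//; last first.
  by rewrite invr_gt0 exprn_gt0// mulr_gt0.
rewrite -exprVn (_ : c / x = n.+1%:R * (n.+1%:R / c * x)^-1); last first.
  by rewrite !invfM invrK; field; rewrite !gt_eqF//= ltr0n.
rewrite expRM_natl; apply: lerXn2r; rewrite ?nnegrE ?expR_ge0//.
  by rewrite invr_ge0 ltW// mulr_gt0.
by apply: le_trans (expR_ge1Dx _); rewrite lerDr ler01.
Qed.

(** If P(1/x) grows at most like x^-k, exponential decay of order k+2 absorbs it and leaves x^2. The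
    quadratic bound gives derivative 0 at the origin, where the two branches of [flat] meet. *)
Lemma flat_quadratic c P : 0 < c ->
  exists2 C, 0 <= C & forall x, x <= 1 -> `|flat c P x| <= C * x ^+ 2.
Proof.
move=> c0; have [C C0 [k hk]] := horner_growth P.
have n0 : 0 < k.+2%:R / c by rewrite divr_gt0// ltr0n.
exists (C * (k.+2%:R / c) ^+ k.+2) => [|x x1].
  by rewrite mulr_ge0// exprn_ge0// ltW.
rewrite /flat; case: ifPn => [x0|_]; last first.
  by rewrite normr0 mulr_ge0 ?sqr_ge0// mulr_ge0// exprn_ge0// ltW.
have y1 : 1 <= x^-1 by rewrite invf_ge1.
rewrite normrM (gtr0_norm (expR_gt0 _)).
apply: le_trans (ler_wpM2r (expR_ge0 _) (hk _ y1)) _.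
rewrite -[leLHS]mulrA -[leRHS]mulrA ler_wpM2l//.
apply: le_trans (ler_wpM2l _ (expRN_decay k.+1 c0 x0)) _.
  by rewrite exprn_ge0// invr_ge0 ltW.
rewrite exprMn mulrCA; apply: ler_wpM2l; first by rewrite exprn_ge0// ltW.
by rewrite exprVn -(addn2 k) exprD mulKf// gt_eqF// exprn_gt0.
Qed.

(** With y = 1/x and dy/dx = -y^2, the derivative of P(y) e^(-c y) is y^2 (c P - P')(y) e^(-c y). *)
Definition dflat (c : R) P : {poly R} := 'X^2 * (c *: P - P^`()).

Lemma is_derive_flat c P (x : R) : 0 < c ->
  is_derive x 1 (flat c P) (flat c (dflat c P) x).
Proof.
move=> c0; case: (ltgtP x 0) => [x0|x0|->].
- rewrite [flat c _ x]/flat ltNge (ltW x0)/=.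
  apply: (near_eq_is_derive (f := cst 0)).
    near=> y; rewrite /flat ltNge (_ : y <= 0)//.
    by near: y; apply: lt_le_nbhsl.
- rewrite [flat c _ x]/flat x0.
  apply: (@near_eq_is_derive R R R (fun y => P.[y^-1] * expR (- (c / y)))).
    near=> y; rewrite /flat (_ : 0 < y)//.
    by near: y; exact: lt_nbhsr.
  have dV : is_derive x 1 (fun y : R => y^-1) (- x ^- 2).
    have xn : x != 0 by rewrite gt_eqF.
    have := @is_deriveV R id x 1 1 xn (is_derive_id x 1).
    by rewrite /GRing.scale /= mulr1.
  have dP : is_derive x 1 (fun y : R => P.[y^-1]) (P^`().[x^-1] * - x ^- 2).
    exact: (@is_derive1_comp _ (horner P) _ x _ _ (is_derive_poly P x^-1) dV).
  have dE : is_derive x 1 (fun y : R => expR (- (c / y))) (expR (- (c / x)) * (c * x ^- 2)).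
    apply: (@is_derive1_comp _ expR (fun y => - (c / y)) x).
    rewrite -[c * _]opprK -mulrN; apply: is_deriveN.
  have := is_deriveM dP dE.
  rewrite /dflat !hornerE /GRing.scale/= -!exprVn => h.
  congr is_derive: h; ring.
- rewrite [flat c _ 0]/flat ltxx.
  have [C C0 hC] := flat_quadratic P c0.
  have f0 : flat c P 0 = 0 by rewrite /flat ltxx.
  suff : (fun h : R => h^-1 *: ((flat c P \o shift 0) (h *: 1) - flat c P 0)) @ 0^' --> (0:R).
    by move=> h; split; [apply/cvg_ex; exists 0|exact/cvg_lim].
  have C1 : 0 < C + 1 by rewrite ltr_wpDl.
  apply/cvgr0Pnorm_le => e e0; near=> h.
  have h0 : h != 0 by near: h; exact: nbhs_dnbhs_neq.
  rewrite f0 subr0 /= addr0 normrM normfV ler_pdivrMl ?normr_gt0// [h *: 1]mulr1.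
  apply: le_trans (hC _ _) _.
    by near: h; apply: nbhs_dnbhs; apply: lt_le_nbhsl.
  rewrite -real_normK ?num_real// expr2 mulrCA ler_wpM2l//.
  have : `|h| <= e / (C + 1).
    by near: h; apply: dnbhs0_le; rewrite divr_gt0.
  rewrite ler_pdivlMr// mulrDr mulr1 => hh; rewrite mulrC; have := normr_ge0 h; lra.
Unshelve. all: by end_near.
Qed.

Lemma smooth_flat c P : 0 < c -> smooth (flat c P : R -> R).
Proof.
move=> c0.
have cfl Q : continuous (flat c Q).
  move=> x; apply: differentiable_continuous; apply/derivable1_diffP.
  by have [] := is_derive_flat Q x c0.
move=> n; elim: n P => [|n IH] P; first exact: cfl.
split; first exact: cfl.
move=> v.
have h (x : R) : is_derive x v (flat c P) (v * flat c (dflat c P) x).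
  have [d1 d2] := is_derive_flat P x c0.
  rewrite -d2; have := @derive_scale_dir R R (flat c P) x v 1 d1.
  by rewrite [v *: 1]mulr1.
split; first by move=> x; have [] := h x.
rewrite (_ : 'D_v _ = fun x => v * flat c (dflat c P) x).
  by apply: is_CnM; [exact: is_Cn_cst|exact: IH].
by apply/funext => x; have [] := h x.
Qed.

(* The parameter c makes the family stable under positive powers: expbump_powR. *)
Definition expbump (c : R) (s : R) : R := flat c 1 (1 + s) * flat c 1 (1 - s).

Lemma smooth_bump c : 0 < c -> smooth (expbump c : R -> R).
Proof.
move=> c0; apply: smoothM.
  apply: (@smooth_affine R R R (fun s => 1 + s) id); last exact: smooth_flat.
    by move=> x; apply: cvgD; [exact: cvg_cst|exact: cvg_id].
  by move=> x h v; rewrite addrA.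
apply: (@smooth_affine R R R (fun s => 1 - s) (fun s => - s)); last exact: smooth_flat.
  by move=> x; apply: cvgB; [exact: cvg_cst|exact: cvg_id].
by move=> x h v; rewrite scalerN opprD addrA.
Qed.

Lemma expbumpE c s : `|s| < 1 -> expbump c s = expR (- (c / (1 + s) + c / (1 - s))).
Proof.
rewrite ltr_norml => /andP[s1 s2]; rewrite /expbump /flat !hornerC !mul1r.
by rewrite !ifT ?opprD ?expRD//; lra.
Qed.

Lemma expbump0 c s : 1 <= `|s| -> expbump c s = 0.
Proof.
rewrite ler_normr => /orP[] h; rewrite /expbump /flat.
  by rewrite [X in _ * X]ifF ?mulr0//; apply/negbTE; rewrite -leNgt; lra.
by rewrite [X in X * _]ifF ?mul0r//; apply/negbTE; rewrite -leNgt; lra.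
Qed.

Lemma expbump_ge0 c s : 0 <= expbump c s.
Proof.
have [h|h] := ltP `|s| 1; first by rewrite expbumpE// expR_ge0.
by rewrite expbump0.
Qed.

Lemma expbump_gt0 c s : `|s| < 1 -> 0 < expbump c s.
Proof. by move=> h; rewrite expbumpE// expR_gt0. Qed.

Lemma expbump_powR m s : 0 < m -> expbump 1 s `^ m = expbump m s.
Proof.
move=> m0; have [h|h] := ltP `|s| 1; last by rewrite !expbump0// powR0// gt_eqF.
rewrite !expbumpE// /powR gt_eqF ?expR_gt0// expRK; congr expR.
by rewrite mulrN mulrDr !mul1r.
Qed.

End flat_functions.

(** * Mean value theorem, chain rule on a graph, primitives *)

Section calculus_lemmas.
Context {R : realType}.
Local Notation leb1 := (@lebesgue_measure R).

Lemma is_derive_continuous (f : R -> R) (x l : R) :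
  is_derive x 1 f l -> {for x, continuous f}.
Proof. by case=> df _; apply/differentiable_continuous/derivable1_diffP. Qed.

(** A form insensitive to the sign of h, suited to difference quotients. *)
Lemma MVT_from0 (f df : R -> R) (h : R) :
  (forall x : R, is_derive x 1 f (df x)) ->
  exists2 xi, `|xi| <= `|h| & f h - f 0 = df xi * h.
Proof.
move=> fd; have cf : continuous f by move=> x; exact: is_derive_continuous (fd x).
have [h0|h0|->] := ltgtP h 0; last by exists 0 => //; rewrite subrr mulr0.
  have [c] := MVT h0 (fun x _ => fd x) (continuous_subspaceT cf).
  rewrite in_itv /= => /andP[c1 c2] E; exists c; last by have : f 0 - f h = df c * (0 - h) by []; lra.
  by rewrite !ltr0_norm// lerN2 ltW.
have [c] := MVT h0 (fun x _ => fd x) (continuous_subspaceT cf).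
rewrite in_itv /= subr0 => /andP[c1 c2] E; exists c => //.
by rewrite !gtr0_norm// ltW.
Qed.

(** Smoothness here only speaks of directional derivatives, so the chain rule is proved by splitting
    the increment: first z moves with the second argument frozen at g(z + h v), which the mean value
    theorem and the continuity of D_(v,0) phi control; then the second argument moves alone. *)
Lemma is_derive_comp_slice (V : normedModType R) (phi : V * R -> R) (g : V -> R) z v l :
  smooth phi -> is_derive z v g l ->
  is_derive z v (fun x => phi (x, g x))
    ('D_(v, 0) phi (z, g z) + 'D_(0, 1) phi (z, g z) * l).
Proof.
move=> sphi /is_derive_lineP dg; apply/is_derive_lineP.
pose gl h := g (z + h *: v).
have gl0 : gl 0 = g z by rewrite /gl scale0r addr0.
rewrite (_ : (fun h : R => phi _) = (fun h => (phi (z + h *: v, gl h) - phi (z, gl h)))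
    + (fun h => phi (z, gl h))); last first.
  by apply/funext => h; rewrite fctE /= subrK.
apply: is_deriveD; last first.
  apply: (@is_derive1_comp _ (fun y => phi (z, y)) gl 0) => //.
  apply/is_derive_lineP; rewrite gl0.
  have /is_derive_lineP := smooth_is_derive (z, g z) (0, 1) sphi; congr is_derive.
  by apply/funext => h; congr phi; congr (_, _); rewrite /= ?scaler0 ?addr0.
set D := 'D_(v, 0) phi.
pose A h := phi (z + h *: v, gl h) - phi (z, gl h).
suff : h^-1 *: ((A \o shift 0) (h *: 1) - A 0) @[h --> 0^'] --> D (z, g z).
  by move=> h; split; [apply/cvg_ex; exists (D (z, g z))|exact/cvg_lim].
have A0 : A 0 = 0 by rewrite /A scale0r addr0 subrr.
have Ah h : exists2 xi, `|xi| <= `|h| & A h = D (z + xi *: v, gl h) * h.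
  have [x|xi xih E] := @MVT_from0 (fun k => phi (z + k *: v, gl h))
     (fun k => D (z + k *: v, gl h)) h.
    apply/is_derive_lineP.
    have /is_derive_lineP := smooth_is_derive (z + x *: v, gl h) (v, 0) sphi; congr is_derive.
    apply/funext => k; congr phi; congr (_, _); rewrite /= ?scaler0 ?addr0//.
    by rewrite [k *: 1]mulr1 scalerDl addrA.
  by exists xi => //; rewrite -E /A scale0r addr0.
have cD : {for (z, g z), continuous D} by apply: smooth_continuous; exact: smooth_derive.
apply/cvgrPdist_le => e e0.
have /cvgrPdist_le /(_ _ e0) /nbhs_ballP[r /= r0 hr] := cD.
have cgl : {for 0, continuous gl} by exact: is_derive_continuous dg.
near=> h.
have h0 : h != 0 by near: h; exact: nbhs_dnbhs_neq.
have [xi xih E] := Ah h.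
rewrite A0 subr0 /= addr0 [h *: 1]mulr1 E [_ *: _]mulrC mulfK//.
apply: (hr (z + xi *: v, gl h)); split => /=.
  rewrite -ball_normE /= opprD addNKr normrN normrZ.
  apply: le_lt_trans (ler_wpM2r (normr_ge0 _) xih) _.
  apply: (@le_lt_trans _ _ (`|h| * (`|v| + 1))); first by rewrite ler_wpM2l// lerDl.
  rewrite -ltr_pdivlMr; last by rewrite ltr_wpDl.
  by near: h; apply: dnbhs0_lt; rewrite divr_gt0// ltr_wpDl.
rewrite -ball_normE /= -gl0.
by near: h; apply: nbhs_dnbhs; move/cvgrPdist_lt: cgl => /(_ _ r0).
Unshelve. all: by end_near.
Qed.

(** The base point is -1 rather than 0 because P is composed with functions u >= 0 that take the
    value 0, where a two-sided derivative is needed. *)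
Lemma antiderivative (G : R -> R) : continuous G ->
  exists P : R -> R, (forall y : R, -1 < y -> is_derive y 1 P (G y)) /\
    (forall y, 0 <= y -> P y - P 0 = \int[leb1]_(v in `[0, y]) G v).
Proof.
move=> cG; pose P (y : R) : R := \int[leb1]_(v in `[-1, y]) G v; exists P.
have dP (y : R) : -1 < y -> is_derive y 1 P (G y).
  move=> y1; have yy : y < y + 1 by rewrite ltrDl.
  have [||d1 d2] := @continuous_FTC1 R G (BLeft (-1)) y (y + 1) yy _ _ (cG y).
  - by apply: continuous_compact_integrable; [exact: segment_compact|exact: continuous_subspaceT].
  - by rewrite /= lte_fin.
  - by split => //; rewrite -derive1E.
split => // y; rewrite le_eqVlt => /predU1P[<-|y0].
  by rewrite subrr set_itv1 Rintegral_set1.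
rewrite /Rintegral (@continuous_FTC2 _ G P 0 y)//.
- exact: continuous_subspaceT.
- split.
  + by move=> x; rewrite in_itv /= => /andP[x0 _]; have [] // := dP x; lra.
  + by apply: cvg_at_right_filter; apply: is_derive_continuous; apply: dP; lra.
  + by apply: cvg_at_left_filter; apply: is_derive_continuous; apply: dP; lra.
- by move=> x; rewrite in_itv /= => /andP[x0 _]; rewrite derive1E; have [] // := dP x; lra.
Qed.

Lemma continuous_normr_powR (q : R) : 0 < q -> continuous (fun v : R => `|v| `^ q).
Proof.
move=> q0 x; have [->|x0] := eqVneq x 0.
  rewrite /continuous_at /= normr0 powR0 ?gt_eqF//; apply/cvgrPdist_lt => e e0.
  near=> y; rewrite sub0r normrN ger0_norm ?powR_ge0//.
  have : `|y| < e `^ q^-1 by near: y; exact: (@nbhs0_lt R R _ (powR_gt0 _ e0)).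
  move=> /(gt0_ltr_powR q0); rewrite !nnegrE => /(_ (normr_ge0 _) (powR_ge0 _ _)).
  by rewrite -powRrM mulVf ?gt_eqF// powRr1// ltW.
apply: (@continuous_comp _ _ _ (fun v : R => `|v|) (fun y => y `^ q)).
  exact: norm_continuous.
apply: (@is_derive_continuous (fun y => y `^ q) `|x| (q * `|x| `^ (q - 1))).
by apply: is_derive1_powR; rewrite normr_gt0.
Unshelve. all: by end_near.
Qed.

End calculus_lemmas.

(** * Measures carried by a graph *)

Section graph_measure.
Context d (T : measurableType d) (R : realType).
Variables (mu : {sigma_finite_measure set T -> \bar R}) (rho U : T -> R) (z0 : T).
Hypothesis mrho : measurable_fun setT rho.
Hypothesis mU : measurable_fun setT U.
Hypothesis rho0 : forall z, 0 <= rho z.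
Local Notation leb1 := (@lebesgue_measure R).
Local Notation graph := (T * measurableTypeR R)%type.

Let sub : set graph := [set x | (0 <= x.2) && (x.2 < rho x.1)].

Let msub : measurable sub.
Proof.
rewrite (_ : sub = (fun x : graph => (0 <= x.2) && (x.2 < rho x.1)) @^-1` [set true]).
  rewrite -[X in measurable X]setTI.
  have h : measurable_fun setT (fun x : graph => (0 <= x.2) && (x.2 < rho x.1)).
    apply: measurable_and.
      by apply: measurable_fun_ler => //; exact: measurable_snd.
    apply: measurable_fun_ltr; first exact: measurable_snd.
    by apply: measurableT_comp => //; exact: measurable_fst.
  exact: h.
by apply/seteqP; split => x.
Qed.

(* points outside the subgraph of rho are sent above z0, which is only allowed
   to carry junk *)
Let Phi (x : graph) : graph := if (0 <= x.2) && (x.2 < rho x.1) then (x.1, U x.1) else (z0, 0).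

Let mPhi : measurable_fun setT Phi.
Proof.
apply: measurable_fun_ifT.
- apply: measurable_and.
    by apply: measurable_fun_ler => //; exact: measurable_snd.
  apply: measurable_fun_ltr; first exact: measurable_snd.
  by apply: measurableT_comp => //; exact: measurable_fst.
- apply: measurable_fun_pair; first exact: measurable_fst.
  by apply: measurableT_comp => //; exact: measurable_fst.
- exact: measurable_cst.
Qed.

(** The density rho on the graph of U is realised as a length: the region 0 <= y < rho(z) has fibre
    of measure rho(z), and [Phi] collapses this fibre to the point (z, U z). The rest of the product
    goes to z0, possibly with infinite mass, whence the condition that A avoid z0. *)
Lemma graph_measure_ex : exists n : {measure set graph -> \bar R},
  forall A, measurable A -> ~ A z0 -> forall f : graph -> \bar R,
  measurable_fun setT f -> (forall x, 0 <= f x)%E ->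
  (\int[n]_(x in A `*` setT) f x = \int[mu]_(z in A) (f (z, U z) * (rho z)%:E))%E.
Proof.
pose n : {measure set graph -> \bar R} := pushforward (mu \x leb1)%E Phi.
exists (n mPhi) => A mA nA f mf f0.
rewrite /n ge0_integral_pushforward//; [|exact: measurableX|exact: measurable_funTS].
rewrite [RHS]integral_mkcond.
pose g (x : graph) : \bar R := ((f (x.1, U x.1) * (\1_sub x)%:E) * (\1_A x.1)%:E)%E.
have mg : measurable_fun setT g.
  apply: emeasurable_funM; last first.
    by apply/measurable_EFinP; apply: measurableT_comp; [exact: measurable_indic|exact: measurable_fst].
  apply: emeasurable_funM; last by apply/measurable_EFinP; exact: measurable_indic.
  apply: measurableT_comp => //; apply: measurable_fun_pair; first exact: measurable_fst.
  by apply: measurableT_comp => //; exact: measurable_fst.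
have g0 x : (0 <= g x)%E by rewrite /g !mule_ge0// lee_fin.
transitivity (\int[(mu \x leb1)%E]_x g x)%E.
  rewrite integral_mkcond; apply: eq_integral => x _.
  rewrite patchE /g /=; have [xs|xs] := boolP ((0 <= x.2) && (x.2 < rho x.1)).
    rewrite (_ : \1_sub x = 1) ?mule1; last by rewrite indicE mem_set.
    rewrite indicE; have [xA|xA] := boolP (x.1 \in A).
      by rewrite mule1 ifT ?/Phi ?xs// inE /= /Phi xs; split => //; rewrite -inE.
    by rewrite mule0 ifF//; apply/negbTE; rewrite notin_setE /= /Phi xs => -[/=]; rewrite -inE (negbTE xA).
  rewrite (_ : \1_sub x = 0) ?mule0 ?mul0e; last first.
    by rewrite indicE memNset//=; exact/negP.
  by rewrite ifF//; apply/negbTE; rewrite notin_setE /= /Phi (negbTE xs) => -[].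
rewrite fubini_tonelli1//; apply: eq_integral => z _; rewrite /fubini_F /g /= patchE.
transitivity (\int[leb1]_y ((f (z, U z) * (\1_A z)%:E) * (\1_(`[0, rho z[%classic) y)%:E))%E.
  apply: eq_integral => y _; rewrite muleAC; congr (_ * (_)%:E)%E.
rewrite ge0_integralZl//; last 2 first.
- by apply/measurable_EFinP; exact: measurable_indic.
- by rewrite mule_ge0// lee_fin.
have E : leb1 `[0, rho z[%classic = (rho z)%:E.
  rewrite lebesgue_measure_itv /= lte_fin; case: ifPn; first by rewrite sube0.
  by rewrite -leNgt => h; congr (_%:E); apply/eqP; rewrite eq_le h rho0.
rewrite integral_indic//= setIT E indicE.
by case: (z \in A); rewrite ?mule1// mule0 mul0e.
Qed.

(** The formula for nonnegative functions is applied to the positive and negative parts of g;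
    multiplication by rho >= 0 respects this decomposition. *)
Lemma graph_measure_Rintegral (n : {measure set graph -> \bar R}) A :
  (forall f : graph -> \bar R, measurable_fun setT f -> (forall x, 0 <= f x)%E ->
    (\int[n]_(x in A `*` setT) f x = \int[mu]_(z in A) (f (z, U z) * (rho z)%:E))%E) ->
  forall g : graph -> R, measurable_fun setT g ->
  \int[n]_(x in A `*` setT) g x = \int[mu]_(z in A) (g (z, U z) * rho z).
Proof.
move=> nA g mg; rewrite /Rintegral; congr fine; rewrite integralE [RHS]integralE.
have meg : measurable_fun setT (EFin \o g) by exact/measurable_EFinP.
have mp : measurable_fun setT ((fun x => (g x)%:E)^\+)%E by exact: measurable_funepos.
have mn : measurable_fun setT ((fun x => (g x)%:E)^\-)%E by exact: measurable_funeneg.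
rewrite nA// nA//; congr (_ - _)%E; apply: eq_integral => z _.
  by rewrite !funeposE maxe_pMl ?mul0e ?lee_fin.
by rewrite !funenegE maxe_pMl ?mul0e ?lee_fin// EFinM mulNe.
Qed.

End graph_measure.

(** Lebesgue measure is an infimum over countable covers by half-open intervals, so the bound on
    intervals passes to all measurable E by subadditivity. *)
Lemma section_measure_le_lebesgue d (T : measurableType d) (R : realType)
    (n : {measure set (T * measurableTypeR R)%type -> \bar R}) (A : set T) (C : R) :
  measurable A -> 0 < C ->
  (forall p q : R, p < q -> (n (A `*` `]p, q]%classic) <= (C * (q - p))%:E)%E) ->
  forall E : set (measurableTypeR R), measurable E ->
    (n (A `*` E) <= C%:E * lebesgue_measure E)%E.
Proof.
move=> mA C0 nC E mE; have [Eoo|] := ltP (lebesgue_measure E) +oo%E; last first.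
  by rewrite leye_eq => /eqP ->; rewrite gt0_muley ?leey// lte_fin.
apply/lee_addgt0Pr => e e0.
(* A cover of total length below |E| + e/C costs at most e after multiplication by C. *)
have /ereal_inf_lt[z [/= M covEM sMz zEe]] :
    (lebesgue_measure E < lebesgue_measure E + (e / C)%:E)%E.
  by rewrite lte_spaddre ?lte_fin ?divr_gt0// ge0_fin_numE.
have mM k : measurable (M k : set (measurableTypeR R)).
  by case: covEM => /(_ k) + _; exact: sub_sigma_algebra.
apply: (@le_trans _ _ (\sum_(0 <= k <oo) n (A `*` M k))%E).
  apply: measure_sigma_subadditive.
  - by move=> k; exact: measurableX.
  - exact: measurableX.
  - case: covEM => _ EM [t v] [/= At Ev]; have [k _ Mk] := EM v Ev.
    by exists k.
apply: (@le_trans _ _ (\sum_(0 <= k <oo) (C%:E * wlength idfun (M k)))%E).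
  apply: lee_nneseries => // k _.
  have /ocitvP[->|[[p q] /= pq ->]] : ocitv (M k) by case: covEM => /(_ k).
    by rewrite setX0 measure0 wlength0 mule0.
  by rewrite (le_trans (nC p q pq))// (wlength_itv_bnd _ _ _ (ltW pq)) -EFinM.
rewrite nneseriesZl; last by move=> k _; rewrite wlength_ge0.
rewrite sMz (@le_trans _ _ (C%:E * (lebesgue_measure E + (e / C)%:E))%E)//.
  by rewrite lee_pmul2l ?lte_fin// ltW.
have /fineK <- : lebesgue_measure E \is a fin_num by rewrite ge0_fin_numE.
by rewrite -EFinD -!EFinM -EFinD lee_fin mulrDr mulrCA divff ?mulr1// gt_eqF.
Qed.

(* a continuous majorant of the indicator of [p, q] supported in [p - e, q + e] *)
Definition tent {R : realType} (p q e v : R) : R :=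
  let y := 1 - (`|v - p| + `|v - q| - (q - p)) / (2 * e) in (y + `|y|) / 2.

Section tent.
Context {R : realType} (p q e : R).
Hypotheses (pq : p <= q) (e0 : 0 < e).
Local Notation leb1 := (@lebesgue_measure R).

Lemma tent_ge0 v : 0 <= tent p q e v.
Proof. by rewrite /tent; set y := 1 - _; have := ler_norm (- y); move: y => y; rewrite normrN; lra. Qed.

Lemma tent_le1 v : tent p q e v <= 1.
Proof.
move: (pq) (e0) => pq' e0'.
rewrite /tent; set y := 1 - _.
have y1 : y <= 1.
  rewrite lerBlDr lerDl divr_ge0//; last by lra.
  have := ler_norm (- (v - p)); have := ler_norm (v - q); have := ler_norm (v - p).
  by have := ler_norm (- (v - q)); rewrite !normrN; lra.
move: y y1 => y y1; have [h|h] := lerP 0 y.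
  by rewrite ger0_norm//; lra.
by rewrite ltr0_norm//; lra.
Qed.

Lemma tent1 v : p <= v <= q -> tent p q e v = 1.
Proof.
move=> /andP[pv vq]; rewrite /tent ger0_norm ?subr_ge0// ler0_norm ?subr_le0//.
rewrite (_ : v - p - (v - q) - (q - p) = 0); last by lra.
by rewrite mul0r subr0 normr1; lra.
Qed.

Lemma tent0 v : ~ `[p - e, q + e]%classic v -> tent p q e v = 0.
Proof.
move: (pq) (e0) => pq' e0'.
rewrite /= in_itv /= => /negP; rewrite negb_and -!ltNge /tent => h.
set y := 1 - _; suff : y <= 0 by move=> /ler0_norm ->; lra.
rewrite subr_le0 ler_pdivlMr; last by lra.
case/orP: h => h.
  by rewrite !ler0_norm; lra.
by rewrite !ger0_norm; lra.
Qed.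

Lemma continuous_tent : continuous (tent p q e).
Proof.
have cy : continuous (fun v => 1 - (`|v - p| + `|v - q| - (q - p)) / (2 * e)).
  have ca c : continuous (fun v : R => `|v - c|).
    move=> v; apply: (@continuous_comp _ _ _ (fun v => v - c) (fun v => `|v|)).
      by apply: cvgB; [exact: cvg_id|exact: cvg_cst].
    exact: norm_continuous.
  move=> v; apply: cvgB; first exact: cvg_cst.
  apply: cvgM; last exact: cvg_cst.
  apply: cvgB; last exact: cvg_cst.
  by apply: cvgD; exact: ca.
move=> v; apply: cvgM; last exact: cvg_cst.
apply: cvgD; first exact: cy.
by apply: (@continuous_comp _ _ _ _ (fun y : R => `|y|) v (cy v)); exact: norm_continuous.
Qed.

Lemma Rintegral_tent y : \int[leb1]_(v in `[0, y]) tent p q e v <= q - p + 2 * e.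
Proof.
move: (pq) (e0) => pq' e0'.
rewrite Rintegral_mkcond (le_trans (ler_norm _))//.
have -> : q - p + 2 * e = 1 * fine (leb1 `[p - e, q + e]%classic).
  rewrite lebesgue_measure_itv /= lte_fin ifT; last by lra.
  by rewrite -EFinB /=; lra.
apply: (@Rintegral_normr_le _ (measurableTypeR R)) => //.
- exact: lebesgue_itv_lty.
- apply/(measurable_restrictT _ _).1 => //.
  by apply: measurable_funTS; apply: continuous_measurable_fun; exact: continuous_tent.
- move=> v _; rewrite patchE; case: ifPn => _; last by rewrite normr0.
  by rewrite ger0_norm ?tent_ge0// tent_le1.
- by move=> v h; rewrite patchE; case: ifPn => // _; exact: tent0.
Qed.

End tent.

Section continuous_arith.
Context {R : realType} {V : topologicalType}.
Implicit Types f g : V -> R.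

Lemma continuous_mulf f g : continuous f -> continuous g -> continuous (fun x => f x * g x).
Proof. by move=> cf cg x; apply: cvgM; [exact: cf|exact: cg]. Qed.

Lemma continuous_addf f g : continuous f -> continuous g -> continuous (fun x => f x + g x).
Proof. by move=> cf cg x; apply: cvgD; [exact: cf|exact: cg]. Qed.

Lemma continuous_subf f g : continuous f -> continuous g -> continuous (fun x => f x - g x).
Proof. by move=> cf cg x; apply: cvgB; [exact: cf|exact: cg]. Qed.

Lemma continuous_cstf (c : R) : continuous (fun _ : V => c).
Proof. by move=> x; exact: cvg_cst. Qed.

Lemma continuous_sumf (I : finType) (F : I -> V -> R) :
  (forall i, continuous (F i)) -> continuous (fun x => \sum_i F i x).
Proof.
move=> cF; rewrite (_ : (fun x => _) = \sum_i F i); last first.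
  by apply/funext => x; rewrite fct_sumE.
by apply: (big_ind (fun f : V -> R => continuous f)) => // [|f g cf cg];
  [exact: continuous_cstf|exact: continuous_addf].
Qed.

End continuous_arith.

(** * Smooth solutions are entropy solutions *)

Section classical_solution.
Context {R : realType} {d : nat}.
Local Notation Rd := 'rV[R]_d.
Local Notation leb1 := (@lebesgue_measure R).
Local Notation lebd := (@lebesgue_rV R d).
Local Notation Q := (R * Rd)%type.
Local Notation mQ := (measurableTypeR R * Rd)%type.
Variables (T m : R) (u w : Q -> R) (a b L : R).
Hypotheses (hm : 1 < m) (a0 : 0 < a) (bT : b < T).
Hypotheses (su : smooth u) (sw : smooth w) (u0 : forall z, 0 <= u z).
Hypothesis wu : forall z, w z = u z `^ m.
Hypothesis usupp : forall z, ~ qbox a b L z -> u z = 0.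
Local Notation K := (@qbox R d a b L).

Definition dt : Q := (1, 0).
Definition dx (i : 'I_d) : Q := (0, e_ i).

Let KQT z : K z -> QT T z.
Proof.
move=> [/= z1 _]; split => //=; move: z1; rewrite !in_itv /= => /andP[z1 z2].
by rewrite (lt_le_trans a0 z1) (le_lt_trans z2 bT).
Qed.

Let cK : closed K.
Proof. exact: compact_closed (@norm_hausdorff _ _) (@qbox_compact _ _ a b L). Qed.

Lemma measurable_QT : measurable (QT T : set mQ).
Proof. by apply: measurableX => //; exact: measurable_itv. Qed.

Lemma Rintegral_QT (f : Q -> R) : (forall z, ~ K z -> f z = 0) ->
  \int[(leb1 \x lebd)%E]_(z in QT T) f z = \int[(leb1 \x lebd)%E]_z f z.
Proof.
move=> f0; rewrite [LHS]Rintegral_mkcond; apply: eq_Rintegral => z _.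
rewrite patchE; case: ifPn => //; rewrite notin_setE => h.
by rewrite f0// => /KQT.
Qed.

Lemma loc_integrable_QT_continuous (f : R -> Rd -> R) :
  continuous (fun z : Q => f z.1 z.2) -> (forall z, ~ K z -> f z.1 z.2 = 0) -> loc_integrable_QT T f.
Proof.
move=> cf f0; split.
  by apply: measurable_funTS; exact: (continuous_measurable_Q cf).
move=> K' _ _.
have /integrableP[_] := continuous_qbox_integrable cf f0.
apply: le_lt_trans; rewrite integral_mkcond.
apply: le_integral_ge0 => z _; rewrite patchE; case: ifPn => //= _;
  by rewrite ?lee_fin.
Qed.

Lemma derive_supp v z : ~ K z -> 'D_v u z = 0.
Proof.
by move=> Kz; apply: (@is_derive_closed_support _ _ K u v z) => //; exact: smooth_is_derive.
Qed.

Let m0 : m != 0. Proof. by rewrite gt_eqF// (lt_trans ltr01 hm). Qed.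

Lemma w_supp z : ~ K z -> w z = 0.
Proof. by move=> /usupp h; rewrite wu h powR0. Qed.

Lemma derive_w_supp v z : ~ K z -> 'D_v w z = 0.
Proof.
move=> Kz; apply: (@is_derive_closed_support _ _ K w v z) => //; last exact: smooth_is_derive.
exact: w_supp.
Qed.

Lemma derive2_w_supp v v' z : ~ K z -> 'D_v ('D_v' w) z = 0.
Proof.
move=> Kz; apply: (@is_derive_closed_support _ _ K ('D_v' w) v z) => //.
  exact: derive_w_supp.
by apply: smooth_is_derive; exact: smooth_derive.
Qed.

(** Where u > 0 this is the chain rule. Where u = 0, the function w >= 0 has a minimum, so its
    derivative is 0; the right-hand side is 0 as well because m > 1. *)
Lemma derive_wE v z : 'D_v w z = m * u z `^ (m - 1) * 'D_v u z.
Proof.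
have /is_derive_lineP dw := smooth_is_derive z v sw.
have [uz|uz] := eqVneq (u z) 0.
  rewrite uz powR0 ?mulr0 ?mul0r ?gt_eqF ?subr_gt0//.
  have w0 y : 0 <= w y by rewrite wu powR_ge0.
  have dw0 : is_derive (0 : R) 1 (fun h : R => w (z + h *: v)) 0.
    apply: (@derive1_at_min _ _ (-1) 1) => [|t _||t _].
    - lra.
    - have := @is_derive_shiftP R _ w z v t _ (smooth_is_derive _ _ sw).
      by case.
    - by rewrite in_itv /=; lra.
    - by rewrite scale0r addr0 [w z]wu uz powR0.
  have [_ <-] := dw; by have [_ ->] := dw0.
have uz0 : 0 < u z by rewrite lt_neqAle eq_sym uz u0.
have /is_derive_lineP du := smooth_is_derive z v su.
have dw' : is_derive (0 : R) 1 (fun h : R => w (z + h *: v)) (m * u z `^ (m - 1) * 'D_v u z).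
  rewrite (_ : (fun h => _) = (fun y => y `^ m) \o (fun h => u (z + h *: v))); last first.
    by apply/funext => h /=; rewrite wu.
  apply: is_derive1_comp => //; rewrite scale0r addr0.
  exact: is_derive1_powR.
by have [_ <-] := dw; have [_ ->] := dw'.
Qed.

(** F is only known on [0, oo), where u takes its values; P extends it past 0 and makes P(u) - P(0)
    differentiable everywhere. The weak gradient formula is then the vanishing integral of the
    derivative of (P(u) - P(0)) phi. *)
Lemma weak_grad_comp (F f : R -> R) (P : R -> R) : continuous f ->
  (forall y : R, -1 < y -> is_derive y 1 P (f y)) ->
  (forall y, 0 <= y -> F y = P y - P 0) ->
  weak_grad T (fun t x => F (u (t, x))) (fun t x => \row_i (f (u (t, x)) * 'D_(dx i) u (t, x))).
Proof.
move=> cf dP FP i; pose g z := P (u z) - P 0.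
have cu := smooth_continuous su.
have dg v z : is_derive z v g (f (u z) * 'D_v u z).
  have /is_derive_lineP du := smooth_is_derive z v su.
  apply/is_derive_lineP; rewrite -[X in is_derive _ _ _ X]subr0.
  apply: (@is_deriveB R R R (fun h => P (u (z + h *: v))) (cst (P 0))).
  apply: (@is_derive1_comp _ P _ _ _ _ _ du).
  by rewrite scale0r addr0; apply: dP; have := u0 z; lra.
have g0 z : ~ K z -> g z = 0 by move=> /usupp uz; rewrite /g uz subrr.
have cg : continuous g.
  move=> z; apply: cvgB; last exact: cvg_cst.
  apply: (@continuous_comp _ _ _ u P); first exact: cu.
  by apply: is_derive_continuous; apply: dP; have := u0 z; lra.
have gE : (fun z : Q => F (u (z.1, z.2))) = g.
  by apply/funext => -[t x] /=; rewrite FP.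
have cG : continuous (fun z : Q => f (u z) * 'D_(dx i) u z).
  apply: continuous_mulf; last by apply: smooth_continuous; exact: smooth_derive.
  by move=> z; apply: continuous_comp; [exact: cu|exact: cf].
have GE : (fun z : Q => (\row_i0 (f (u (z.1, z.2)) * 'D_(dx i0) u (z.1, z.2))) 0 i) =
    (fun z : Q => f (u z) * 'D_(dx i) u z).
  by apply/funext => -[t x] /=; rewrite mxE.
split.
- by apply: loc_integrable_QT_continuous; rewrite ?gE// => z; move/g0; rewrite -gE.
- apply: loc_integrable_QT_continuous; rewrite ?GE//.
  by move=> [t x] Kz; rewrite mxE derive_supp ?mulr0.
move=> phi [sphi _].
rewrite /= expr1 mulN1r.
have sD : smooth ('D_(dx i) phi) by exact: smooth_derive.
have cphi := smooth_continuous sphi.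
have h1 : forall z, ~ K z -> F (u (z.1, z.2)) * 'D_(dx i) phi z = 0.
  by move=> [t x] Kz; rewrite FP//= usupp// subrr mul0r.
have h2 : forall z, ~ K z -> (\row_i0 (f (u (z.1, z.2)) * 'D_(dx i0) u (z.1, z.2))) 0 i * phi z = 0.
  by move=> [t x] Kz; rewrite mxE derive_supp ?mulr0 ?mul0r.
rewrite !Rintegral_QT//; apply/eqP; rewrite -addr_eq0 -RintegralD//; last 2 first.
- apply: (@continuous_qbox_integrable _ _ a b L (fun z : Q => F (u (z.1, z.2)) * 'D_(dx i) phi z)) => //.
  by apply: continuous_mulf; [rewrite gE|exact: smooth_continuous].
- apply: (@continuous_qbox_integrable _ _ a b L (fun z : Q => (\row_i0 (f (u (z.1, z.2)) * 'D_(dx i0) u (z.1, z.2))) 0 i * phi z)) => //.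
  by apply: continuous_mulf => //; rewrite GE.
apply/eqP; apply: (@Rintegral_derivative_Q R d (fun z => g z * phi z) _ (dx i) a b L).
- by right; exists i.
- move=> z; have := is_deriveM (dg (dx i) z) (smooth_is_derive z (dx i) sphi).
  congr is_derive; case: z => t x; rewrite mxE /g FP//= [phi _ *: _]mulrC.
  by [].
- apply: continuous_addf; apply: continuous_mulf => //; rewrite ?gE ?GE//.
  exact: smooth_continuous.
- by move=> z /g0 ->; rewrite mul0r.
Qed.

Definition bflux (psi : R -> R) (v : R) : R :=
  psi v * (Num.sqrt m * `|v| `^ ((m - 1) / 2)).

Let m10 : 0 < m - 1. Proof. by rewrite subr_gt0. Qed.

Lemma continuous_bflux psi : continuous psi -> continuous (bflux psi).
Proof.
move=> cpsi; apply: continuous_mulf => //; apply: continuous_mulf; first exact: continuous_cstf.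
by apply: continuous_normr_powR; rewrite divr_gt0.
Qed.

Lemma Bpsi_primitive psi : continuous psi -> exists P : R -> R,
  (forall y : R, -1 < y -> is_derive y 1 P (bflux psi y)) /\
  (forall y, 0 <= y -> Bpsi m psi y = P y - P 0).
Proof.
move=> /continuous_bflux /antiderivative[P [dP PE]]; exists P; split => // y y0.
rewrite PE// /Bpsi [X in _ - X](_ : _ = 0) ?subr0//.
move: y0; rewrite le_eqVlt => /predU1P[<-|y0]; first by rewrite set_itv1 Rintegral_set1.
by rewrite set_itv_ge ?Rintegral_set0// bnd_simp -ltNge.
Qed.

Definition Bgrad (psi : R -> R) : R -> Rd -> Rd :=
  fun t x => \row_i (bflux psi (u (t, x)) * 'D_(dx i) u (t, x)).

Lemma weak_grad_Bpsi psi : continuous psi ->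
  weak_grad T (fun t x => Bpsi m psi (u (t, x))) (Bgrad psi).
Proof.
move=> cpsi; have [P [dP PE]] := Bpsi_primitive cpsi.
by apply: weak_grad_comp dP PE; exact: continuous_bflux.
Qed.

Lemma enorm_Bgrad psi z : enorm (Bgrad psi z.1 z.2 0) ^+ 2 =
  \sum_i (bflux psi (u z) * 'D_(dx i) u z) ^+ 2.
Proof.
rewrite /enorm sqr_sqrtr ?sumr_ge0// => [|i _]; last exact: sqr_ge0.
by apply: eq_bigr => i _; rewrite mxE; case: z.
Qed.

Lemma continuous_nonneg_test (psi : R -> R) : nonneg_test psi -> continuous psi.
Proof. by move=> [[/(_ 0%N)]]. Qed.

Lemma continuous_sqrt_comp (psi : R -> R) : continuous psi -> continuous (Num.sqrt \o psi).
Proof. by move=> c x; apply: continuous_comp; [exact: c|exact: sqrt_continuous]. Qed.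

Let cu : continuous u. Proof. exact: smooth_continuous. Qed.
Let cDu v : continuous ('D_v u).
Proof. by apply: smooth_continuous; exact: smooth_derive. Qed.
Let cDw v : continuous ('D_v w).
Proof. by apply: smooth_continuous; exact: smooth_derive. Qed.

Lemma grad_L2 psi : nonneg_test psi ->
  exists2 G, weak_grad T (fun t x => Bpsi m psi (u (t, x))) G &
      (\int[leb1 \x lebd]_(z in QT T) (enorm (G z.1 z.2 0) ^+ 2)%:E < +oo)%E.
Proof.
move=> /continuous_nonneg_test cpsi; exists (Bgrad psi); first exact: weak_grad_Bpsi.
pose g (z : Q) := \sum_i (bflux psi (u z) * 'D_(dx i) u z) ^+ 2.
have cg : continuous g.
  apply: continuous_sumf => i; rewrite (_ : (fun z => _) =
    (fun z => (bflux psi (u z) * 'D_(dx i) u z) * (bflux psi (u z) * 'D_(dx i) u z)))//.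
  apply: continuous_mulf; apply: continuous_mulf => //;
    by move=> z; apply: continuous_comp; [exact: cu|exact: continuous_bflux].
have g0 z : ~ K z -> g z = 0.
  by move=> Kz; rewrite /g big1// => i _; rewrite derive_supp// mulr0 expr0n.
have /integrableP[_] := continuous_qbox_integrable cg g0.
apply: le_lt_trans; rewrite integral_mkcond; apply: le_integral_ge0 => z _.
  by rewrite patchE; case: ifPn => // _; rewrite lee_fin sqr_ge0.
rewrite patchE; case: ifPn => // _; last by rewrite abse_ge0.
by rewrite enorm_Bgrad /= lee_fin ler_norm.
Qed.

Lemma chain_rule_u psi1 psi2 : nonneg_test psi1 -> nonneg_test psi2 ->
    exists G H,
      [/\ weak_grad T (fun t x => Bpsi m psi2 (u (t, x))) G,
          weak_grad T
            (fun t x => Bpsi m (fun v => Num.sqrt (psi1 v) * psi2 v) (u (t, x))) H &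
          {ae (leb1 \x lebd)%E, forall z, QT T z ->
             Num.sqrt (psi1 (u (z.1, z.2))) *: G z.1 z.2 = H z.1 z.2}].
Proof.
move=> /continuous_nonneg_test c1 /continuous_nonneg_test c2.
exists (Bgrad psi2), (Bgrad (fun v => Num.sqrt (psi1 v) * psi2 v)); split.
- exact: weak_grad_Bpsi.
- by apply: weak_grad_Bpsi; apply: continuous_mulf => //; exact: continuous_sqrt_comp.
- by apply/aeW => -[t x] _; apply/rowP => i; rewrite !mxE /bflux !mulrA.
Qed.

(** The parabolic dissipation m u^(m-1) |grad u|^2, written as grad(u^m) . grad u so that its
    continuity is immediate. *)
Definition dissip (z : Q) : R := \sum_i 'D_(dx i) w z * 'D_(dx i) u z.

Lemma dissipE z : dissip z = \sum_i m * u z `^ (m - 1) * 'D_(dx i) u z ^+ 2.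
Proof. by apply: eq_bigr => i _; rewrite derive_wE expr2 !mulrA. Qed.

Lemma dissip_ge0 z : 0 <= dissip z.
Proof.
rewrite dissipE sumr_ge0// => i _.
apply: mulr_ge0; last exact: sqr_ge0.
by apply: mulr_ge0; [rewrite (le_trans ler01)// ltW|exact: powR_ge0].
Qed.

Lemma continuous_dissip : continuous dissip.
Proof. by apply: continuous_sumf => i; exact: continuous_mulf. Qed.

Lemma dissip_supp z : ~ K z -> dissip z = 0.
Proof. by move=> Kz; rewrite /dissip big1// => i _; rewrite derive_supp ?mulr0. Qed.

Lemma bflux_sqr psi y : 0 <= psi y -> 0 <= y ->
  bflux (Num.sqrt \o psi) y ^+ 2 = psi y * (m * y `^ (m - 1)).
Proof.
move=> p0 y0; rewrite /bflux !exprMn sqr_sqrtr// sqr_sqrtr; last first.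
  by rewrite (le_trans ler01)// ltW.
rewrite ger0_norm// -powR_mulrn ?powR_ge0// -powRrM; congr (_ * (_ * _ `^ _)).
by field.
Qed.

(** This identifies the parabolic measure n: it is carried by the graph v = u(t,x) and has density
    [dissip] there. *)
Lemma enorm_Bgrad_sqrt psi z : (forall v, 0 <= psi v) ->
  enorm (Bgrad (Num.sqrt \o psi) z.1 z.2 0) ^+ 2 = psi (u z) * dissip z.
Proof.
move=> p0; rewrite enorm_Bgrad dissipE mulr_sumr; apply: eq_bigr => i _.
by rewrite exprMn bflux_sqr// !mulrA.
Qed.

Section phase_integrals.
Local Notation phase := (mQ * measurableTypeR R)%type.
Variables (f : Q * R -> R) (c1 c2 C : R).
Hypothesis mf : measurable_fun setT (f : phase -> R).
Hypothesis fC : forall z v, K z -> `[c1, c2]%classic v -> `|f (z, v)| <= C.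
Hypothesis f0 : forall z v, ~ (K z /\ `[c1, c2]%classic v) -> f (z, v) = 0.

Let mslice z : measurable_fun setT (fun v : measurableTypeR R => f (z, v)).
Proof. exact: (measurableT_comp mf (measurable_pair1 z)). Qed.

Lemma phase_integrable : (sfprod leb1 lebd \x leb1)%E.-integrable setT (EFin \o (f : phase -> R)).
Proof.
apply: (@bounded_support_integrable _ phase R _ (K `*` `[c1, c2]%classic) f C) => //.
- by apply: measurableX; [exact: measurable_qbox|exact: measurable_itv].
- exact: (@product_measure1_lty _ _ mQ (measurableTypeR R) R (sfprod leb1 lebd) leb1 K
    `[c1, c2]%classic (@measurable_qbox R d a b L) (@measurable_itv R `[c1, c2])
    (@qbox_lty R d a b L) (@lebesgue_itv_lty R c1 c2)).
- by move=> [z v] [/= Kz Iv]; exact: fC.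
- by move=> [z v] h; apply: f0.
Qed.

Lemma phase_slice_integrable z : leb1.-integrable setT (fun v => (f (z, v))%:E).
Proof.
apply: (@bounded_support_integrable _ (measurableTypeR R) R leb1 `[c1, c2]%classic (fun v => f (z, v)) `|C|) => //.
- exact: lebesgue_itv_lty.
- move=> v Iv; have [Kz|Kz] := pselect (K z); first exact: le_trans (fC Kz Iv) (ler_norm _).
  by rewrite f0 ?normr0// => -[].
- by move=> v Iv; rewrite f0// => -[].
Qed.

Lemma phase_Rfubini : \int[(sfprod leb1 lebd \x leb1)%E]_x f x =
  \int[sfprod leb1 lebd]_z \int[leb1]_v f (z, v).
Proof. by rewrite Rfubini12//; [exact: phase_integrable|exact: phase_slice_integrable]. Qed.

End phase_integrals.

Definition source (z : Q) : R := 'D_dt u z - \sum_i 'D_(dx i) ('D_(dx i) w) z.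

(** * The kinetic equation for a smooth nonnegative solution *)

Section kinetic.
Variable phi : Q * R -> R.
Hypothesis sphi : smooth phi.

(** The factor that multiplies the kinetic function in the weak equation: minus the formal adjoint
    of the kinetic operator, applied to phi. *)
Definition kin_Psi (x : Q * R) : R := 'D_(dt, 0) phi x +
  m * `|x.2| `^ (m - 1) * \sum_i 'D_(dx i, 0) ('D_(dx i, 0) phi) x.

Let pv : Q * R -> R := 'D_(0, 1) phi.
Let ph i : Q * R -> R := 'D_(dx i, 0) phi.
Let pc (psi : Q * R -> R) (r : R) (z : Q) := psi (z, r * u z).

(* gt and gx i are the derivatives in t and x_i of compactly supported functions of
   z, namely u phi(z, r u) and m r^(m-1) u^m d_i phi(z, r u), hence the integral of
   Theta (_, r) over z vanishes for every r. Integrating over r in [0, 1] recovers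
   the kinetic function, as v = r u runs through [0, u]. *)
Let gt (x : Q * R) : R := 'D_dt u x.1 * phi (x.1, x.2 * u x.1) +
  u x.1 * ('D_(dt, 0) phi (x.1, x.2 * u x.1) + pv (x.1, x.2 * u x.1) * (x.2 * 'D_dt u x.1)).
Let gx i (x : Q * R) : R := (m * `|x.2| `^ (m - 1)) *
  ('D_(dx i) w x.1 * ph i (x.1, x.2 * u x.1) +
   w x.1 * ('D_(dx i, 0) (ph i) (x.1, x.2 * u x.1) +
     'D_(0, 1) (ph i) (x.1, x.2 * u x.1) * (x.2 * 'D_(dx i) u x.1))).
Let Theta (x : Q * R) : R := gt x + \sum_i gx i x.

Let is_derive_pc psi r v z : smooth psi ->
  is_derive z v (pc psi r) ('D_(v, 0) psi (z, r * u z) + 'D_(0, 1) psi (z, r * u z) * (r * 'D_v u z)).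
Proof.
move=> spsi; apply: (@is_derive_comp_slice R _ psi (fun z => r * u z)) => //.
exact: (is_deriveZ r (smooth_is_derive z v su)).
Qed.

Let cru : continuous (fun x : Q * R => x.2 * u x.1).
Proof.
apply: continuous_mulf; first by move=> x; exact: cvg_snd.
by move=> x; apply: (@continuous_comp _ _ _ fst u); [exact: cvg_fst|exact: cu].
Qed.

Let cpc psi : smooth psi -> continuous (fun x : Q * R => psi (x.1, x.2 * u x.1)).
Proof.
move=> /smooth_continuous cpsi x.
apply: (@continuous_comp _ _ _ (fun x : Q * R => (x.1, x.2 * u x.1)) psi); last exact: cpsi.
by apply: continuous_pair_fun => // y; exact: cvg_fst.
Qed.

Let cfst (f : Q -> R) : continuous f -> continuous (fun x : Q * R => f x.1).
Proof. by move=> cf x; apply: (@continuous_comp _ _ _ fst f); [exact: cvg_fst|exact: cf]. Qed.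

Let csnd (f : R -> R) : continuous f -> continuous (fun x : Q * R => f x.2).
Proof. by move=> cf x; apply: (@continuous_comp _ _ _ snd f); [exact: cvg_snd|exact: cf]. Qed.

Let cabs : continuous (fun x : R => `|x| `^ (m - 1)).
Proof. exact: continuous_normr_powR. Qed.

Let cw : continuous w. Proof. exact: smooth_continuous. Qed.

Let sph i : smooth (ph i). Proof. exact: smooth_derive. Qed.

Let cgt : continuous gt.
Proof.
apply: continuous_addf; first by apply: continuous_mulf; [exact: (cfst (@cDu dt))|exact: (cpc sphi)].
apply: continuous_mulf; first exact: (cfst cu).
apply: continuous_addf; first exact: (cpc (@smooth_derive R _ _ _ sphi)).
apply: continuous_mulf; first exact: (cpc (@smooth_derive R _ _ _ sphi)).
by apply: continuous_mulf; [exact: (csnd (@continuous_id R))|exact: (cfst (@cDu dt))].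
Qed.

Let cgx i : continuous (gx i).
Proof.
apply: continuous_mulf.
  by apply: continuous_mulf; [exact: continuous_cstf|exact: (csnd cabs)].
apply: continuous_addf; first by apply: continuous_mulf; [exact: (cfst (@cDw (dx i)))|exact: (cpc (@sph i))].
apply: continuous_mulf; first exact: (cfst cw).
apply: continuous_addf; first exact: (cpc (@smooth_derive R _ _ _ (@sph i))).
apply: continuous_mulf; first exact: (cpc (@smooth_derive R _ _ _ (@sph i))).
by apply: continuous_mulf; [exact: (csnd (@continuous_id R))|exact: (cfst (@cDu (dx i)))].
Qed.

Let cTheta : continuous Theta.
Proof. exact: (continuous_addf cgt (continuous_sumf cgx)). Qed.

Let gt_supp z r : ~ K z -> gt (z, r) = 0.
Proof. by move=> Kz; rewrite /gt /= derive_supp// usupp// !mul0r addr0. Qed.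

Let gx_supp i z r : ~ K z -> gx i (z, r) = 0.
Proof. by move=> Kz; rewrite /gx /= derive_w_supp// w_supp// !mul0r addr0 mulr0. Qed.

Let Theta_supp z r : ~ K z -> Theta (z, r) = 0.
Proof. by move=> Kz; rewrite /Theta gt_supp// big1 ?addr0// => i _; exact: gx_supp. Qed.

Let int_gt r : \int[(leb1 \x lebd)%E]_z gt (z, r) = 0.
Proof.
apply: (@Rintegral_derivative_Q R d (fun z => u z * pc phi r z) _ dt a b L); first by left.
- move=> z; have := is_deriveM (smooth_is_derive z dt su) (is_derive_pc r dt z sphi).
  by congr is_derive; rewrite /gt /= addrC [pc _ _ _ *: _]mulrC.
- exact: (continuous_slicel cgt).
- by move=> z /usupp ->; rewrite mul0r.
Qed.

Let int_gx i r : \int[(leb1 \x lebd)%E]_z gx i (z, r) = 0.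
Proof.
apply: (@Rintegral_derivative_Q R d
  (fun z => (m * `|r| `^ (m - 1)) * (w z * pc (ph i) r z)) _ (dx i) a b L).
- by right; exists i.
- move=> z; have := is_deriveM (smooth_is_derive z (dx i) sw) (is_derive_pc r (dx i) z (sph i)).
  move=> /(is_deriveZ (m * `|r| `^ (m - 1))).
  by congr is_derive; rewrite /gx /=; congr (_ * _); rewrite addrC; congr (_ + _); exact: mulrC.
- exact: (continuous_slicel (@cgx i)).
- by move=> z /w_supp ->; rewrite mul0r mulr0.
Qed.

Let integrable_slice (f : Q * R -> R) r : continuous f -> (forall z, ~ K z -> f (z, r) = 0) ->
  (leb1 \x lebd)%E.-integrable setT (fun z => (f (z, r))%:E).
Proof.
move=> cf f0; apply: (@continuous_qbox_integrable _ _ a b L (fun z => f (z, r))) => //.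
exact: (continuous_slicel cf).
Qed.

Let int_Theta r : \int[(leb1 \x lebd)%E]_z Theta (z, r) = 0.
Proof.
rewrite /Theta RintegralD//; last 2 first.
- by apply: integrable_slice => // z; exact: gt_supp.
- apply: (@integrable_slice (fun x => \sum_i gx i x)).
    exact: (continuous_sumf cgx).
  by move=> z Kz; rewrite big1// => i _; exact: gx_supp.
rewrite int_gt add0r Rintegral_sumf; last first.
  by move=> i; apply: integrable_slice => // z; exact: gx_supp.
by rewrite big1// => i _; exact: int_gx.
Qed.

Let int2_Theta : \int[(leb1 \x lebd)%E]_z \int[leb1]_(r in `[0, 1]) Theta (z, r) = 0.
Proof.
have [C C0 TC] := compact_continuous_bounded
  (compact_setX (@qbox_compact R d a b L) (@segment_compact R 0 1)) cTheta.
(* [Theta] is compactly supported in z only; the cut-off in r makes it integrable on the product, so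
   that the two integrations can be exchanged. *)
pose h (x : Q * R) := Theta x * \1_(`[0, 1]%classic) x.2.
have hC z v : K z -> `[0, 1]%classic v -> `|h (z, v)| <= C.
  by move=> Kz Iv; rewrite /h indicE mem_set// mulr1; exact: TC.
have h0 z v : ~ (K z /\ `[0, 1]%classic v) -> h (z, v) = 0.
  move=> nKI; rewrite /h indicE /=; have [Iv|Iv] := boolP (v \in `[0, 1]%classic); last by rewrite mulr0.
  by rewrite Theta_supp ?mul0r// => Kz; apply: nKI; split => //; rewrite inE in Iv.
have mh : measurable_fun setT (h : mQ * measurableTypeR R -> R).
  apply: measurable_funM; first exact: continuous_measurable_phase.
  apply: measurableT_comp; last exact: measurable_snd.
  by apply: measurable_indic; exact: measurable_itv.
transitivity (\int[(leb1 \x lebd)%E]_z \int[leb1]_r h (z, r)).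
  apply: eq_Rintegral => z _; rewrite [LHS]Rintegral_mkcond; apply: eq_Rintegral => r _.
  by rewrite patchE /h indicE; case: ifPn; rewrite ?mulr1 ?mulr0.
rewrite -(phase_Rfubini mh hC h0) Rfubini21; last 2 first.
- exact: (phase_integrable mh hC h0).
- move=> r; have := @integrableZr _ _ _ (sfprod leb1 lebd) setT measurableT
    (\1_(`[0, 1]%classic) r) _ (@integrable_slice Theta r cTheta (fun z => @Theta_supp z r)).
  by congr integrable; apply/funext => z; rewrite /= /cst -EFinM.
rewrite (@eq_Rintegral _ _ _ leb1 setT (cst 0)) ?Rintegral_cst ?mul0r//= => r _.
rewrite /h /= RintegralZr ?int_Theta ?mul0r//.
by apply: integrable_slice => // z; exact: Theta_supp.
Qed.

Let ckin : continuous kin_Psi.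
Proof.
apply: continuous_addf; first by apply: smooth_continuous; exact: smooth_derive.
apply: continuous_mulf.
  by apply: continuous_mulf; [exact: continuous_cstf|exact: (csnd cabs)].
by apply: continuous_sumf => i; apply: smooth_continuous; exact: (@smooth_derive R _ _ _ (@sph i)).
Qed.

Let is_derive_slice (psi : Q * R -> R) (z : Q) (y : R) : smooth psi ->
  is_derive y 1 (fun y : R => psi (z, y)) ('D_(0, 1) psi (z, y)).
Proof.
move=> spsi; apply/is_derive_lineP.
have /is_derive_lineP := smooth_is_derive (z, y) (0, 1) spsi; congr is_derive.
by apply/funext => h; congr psi; congr (_, _); rewrite /= ?scaler0 ?addr0.
Qed.

Let slice_Theta z : \int[leb1]_(r in `[0, 1]) Theta (z, r) =
  \int[leb1]_(v in `[0, u z]) kin_Psi (z, v) +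
  ('D_dt u z * phi (z, u z) + \sum_i 'D_(dx i) w z * ph i (z, u z)).
Proof.
have [P [dP PE]] := antiderivative (@continuous_slicer _ _ _ kin_Psi z ckin).
rewrite -PE//.
(* X is a primitive of r -> Theta(z, r) for r > 0. Between r = 0 and r = 1 the term P(r u)
   contributes the integral of [kin_Psi] over [0, u], and the other two terms contribute the
   boundary values at r = 1. *)
pose X1 r := P (r * u z).
pose X2 r := r * ('D_dt u z * phi (z, r * u z)).
pose X3 i r := 'D_(dx i) w z * ph i (z, r * u z).
pose X r := X1 r + (X2 r + `|r| `^ m * \sum_i X3 i r).
have dl (r : R) : is_derive r 1 (fun r => r * u z) (u z).
  have := @is_deriveM R R id (cst (u z)) r 1 _ _ (is_derive_id r 1) (is_derive_cst (u z) r 1).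
  by rewrite scaler0 add0r [_ *: _]mulr1.
have dX1 (r : R) : 0 <= r -> is_derive r 1 X1 (kin_Psi (z, r * u z) * u z).
  move=> r0; apply: (@is_derive1_comp _ P _ _ _ _ _ (dl r)); apply: dP.
  by apply: (@lt_le_trans _ _ 0); [rewrite ltrN10|rewrite mulr_ge0].
have dc psi (r : R) : smooth psi ->
    is_derive r 1 (fun r => psi (z, r * u z)) ('D_(0, 1) psi (z, r * u z) * u z).
  move=> spsi; apply: (@is_derive1_comp _ (fun y => psi (z, y)) _ _ _ _ _ (dl r)).
  exact: is_derive_slice.
have dX2 (r : R) : is_derive r 1 X2 (r * ('D_dt u z * (pv (z, r * u z) * u z)) +
    'D_dt u z * phi (z, r * u z)).
  have h := is_deriveZ ('D_dt u z) (dc phi r sphi).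
  by have := is_deriveM (is_derive_id r 1) h; rewrite [X in _ + X]mulr1.
have dX3 i (r : R) : is_derive r 1 (X3 i) ('D_(dx i) w z * ('D_(0, 1) (ph i) (z, r * u z) * u z)).
  exact: (is_deriveZ ('D_(dx i) w z) (dc (ph i) r (sph i))).
have dX3s (r : R) : is_derive r 1 (fun r => \sum_i X3 i r)
    (\sum_i 'D_(dx i) w z * ('D_(0, 1) (ph i) (z, r * u z) * u z)).
  rewrite (_ : (fun r => _) = \sum_i X3 i); last by apply/funext => s; rewrite fct_sumE.
  exact: is_derive_sum.
have dX (r : R) : 0 < r -> is_derive r 1 X (Theta (z, r)).
  move=> r0; have dm : is_derive r 1 (fun r : R => `|r| `^ m) (m * r `^ (m - 1)).
    apply: (@near_eq_is_derive R R R (fun y => y `^ m)); last exact: is_derive1_powR.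
    near=> y; rewrite gtr0_norm//; near: y; exact: lt_nbhsr.
  have := is_deriveD (dX1 _ (ltW r0)) (is_deriveD (dX2 r) (is_deriveM dm (dX3s r))).
  congr is_derive; rewrite /Theta /gt /kin_Psi /GRing.scale /=.
  have rE : `|r| = r by rewrite gtr0_norm.
  have rm : r `^ m = r * r `^ (m - 1).
    by rewrite -{2}(powRr1 (ltW r0)) -powRD ?subrKC// (gt_eqF r0) implybT.
  have uw : u z `^ (m - 1) * u z = w z.
    rewrite wu; have [->|uz] := eqVneq (u z) 0; first by rewrite mulr0 powR0.
    by rewrite -{2}(powRr1 (u0 z)) -powRD ?subrK// uz implybT.
  (* Two homogeneity relations match X' with [Theta]: u d_i(u^m) = m u^m d_i u, and |r u|^(m-1) u =
     r^(m-1) u^m in [rum] below. *)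
  have dwu i : 'D_(dx i) w z * u z = m * w z * 'D_(dx i) u z by rewrite derive_wE -uw; ring.
  have rum : `|r * u z| `^ (m - 1) * u z = r `^ (m - 1) * w z.
    by rewrite normrM rE (ger0_norm (u0 z)) powRM ?(ltW r0)// -mulrA uw.
  pose s0 := \sum_i 'D_(dx i, 0) ('D_(dx i, 0) phi) (z, r * u z).
  rewrite -/s0 mulrDl.
  have -> : m * `|r * u z| `^ (m - 1) * s0 * u z = m * (`|r * u z| `^ (m - 1) * u z) * s0 by ring.
  rewrite rum rE rm /s0 !mulr_sumr mulr_suml.
  rewrite (_ : \sum_i gx i (z, r) = \sum_i (m * (r `^ (m - 1) * w z) *
       'D_(dx i, 0) ('D_(dx i, 0) phi) (z, r * u z)) +
     (\sum_i r * r `^ (m - 1) * ('D_(dx i) w z * ('D_(0, 1) (ph i) (z, r * u z) * u z)) +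
     \sum_i X3 i r * (m * r `^ (m - 1)))); first by ring.
  rewrite -!big_split; apply: eq_bigr => i _; rewrite /gx /X3 /= rE.
  have -> : 'D_(dx i) w z * ('D_(0, 1) (ph i) (z, r * u z) * u z) =
     'D_(0, 1) (ph i) (z, r * u z) * ('D_(dx i) w z * u z) by ring.
  rewrite dwu -/(ph i).
  move: ('D_(0, 1) (ph i) _) ('D_(dx i, 0) (ph i) _) (ph i _) ('D_(dx i) w z) ('D_(dx i) u z).
  move: (r `^ (m - 1)) (w z) => *; ring.
have cX (r : R) : 0 <= r -> {for r, continuous X}.
  move=> r0; apply: cvgD; first exact: (is_derive_continuous (dX1 r r0)).
  apply: cvgD; first exact: (is_derive_continuous (dX2 r)).
  apply: cvgM; first by apply: continuous_normr_powR; exact: lt_trans hm.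
  exact: (is_derive_continuous (dX3s r)).
rewrite /Rintegral (@continuous_FTC2 R (fun r => Theta (z, r)) X 0 1)//; first last.
- by move=> r; rewrite in_itv /= => /andP[r0 _]; rewrite derive1E; have [_ ->] := dX r r0.
- split; first by move=> r; rewrite in_itv /= => /andP[r0 _]; have [] := dX r r0.
    by apply: cvg_at_right_filter; exact: cX.
  by apply: cvg_at_left_filter; exact: cX.
- by apply: continuous_subspaceT; exact: (@continuous_slicer _ _ _ Theta z cTheta).
rewrite -EFinB /= /X /X1 /X2 /X3 normr0 normr1 powR0// powR1 !mul1r !mul0r addr0 addr0.
by rewrite addrAC.
Unshelve. all: by end_near.
Qed.

(** As u >= 0, the kinetic function is the indicator of [0, u), which differs from [0, u] by a null
    set. *)
Let kin_int z : \int[leb1]_v (kinetic_fun (u z) v * kin_Psi (z, v)) =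
  \int[leb1]_(v in `[0, u z]) kin_Psi (z, v).
Proof.
rewrite -Rintegral_itv_bndo_bndc; last first.
  have i0 : leb1.-integrable `[0, u z] (fun v => (kin_Psi (z, v))%:E).
    apply: continuous_compact_integrable; first exact: segment_compact.
    by apply: continuous_subspaceT; exact: (@continuous_slicer _ _ _ kin_Psi z ckin).
  apply: (integrableS _ _ _ i0) => //.
  by apply: subset_itvl; rewrite bnd_simp.
rewrite [RHS]Rintegral_mkcond; apply: eq_Rintegral => v _.
rewrite patchE /kinetic_fun; case: ifPn => [|].
  by rewrite inE /= in_itv /= => /andP[v0 ->]; rewrite ltNge v0 subr0 mul1r.
rewrite notin_setE /= in_itv /= => /negP; rewrite negb_and -leNgt -ltNge => /orP[v0|uv].
  by rewrite v0 (lt_le_trans v0 (u0 z)) subrr mul0r.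
by rewrite ltNge uv /= ltNge (le_trans (u0 z) uv) subrr mul0r.
Qed.

Let uc (psi : Q * R -> R) z := psi (z, u z).

Let cuc psi : smooth psi -> continuous (uc psi).
Proof.
move=> /smooth_continuous cpsi z; apply: (@continuous_comp _ _ _ (fun z => (z, u z)) psi); last exact: cpsi.
by apply: continuous_pair_fun => //; exact: continuous_id.
Qed.

(** This is [slice_Theta] integrated over z: its left-hand side then vanishes by [int2_Theta], and
    only the boundary terms at r = 1 remain. *)
Let int_kin : \int[(leb1 \x lebd \x leb1)%E]_(x in QTv T) (kinetic_fun (u x.1) x.2 * kin_Psi x) =
  - \int[(leb1 \x lebd)%E]_z ('D_dt u z * phi (z, u z) + \sum_i 'D_(dx i) w z * ph i (z, u z)).
Proof.
have [U U0 uU] := compact_continuous_bounded (@qbox_compact R d a b L) cu.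
have [C C0 kC] := compact_continuous_bounded
  (compact_setX (@qbox_compact R d a b L) (@segment_compact R 0 U)) ckin.
pose h (x : Q * R) := kinetic_fun (u x.1) x.2 * kin_Psi x.
have kin1 y v : `|kinetic_fun y v| <= 1 :> R.
  rewrite /kinetic_fun; case: (v < y); case: (v < 0);
    by rewrite ?subrr ?subr0 ?sub0r ?normrN ?normr1 ?normr0.
have hC z v : K z -> `[0, U]%classic v -> `|h (z, v)| <= C.
  move=> Kz Iv; rewrite /h normrM -[C]mul1r; apply: ler_pM => //.
  exact: kC.
have h0 z v : ~ (K z /\ `[0, U]%classic v) -> h (z, v) = 0.
  move=> nKI; rewrite /h /= (_ : kinetic_fun _ _ = 0) ?mul0r// /kinetic_fun.
  have [v0|v0] := ltP v 0; first by rewrite (lt_le_trans v0 (u0 z)) subrr.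
  have [uv|uv] := ltP v (u z); last by rewrite subrr.
  exfalso; apply: nKI; have Kz : K z.
    by apply: contrapT => /usupp uz; move: uv; rewrite uz ltNge v0.
  split => //; rewrite /= in_itv /= v0 (le_trans (ltW uv))// -(ger0_norm (u0 z)).
  exact: uU.
have mh : measurable_fun setT (h : mQ * measurableTypeR R -> R).
  apply: measurable_funM; last exact: continuous_measurable_phase.
  apply: measurable_funB.
    rewrite (_ : (fun x => _) = (fun x : mQ * measurableTypeR R => if x.2 < u x.1 then 1 else 0 : R)).
      apply: measurable_fun_ifT => //.
      apply: measurable_fun_ltr; first exact: measurable_snd.
      by apply: measurableT_comp; [exact: continuous_measurable_Q|exact: measurable_fst].
    by apply/funext => x; case: ifP.
  rewrite (_ : (fun x => _) = (fun x : mQ * measurableTypeR R => if x.2 < 0 then 1 else 0 : R)).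
    apply: measurable_fun_ifT => //.
    by apply: measurable_fun_ltr => //; exact: measurable_snd.
  by apply/funext => x; case: ifP.
transitivity (\int[(sfprod leb1 lebd \x leb1)%E]_x h x).
  rewrite [LHS]Rintegral_mkcond; apply: eq_Rintegral => -[z v] _.
  rewrite patchE; case: ifPn => //; rewrite notin_setE => hz.
  by rewrite h0// => -[Kz _]; apply: hz; split => //; exact: KQT.
rewrite (phase_Rfubini mh hC h0).
have E : \int[(leb1 \x lebd)%E]_z \int[leb1]_v h (z, v) =
    \int[(leb1 \x lebd)%E]_z \int[leb1]_(r in `[0, 1]) Theta (z, r) -
    \int[(leb1 \x lebd)%E]_z ('D_dt u z * phi (z, u z) + \sum_i 'D_(dx i) w z * ph i (z, u z)).
  have ig : (leb1 \x lebd)%E.-integrable setT (fun z =>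
      ('D_dt u z * phi (z, u z) + \sum_i 'D_(dx i) w z * ph i (z, u z))%:E).
    apply: (@continuous_qbox_integrable _ _ a b L (fun z =>
      'D_dt u z * phi (z, u z) + \sum_i 'D_(dx i) w z * ph i (z, u z))).
      apply: continuous_addf; first exact: (continuous_mulf (@cDu dt) (cuc sphi)).
      by apply: continuous_sumf => i; exact: (continuous_mulf (@cDw (dx i)) (cuc (sph i))).
    move=> z Kz; rewrite derive_supp// mul0r add0r big1// => i _.
    by rewrite derive_w_supp// mul0r.
  have ih : (leb1 \x lebd)%E.-integrable setT (fun z => (\int[leb1]_v h (z, v))%:E).
    exact: (integrable_Rfubini12 (phase_integrable mh hC h0) (phase_slice_integrable mh hC h0)).
  apply/eqP; rewrite -[_ == _]subr_eq opprK -RintegralD//; apply/eqP.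
  apply: eq_Rintegral => z _; rewrite slice_Theta /h kin_int//.
by rewrite [LHS]E int2_Theta sub0r.
Qed.

(** The divergence of phi(z, u(z)) grad w has integral zero. The chain rule on phi(z, u(z)) yields,
    besides d_i phi, the term d_v phi d_i u, which paired with grad w is the dissipation. *)
Let int_byparts : \int[(leb1 \x lebd)%E]_z (\sum_i 'D_(dx i) w z * ph i (z, u z)) =
  - \int[(leb1 \x lebd)%E]_z ((\sum_i 'D_(dx i) ('D_(dx i) w) z) * phi (z, u z) +
      pv (z, u z) * dissip z).
Proof.
pose g i z : R := 'D_(dx i) ('D_(dx i) w) z * phi (z, u z) +
   'D_(dx i) w z * (ph i (z, u z) + pv (z, u z) * 'D_(dx i) u z).
have cDDw i : continuous ('D_(dx i) ('D_(dx i) w)).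
  by apply: smooth_continuous; do 2 apply: smooth_derive.
have spv : smooth pv by exact: smooth_derive.
have cg i : continuous (g i).
  apply: continuous_addf; first exact: (continuous_mulf (@cDDw i) (cuc sphi)).
  apply: continuous_mulf => //; apply: continuous_addf; first exact: (cuc (sph i)).
  exact: (continuous_mulf (cuc spv) (@cDu (dx i))).
have g0 i z : ~ K z -> g i z = 0.
  by move=> Kz; rewrite /g derive2_w_supp// derive_w_supp// !mul0r addr0.
have ig i : \int[(leb1 \x lebd)%E]_z g i z = 0.
  apply: (@Rintegral_derivative_Q R d (fun z => 'D_(dx i) w z * uc phi z) (g i) (dx i) a b L).
  - by right; exists i.
  - move=> z; have sDw : smooth ('D_(dx i) w) by exact: smooth_derive.
    have := is_deriveM (smooth_is_derive z (dx i) sDw)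
      (is_derive_comp_slice sphi (smooth_is_derive z (dx i) su)).
    by congr is_derive; rewrite /g /GRing.scale /= addrC [phi _ * _]mulrC.
  - exact: cg.
  - by move=> z Kz; rewrite derive_w_supp// mul0r.
apply/eqP; rewrite -addr_eq0 -RintegralD//; last 2 first.
- apply: (@continuous_qbox_integrable _ _ a b L (fun z => \sum_i 'D_(dx i) w z * ph i (z, u z))).
    by apply: continuous_sumf => i; exact: (continuous_mulf (@cDw (dx i)) (cuc (sph i))).
  by move=> z Kz; rewrite big1// => i _; rewrite derive_w_supp// mul0r.
- apply: (@continuous_qbox_integrable _ _ a b L (fun z =>
     (\sum_i 'D_(dx i) ('D_(dx i) w) z) * phi (z, u z) + pv (z, u z) * dissip z)).
    apply: continuous_addf; first exact: (continuous_mulf (continuous_sumf cDDw) (cuc sphi)).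
    exact: (continuous_mulf (cuc spv) continuous_dissip).
  move=> z Kz; rewrite dissip_supp// mulr0 addr0 big1 ?mul0r// => i _.
  exact: derive2_w_supp.
apply/eqP; transitivity (\int[(leb1 \x lebd)%E]_z (\sum_i g i z)); last first.
  rewrite Rintegral_sumf; first by rewrite big1.
  by move=> i; apply: (@continuous_qbox_integrable _ _ a b L (g i)) => // z; exact: g0.
apply: eq_Rintegral => z _; rewrite /dissip mulr_suml mulr_sumr -!big_split.
apply: eq_bigr => i _ /=; rewrite /g.
move: ('D_(dx i) w z) ('D_(dx i) u z) (ph i _) (pv _) ('D_(dx i) ('D_(dx i) w) z) (phi _) => *.
ring.
Qed.

Lemma kinetic_identity :
  - (\int[(leb1 \x lebd \x leb1)%E]_(x in QTv T) (kinetic_fun (u x.1) x.2 * kin_Psi x)) =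
  - (\int[(leb1 \x lebd)%E]_(z in QT T) (pv (z, u z) * dissip z))
  + \int[(leb1 \x lebd)%E]_(z in QT T) (source z * phi (z, u z)).
Proof.
have cDDw i : continuous ('D_(dx i) ('D_(dx i) w)).
  by apply: smooth_continuous; do 2 apply: smooth_derive.
have spv : smooth pv by exact: smooth_derive.
have iD : forall f : Q -> R, continuous f -> (forall z, ~ K z -> f z = 0) ->
  (leb1 \x lebd)%E.-integrable setT (fun z => (f z)%:E).
  by move=> f cf f0; exact: (continuous_qbox_integrable cf f0).
have i1 := iD _ (continuous_mulf (@cDu dt) (cuc sphi)).
have i2 := iD _ (continuous_mulf (cuc spv) continuous_dissip).
have i3 := iD _ (continuous_mulf (continuous_sumf cDDw) (cuc sphi)).
have i4 := iD _ (continuous_sumf (fun i => continuous_mulf (@cDw (dx i)) (cuc (sph i)))).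
rewrite int_kin opprK Rintegral_QT; last by move=> z Kz; rewrite dissip_supp ?mulr0.
rewrite Rintegral_QT; last first.
  move=> z Kz; rewrite /source derive_supp// sub0r big1 ?oppr0 ?mul0r// => i _.
  exact: derive2_w_supp.
have {}i1 : (leb1 \x lebd)%E.-integrable setT (fun z => ('D_dt u z * phi (z, u z))%:E).
  by apply: i1 => z Kz; rewrite derive_supp ?mul0r.
have {}i2 : (leb1 \x lebd)%E.-integrable setT (fun z => (pv (z, u z) * dissip z)%:E).
  by apply: i2 => z Kz; rewrite dissip_supp ?mulr0.
have {}i3 : (leb1 \x lebd)%E.-integrable setT
    (fun z => ((\sum_i 'D_(dx i) ('D_(dx i) w) z) * phi (z, u z))%:E).
  by apply: i3 => z Kz; rewrite big1 ?mul0r// => i _; exact: derive2_w_supp.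
have {}i4 : (leb1 \x lebd)%E.-integrable setT
    (fun z => (\sum_i 'D_(dx i) w z * ph i (z, u z))%:E).
  by apply: i4 => z Kz; rewrite big1// => i _; rewrite derive_w_supp ?mul0r.
rewrite RintegralD// int_byparts RintegralD// opprD addrA addrC; congr (_ + _).
rewrite -RintegralB//; apply: eq_Rintegral => z _.
by rewrite /source mulrBl.
Qed.

End kinetic.

Definition laplace_w (z : Q) : R := \sum_i 'D_(dx i) ('D_(dx i) w) z.

Let cDDw i : continuous ('D_(dx i) ('D_(dx i) w)).
Proof. by apply: smooth_continuous; do 2 apply: smooth_derive. Qed.

Let laplace_supp z : ~ K z -> laplace_w z = 0.
Proof. by move=> Kz; rewrite /laplace_w big1// => i _; exact: derive2_w_supp. Qed.

(* Green's formula: the dissipation tested with psi(u) is -Psi(u) Lap(u^m) with Psi' = psi *)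
Lemma dissip_bound : exists2 C, 0 < C & forall (psi : R -> R) (I : R), continuous psi ->
  (forall v, 0 <= psi v) -> (forall y, 0 <= y -> \int[leb1]_(v in `[0, y]) psi v <= I) ->
  \int[(leb1 \x lebd)%E]_z (psi (u z) * dissip z) <= C * I.
Proof.
have cL : continuous laplace_w by exact: continuous_sumf.
have [C C0 LC] := compact_continuous_bounded (@qbox_compact R d a b L) cL.
have mK0 : 0 <= fine ((leb1 \x lebd)%E K) by rewrite fine_ge0.
(* The summand 1 keeps the constant positive even if the box has measure zero. *)
exists (C * (fine ((leb1 \x lebd)%E K) + 1)); first by rewrite mulr_gt0// ltr_wpDl.
move=> psi I cpsi psi0 psiI.
have [P [dP PE]] := antiderivative cpsi.
(* F is Psi(u) with Psi(0) = 0. The hypothesis on psi enters only through 0 <= F <= I. *)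
pose F z := P (u z) - P 0.
have F0 z : 0 <= F z <= I.
  by rewrite /F PE// psiI// andbT; apply: Rintegral_ge0.
have dF v z : is_derive z v F (psi (u z) * 'D_v u z).
  have /is_derive_lineP du := smooth_is_derive z v su.
  apply/is_derive_lineP; rewrite -[X in is_derive _ _ _ X]subr0.
  apply: (@is_deriveB R R R (fun h => P (u (z + h *: v))) (cst (P 0))).
  apply: (@is_derive1_comp _ P _ _ _ _ _ du).
  by rewrite scale0r addr0; apply: dP; have := u0 z; lra.
have cF : continuous F.
  move=> z; apply: cvgB; last exact: cvg_cst.
  apply: (@continuous_comp _ _ _ u P); first exact: cu.
  by apply: is_derive_continuous; apply: dP; have := u0 z; lra.
have cpu : continuous (fun z => psi (u z)).
  by move=> z; apply: continuous_comp; [exact: cu|exact: cpsi].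
pose g i z := psi (u z) * 'D_(dx i) u z * 'D_(dx i) w z + F z * 'D_(dx i) ('D_(dx i) w) z.
have g0 i z : ~ K z -> g i z = 0.
  by move=> Kz; rewrite /g derive_supp// derive2_w_supp// !mulr0 mul0r addr0.
have cg i : continuous (g i).
  by apply: continuous_addf; repeat apply: continuous_mulf.
have ig i : \int[(leb1 \x lebd)%E]_z g i z = 0.
  apply: (@Rintegral_derivative_Q R d (fun z => F z * 'D_(dx i) w z) (g i) (dx i) a b L).
  - by right; exists i.
  - move=> z; have sDw : smooth ('D_(dx i) w) by exact: smooth_derive.
    have := is_deriveM (dF (dx i) z) (smooth_is_derive z (dx i) sDw).
    by congr is_derive; rewrite /g /GRing.scale /= addrC [_ * 'D_(dx i) w z]mulrC.
  - exact: cg.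
  - by move=> z Kz; rewrite derive_w_supp// mulr0.
have E : \int[(leb1 \x lebd)%E]_z (psi (u z) * dissip z) =
    - \int[(leb1 \x lebd)%E]_z (F z * laplace_w z).
  apply/eqP; rewrite -addr_eq0 -RintegralD//; last 2 first.
  - apply: (@continuous_qbox_integrable _ _ a b L (fun z => psi (u z) * dissip z)).
      exact: (continuous_mulf cpu continuous_dissip).
    by move=> z Kz; rewrite dissip_supp// mulr0.
  - apply: (@continuous_qbox_integrable _ _ a b L (fun z => F z * laplace_w z)).
      exact: (continuous_mulf cF cL).
    by move=> z Kz; rewrite laplace_supp// mulr0.
  apply/eqP; transitivity (\int[(leb1 \x lebd)%E]_z (\sum_i g i z)); last first.
    rewrite Rintegral_sumf; first by rewrite big1.
    by move=> i; apply: (@continuous_qbox_integrable _ _ a b L (g i)) => // z; exact: g0.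
  apply: eq_Rintegral => z _; rewrite /dissip /laplace_w !mulr_sumr -!big_split.
  by apply: eq_bigr => i _ /=; rewrite /g ['D_(dx i) w z * _]mulrC mulrA.
rewrite E (le_trans (ler_norm _))// normrN.
have FL z : K z -> `|F z * laplace_w z| <= I * C.
  move=> Kz; rewrite normrM; apply: ler_pM => //; last exact: LC.
  by have /andP[h1 h2] := F0 z; rewrite ger0_norm.
apply: le_trans (@Rintegral_normr_le _ mQ R (leb1 \x lebd)%E K (fun z => F z * laplace_w z) (I * C) _ _ _ FL _) _.
- exact: measurable_qbox.
- exact: qbox_lty.
- by apply: continuous_measurable_Q; exact: (continuous_mulf cF cL).
- by move=> z Kz; rewrite laplace_supp// mulr0.
have I0 : 0 <= I by have /andP[h1 h2] := F0 (0, 0); exact: le_trans h2.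
rewrite [I * _]mulrC -!mulrA ler_wpM2l//; first exact: ltW.
by rewrite mulrC ler_wpM2r// lerDl.
Qed.

Local Notation phase := (mQ * measurableTypeR R)%type.

Section defect.
Variable n : {measure set phase -> \bar R}.
Hypothesis hn : forall A : set mQ, measurable A -> A `<=` QT T -> forall f : phase -> \bar R,
  measurable_fun setT f -> (forall x, 0 <= f x)%E ->
  (\int[n]_(x in A `*` setT) f x =
   \int[leb1 \x lebd]_(z in A) (f (z, u z) * (dissip z)%:E))%E.

Let n_section E : measurable E -> n (QT T `*` E) =
  (\int[leb1 \x lebd]_(z in QT T) ((\1_E (u z) * dissip z)%:E))%E.
Proof.
move=> mE; have mI : measurable_fun setT (fun x : phase => (\1_E x.2)%:E : \bar R).
  apply/measurable_EFinP; apply: measurableT_comp; last exact: measurable_snd.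
  exact: measurable_indic.
under eq_integral do rewrite EFinM.
rewrite -(hn measurable_QT (@subset_refl _ _) mI); last by move=> x; rewrite lee_fin.
rewrite (_ : (fun x : phase => _) = (fun x => (\1_(setT `*` E) x)%:E)); last first.
  apply/funext => -[z v] /=; rewrite !indicE (_ : ((z, v) \in setT `*` E) = (v \in E))//.
  by rewrite in_setX in_setT.
rewrite integral_indic; last 2 first.
- by apply: measurableX => //; exact: measurable_QT.
- exact: measurableX.
congr (n _); apply/seteqP; split => [[z v] [/= h1 h2]|[z v] [[/= _ h1] [/= h2 _]]] //.
Qed.

(** On a strip p < v <= q the indicator is dominated by a tent, and [dissip_bound] controls the
    dissipation weighted by the tent by C times its integral. Hence the marginal of n is at most C
    dv on intervals, then on all measurable sets. *)
Lemma defect_bound_dissip : defect_bound T (mzero : {measure set phase -> \bar R}) n.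
Proof.
have [U U0 uU] := compact_continuous_bounded (@qbox_compact R d a b L) cu.
have uI z : `[0, U]%classic (u z).
  rewrite /= in_itv /= u0; have [Kz|Kz] := pselect (K z).
    by rewrite -(ger0_norm (u0 z)) uU.
  by rewrite usupp// ltW.
have [C C0 dC] := dissip_bound.
have nI (p q : R) : p < q -> (n (QT T `*` `]p, q]%classic) <= (C * (q - p))%:E)%E.
  move=> pq; rewrite n_section//; apply/lee_addgt0Pr => e e0.
  (* The tent exceeds the strip by at most 2 e' in integral, which costs 2 C e' = e. *)
  pose e' := e / (2 * C); have e'0 : 0 < e' by rewrite divr_gt0// mulr_gt0.
  have cT := @continuous_tent R p q e'.
  have cg : continuous (fun z => tent p q e' (u z) * dissip z).
    apply: continuous_mulf; last exact: continuous_dissip.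
    by move=> z; apply: continuous_comp; [exact: cu|exact: cT].
  have g0 z : ~ K z -> tent p q e' (u z) * dissip z = 0.
    by move=> Kz; rewrite dissip_supp// mulr0.
  have ig := continuous_qbox_integrable cg g0.
  apply: (@le_trans _ _ (\int[leb1 \x lebd]_z (tent p q e' (u z) * dissip z)%:E)%E).
    rewrite integral_mkcond; apply: le_integral_ge0 => z _.
      rewrite patchE; case: ifPn => // _; rewrite lee_fin mulr_ge0// ?dissip_ge0//.
    rewrite patchE; case: ifPn => _; last first.
      by rewrite lee_fin mulr_ge0 ?tent_ge0 ?dissip_ge0.
    rewrite lee_fin ler_wpM2r ?dissip_ge0// indicE.
    have [uz|_] := boolP (u z \in _); last by rewrite tent_ge0.
    by rewrite tent1//; move: uz; rewrite inE /= in_itv /= => /andP[/ltW -> ->].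
  rewrite -(fineK (integrable_fin_num measurableT ig)) -EFinD lee_fin.
  have -> : C * (q - p) + e = C * (q - p + 2 * e').
    by rewrite /e'; field; rewrite gt_eqF.
  apply: dC => // [v|y _]; first exact: tent_ge0.
  by apply: Rintegral_tent => //; exact: ltW.
(* Since n only charges values v = u(z), which lie in [0, U], the constant bound can be cut off
   there; this gives the decay at infinity. *)
pose mu0 (v : measurableTypeR R) : R := C * \1_(`[0, U]%classic) v.
exists mu0.
have mI : measurable (`[0, U]%classic : set (measurableTypeR R)) by exact: measurable_itv.
split.
- by apply: measurable_funM => //; exact: measurable_indic.
- rewrite unlock; case: ifPn => // _.
  apply: (@le_lt_trans _ _ C%:E); last exact: ltry.
  apply/ess_supP; apply/aeW => v /=; rewrite lee_fin ger0_norm; last first.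
    by rewrite mulr_ge0// ltW.
  by rewrite /mu0 indicE; case: (_ \in _); rewrite ?mulr1// mulr0 ltW.
- apply: cvg_near_cst; near=> v; rewrite /mu0 indicE memNset ?mulr0//= in_itv /=.
  apply/negP; rewrite negb_and -!ltNge; apply/orP; right.
  by near: v; apply: nbhs_pinfty_gt; exact: num_real.
- apply: cvg_near_cst; near=> v; rewrite /mu0 indicE memNset ?mulr0//= in_itv /=.
  apply/negP; rewrite negb_and -!ltNge; apply/orP; left.
  by near: v; apply: nbhs_ninfty_lt; exact: num_real.
- move=> E mE; rewrite /mzero/= add0e.
  have -> : n (QT T `*` E) = n (QT T `*` (E `&` `[0, U]%classic)).
    rewrite !n_section//; last exact: measurableI.
    apply: eq_integral => z _; rewrite indicI /=; congr ((_ * _)%:E).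
    by rewrite [X in _ = _ * X]indicE mem_set ?mulr1//; exact: uI.
  apply: le_trans (section_measure_le_lebesgue measurable_QT C0 nI _) _.
    exact: measurableI.
  under eq_integral do rewrite EFinM.
  rewrite ge0_integralZl//; last 2 first.
  + by apply/measurable_EFinP; apply: measurable_funTS; exact: measurable_indic.
  + by rewrite lee_fin ltW.
  by rewrite integral_indic// setIC.
Unshelve. all: by end_near.
Qed.

End defect.

Lemma cont_L1_u : cont_L1 T (fun t x => u (t, x)).
Proof.
have iu t : lebd.-integrable setT (fun x => (u (t, x))%:E).
  apply: (@continuous_rbox_integrable _ _ L (fun x => u (t, x))).
    exact: (continuous_slicer cu).
  by move=> x h; apply: usupp => -[].
split=> // t0 _.
have [M M0 uM] := compact_continuous_bounded (@qbox_compact R d a b L) (@cDu dt).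
have duM z : `|'D_dt u z| <= M.
  by have [Kz|Kz] := pselect (K z); [exact: uM|rewrite derive_supp// normr0 ltW].
have lip t x : `|u (t, x) - u (t0, x)| <= M * `|t - t0|.
  have [y|xi _ E] := @MVT_from0 R (fun h => u ((t0, x) + h *: dt)) (fun h => 'D_dt u ((t0, x) + h *: dt)) (t - t0).
    by apply: is_derive_shiftP; exact: smooth_is_derive.
  move: E; rewrite scale0r addr0 (_ : (t0, x) + (t - t0) *: dt = (t, x)); last first.
    by congr (_, _); rewrite /= ?scaler0 ?addr0// [_ *: _]mulr1 addrC subrK.
  by move=> ->; rewrite normrM ler_wpM2r.
(* Lipschitz continuity in time on a fixed box of finite volume makes t -> u(t) Lipschitz in L^1
   with this constant. *)
pose c := M * fine (lebd (rbox L)).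
apply: (@squeeze_cvge _ _ _ _ (cst 0%E) _ (fun t => (c * `|t - t0|)%:E)).
- near=> t; apply/andP; split; first by apply: integral_ge0 => x _; rewrite lee_fin.
  apply: (@le_trans _ _ (\int[lebd]_(x in rbox L) (M * `|t - t0|)%:E)%E).
    rewrite [leRHS]integral_mkcond; apply: le_integral_ge0 => x _; first by rewrite lee_fin.
    rewrite patchE; case: ifPn => [_|]; first by rewrite lee_fin.
    by rewrite notin_setE => h; rewrite !usupp ?subrr ?normr0// => -[].
  rewrite integral_cst; last exact: measurable_rbox.
  have /fineK h : lebd (rbox L) \is a fin_num by rewrite ge0_fin_numE//; exact: rbox_lty.
  by rewrite -[X in (_ * X)%E]h -EFinM lee_fin /c mulrAC.
- exact: cvg_cst.
- apply: cvg_within_filter.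
  have -> : 0%E = (c * `|t0 - t0|)%:E :> \bar R by rewrite subrr normr0 mulr0.
  apply: cvg_EFin; first by near=> t.
  have cc : continuous (fun t : R => c * `|t - t0|).
    apply: continuous_mulf; first exact: continuous_cstf.
    move=> s; apply: (@continuous_comp _ _ _ (fun s => s - t0) (fun s => `|s|)).
      by apply: cvgB; [exact: cvg_id|exact: cvg_cst].
    exact: norm_continuous.
  exact: cc.
Unshelve. all: by end_near.
Qed.

Lemma classical_entropy_solution :
  entropy_solution m T (fun=> 0) (fun t x => source (t, x)) (fun t x => u (t, x)).
Proof.
(* The junk point has time -1, hence lies outside (0,T) x R^d. *)
have [n hn0] := @graph_measure_ex _ mQ R (sfprod leb1 lebd) dissip u (-1, 0)
  (continuous_measurable_Q continuous_dissip) (continuous_measurable_Q cu) dissip_ge0.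
have hn : forall A : set mQ, measurable A -> A `<=` QT T -> forall f : phase -> \bar R,
  measurable_fun setT f -> (forall x, 0 <= f x)%E ->
  (\int[n]_(x in A `*` setT) f x =
   \int[leb1 \x lebd]_(z in A) (f (z, u z) * (dissip z)%:E))%E.
  move=> A mA AQ; apply: hn0 => // /AQ[/=]; rewrite in_itv /= => /andP[]; lra.
have uE : (fun z : mQ => u (z.1, z.2)) = u by apply/funext => -[].
split.
- by apply: measurable_funTS; rewrite uE; exact: (continuous_measurable_Q cu).
- exact: cont_L1_u.
- apply/aeW => x; apply: usupp => -[/=]; rewrite in_itv /= => /andP[+ _] _.
  by rewrite leNgt a0.
- exact: grad_L2.
- exact: chain_rule_u.
- exists mzero, n; split; last exact: defect_bound_dissip.
  + move=> psi tpsi; exists (Bgrad (Num.sqrt \o psi)).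
      by apply: weak_grad_Bpsi; apply: continuous_sqrt_comp; exact: continuous_nonneg_test.
    move=> A mA AQ; have [_ psi0] := tpsi.
    rewrite (hn A mA AQ (fun x => (psi x.2)%:E)); last 2 first.
    * apply/measurable_EFinP; apply: measurableT_comp; last exact: measurable_snd.
      by apply: continuous_measurable_fun; exact: continuous_nonneg_test.
    * by move=> x; rewrite lee_fin.
    by apply: eq_integral => z _; rewrite enorm_Bgrad_sqrt// EFinM.
  + move=> phi [sphi _].
    have cpv : continuous ('D_(0, 1) phi : Q * R -> R).
      by apply: smooth_continuous; exact: smooth_derive.
    have nE := @graph_measure_Rintegral _ mQ R (sfprod leb1 lebd) dissip u dissip_ge0 n (QT T)
      (hn _ measurable_QT (@subset_refl _ _)) _ (continuous_measurable_phase cpv).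
    rewrite [X in _ = - X - _ + _](_ : _ = 0); last first.
      by rewrite /Rintegral integral_measure_zero.
    rewrite oppr0 add0r.
    rewrite [X in _ = - X + _](_ : _ = \int[(leb1 \x lebd)%E]_(z in QT T)
      ('D_(0, 1) phi (z, u z) * dissip z)); last exact: nE.
    rewrite -[X in _ = _ + X](_ : \int[(leb1 \x lebd)%E]_(z in QT T) (source z * phi (z, u z)) = _);
      last by apply: eq_Rintegral => -[].
    rewrite -(kinetic_identity sphi); congr (- _).
    by apply: eq_Rintegral => -[[t x] v] _.
Qed.

End classical_solution.

(** * Lower bounds for the Sobolev norms *)

(** As |th| <= M and th lives on I, the integral of |k| over I is at least |int th k| / M; the
    affine minorant of F is then integrated over I. F is a power of a norm in the applications and
    is not assumed measurable. *)
Lemma averaging_bound d (Om : measurableType d) (R : realType) (mu : {measure set Om -> \bar R}) (I : set Om) (k th : Om -> R)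
    (F : Om -> \bar R) (M kap eps : R) :
  measurable I -> (mu I < +oo)%E -> mu.-integrable setT (EFin \o k) ->
  measurable_fun setT th -> 0 < M -> (forall x, `|th x| <= M) -> (forall x, ~ I x -> th x = 0) ->
  0 <= kap -> (forall x, 0 <= F x)%E -> (forall x, I x -> ((kap * (`|k x| - eps))%:E <= F x)%E) ->
  ((kap * (`|\int[mu]_x (th x * k x)| / M - eps * fine (mu I)))%:E <= \int[mu]_x F x)%E.
Proof.
move=> mI Ioo ik mth M0 thM th0 kap0 F0 kF.
have mk : measurable_fun setT k by apply/measurable_EFinP; exact: measurable_int ik.
have ikI : mu.-integrable I (EFin \o (fun x => `|k x|)).
  by apply: (integrableS measurableT) => //; exact: integrable_norm.
have iI c : mu.-integrable I (EFin \o cst c).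
  apply: measurable_bounded_integrable => //; exists `|c|.
  by split; [exact: num_real|move=> D /ltW + x _].
pose f x := kap * (`|k x| - eps).
have ifI : mu.-integrable I (EFin \o f).
  apply: (@eq_integrable _ _ _ _ I mI (fun x => kap%:E * ((`|k x|)%:E - eps%:E)))%E => //.
  apply: integrableZl => //; apply: integrableB => //; exact: (iI eps).
apply: (@le_trans _ _ (\int[mu]_(x in I) (f x)%:E)%E); last first.
  (* The minorant f may be negative, while the monotonicity that dispenses with measurability of F
     needs a nonnegative lower function. *)
  apply: (@le_trans _ _ (\int[mu]_(x in I) (Num.max 0 (f x))%:E)%E).
    apply: le_integral => //.
      by have := integrable_funepos mI ifI; apply: eq_integrable => // x _;
        rewrite funeposE /= -EFin_max maxC.
    by move=> x _; rewrite lee_fin le_max lexx orbT.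
  rewrite integral_mkcond; apply: le_integral_ge0 => x _; rewrite patchE.
    by case: ifPn => // _; rewrite lee_fin le_max lexx.
  case: ifPn => // Ix; rewrite inE in Ix.
  by rewrite EFin_max ge_max F0 kF.
rewrite -(fineK (integrable_fin_num mI ifI)) lee_fin.
have -> : fine (\int[mu]_(x in I) (EFin \o f) x)%E =
    kap * (\int[mu]_(x in I) `|k x| - eps * fine (mu I)).
  transitivity (\int[mu]_(x in I) (kap * (`|k x| - eps))); first by [].
  rewrite RintegralZl//; last exact: (integrableB mI ikI (iI eps)).
  by rewrite RintegralB//; [rewrite Rintegral_cst|exact: iI].
apply: ler_wpM2l => //; rewrite lerD2r ler_pdivrMr// mulrC -RintegralZl//.
have ithk : mu.-integrable setT (EFin \o (fun x => th x * k x)).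
  apply: (@le_integrable _ _ _ mu setT measurableT _ (fun x => M%:E * (`|k x|)%:E)%E).
  - by apply/measurable_EFinP; exact: measurable_funM.
  - by move=> x _ /=; rewrite lee_fin !normrM normr_id (ger0_norm (ltW M0)) ler_wpM2r.
  - by apply: integrableZl => //; exact: integrable_norm.
apply: le_trans (@le_normr_Rintegral _ _ _ mu setT _ measurableT ithk) _.
rewrite [leRHS]Rintegral_mkcond; apply: le_Rintegral => //.
- exact: integrable_norm.
- have := (integrable_mkcond (fun x => M%:E * (`|k x|)%:E)%E mI).1 (integrableZl mI M ikI).
  by apply: eq_integrable => // x _; rewrite [RHS]/= !patchE; case: ifPn.
- move=> x _; rewrite patchE; case: ifPn; rewrite ?inE ?notin_setE => Ix.
    by rewrite normrM ler_wpM2r.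
  by rewrite th0// mul0r normr0.
Qed.

Section averaging.
Context d (Om : measurableType d) (R : realType).

Lemma integrable_tensor d2 (Om2 : measurableType d2) (m1 : {sigma_finite_measure set Om -> \bar R})
    (m2 : {sigma_finite_measure set Om2 -> \bar R}) (f : Om -> R) (g : Om2 -> R) :
  m1.-integrable setT (EFin \o f) -> m2.-integrable setT (EFin \o g) ->
  (m1 \x m2)%E.-integrable setT (fun z => (f z.1 * g z.2)%:E) /\
  \int[(m1 \x m2)%E]_z (f z.1 * g z.2) = (\int[m1]_x f x) * (\int[m2]_y g y).
Proof.
move=> /[dup] i1 /integrableP[mf _] /[dup] i2 /integrableP[mg _].
have mfg : measurable_fun setT (fun z : Om * Om2 => (f z.1 * g z.2)%:E).
  apply/measurable_EFinP; apply: measurable_funM.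
    by apply: measurableT_comp; [exact/measurable_EFinP|exact: measurable_fst].
  by apply: measurableT_comp; [exact/measurable_EFinP|exact: measurable_snd].
have mfa : measurable_fun setT (fun x => (`|f x|)%:E).
  by apply/measurable_EFinP; apply: measurableT_comp => //; exact/measurable_EFinP.
have mga : measurable_fun setT (fun x => (`|g x|)%:E).
  by apply/measurable_EFinP; apply: measurableT_comp => //; exact/measurable_EFinP.
have ifg : (m1 \x m2)%E.-integrable setT (fun z => (f z.1 * g z.2)%:E).
  apply/integrable12ltyP => //=.
  rewrite (@eq_integral _ _ _ m1 setT (fun x => (`|f x|)%:E * \int[m2]_y (`|g y|)%:E)%E); last first.
    move=> x _; rewrite -ge0_integralZl//.
    by apply: eq_integral => y _; rewrite /= normrM EFinM.
  rewrite ge0_integralZr//; last exact: integral_ge0.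
  have /integrableP[_ h1] := i1; have /integrableP[_ h2] := i2.
  apply: lte_mul_pinfty => //; first exact: integral_ge0.
  by rewrite ge0_fin_numE//; exact: integral_ge0.
split => //; rewrite Rfubini12//=; last first.
  by move=> x; under eq_fun do rewrite EFinM; exact: integrableZl.
under eq_Rintegral do rewrite RintegralZl//.
by rewrite RintegralZr.
Qed.

(* Since th has mean zero, pairing k x - k y with th x over I x I gives back
   mu I times the pairing of k with th. *)
Lemma averaging_bound2 (mu : {sigma_finite_measure set Om -> \bar R}) (I : set Om) (k th : Om -> R)
    (F : Om * Om -> \bar R) (M kap eps : R) :
  measurable I -> (mu I < +oo)%E -> mu.-integrable setT (EFin \o k) ->
  measurable_fun setT th -> 0 < M -> (forall x, `|th x| <= M) -> (forall x, ~ I x -> th x = 0) ->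
  \int[mu]_x th x = 0 ->
  0 <= kap -> (forall x, 0 <= F x)%E ->
  (forall x y, I x -> I y -> ((kap * (`|k x - k y| - eps))%:E <= F (x, y))%E) ->
  ((kap * (`|\int[mu]_x (th x * k x)| * fine (mu I) / M - eps * fine (mu I) ^+ 2))%:E <=
    \int[(mu \x mu)%E]_x F x)%E.
Proof.
move=> mI Ioo ik mth M0 thM th0 thI kap0 F0 kF.
have mk : measurable_fun setT k by apply/measurable_EFinP; exact: measurable_int ik.
have i1 : mu.-integrable setT (EFin \o \1_I).
  apply: (@bounded_support_integrable _ _ _ mu I \1_I 1) => // x Ix.
    by rewrite indicE mem_set// normr1.
  by rewrite indicE memNset.
have ith : mu.-integrable setT (EFin \o th).
  by apply: (@bounded_support_integrable _ _ _ mu I th M).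
have ithk : mu.-integrable setT (EFin \o (fun x => th x * k x)).
  apply: (@le_integrable _ _ _ mu setT measurableT _ (fun x => M%:E * (`|k x|)%:E)%E).
  - by apply/measurable_EFinP; exact: measurable_funM.
  - by move=> x _ /=; rewrite lee_fin !normrM normr_id (ger0_norm (ltW M0)) ler_wpM2r.
  - by apply: integrableZl => //; exact: integrable_norm.
have ikI : mu.-integrable setT (EFin \o (fun x => \1_I x * k x)).
  apply: (@le_integrable _ _ _ mu setT measurableT _ (fun x => (`|k x|)%:E)%E).
  - by apply/measurable_EFinP; exact: measurable_funM.
  - move=> x _ /=; rewrite lee_fin normrM normr_id indicE.
    by case: (x \in I); rewrite ?normr1 ?mul1r// normr0 mul0r.
  - exact: integrable_norm.
have [j1 E1] := integrable_tensor ikI i1.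
have [j2 E2] := integrable_tensor i1 ikI.
have [j3 E3] := integrable_tensor ithk i1.
have [j4 E4] := integrable_tensor ith ikI.
(* This is k x - k y on I x I, written as a difference of two integrable tensor products; paired
   with [th2], the second one drops out because th has mean zero. *)
pose k2 (z : Om * Om) := (\1_I z.1 * k z.1) * \1_I z.2 - \1_I z.1 * (\1_I z.2 * k z.2).
pose th2 (z : Om * Om) := th z.1 * \1_I z.2.
have II : fine ((mu \x mu)%E (I `*` I)) = fine (mu I) ^+ 2.
  by rewrite product_measure1E// fineM ?ge0_fin_numE.
have E : \int[(mu \x mu)%E]_z (th2 z * k2 z) = \int[mu]_x (th x * k x) * fine (mu I).
  transitivity (\int[(mu \x mu)%E]_z (th z.1 * k z.1 * \1_I z.2 - th z.1 * (\1_I z.2 * k z.2))).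
    apply: eq_Rintegral => z _; rewrite /th2 /k2.
    have h1 : th z.1 * \1_I z.1 = th z.1.
      rewrite indicE; have [_|zI] := boolP (z.1 \in I); first by rewrite mulr1.
      by rewrite notin_setE in zI; rewrite (th0 _ zI) mul0r.
    have h2 : \1_I z.2 * \1_I z.2 = \1_I z.2 :> R.
      by rewrite indicE; case: (_ \in _); rewrite ?mulr1 ?mulr0.
    move: (\1_I z.1) (\1_I z.2) h1 h2 => o1 o2 h1 h2.
    transitivity ((th z.1 * o1) * k z.1 * (o2 * o2) - (th z.1 * o1) * (o2 * o2) * k z.2).
      by ring.
    by rewrite h1 h2; ring.
  rewrite RintegralB// E3 E4 thI mul0r subr0; congr (_ * _).
  by rewrite /Rintegral integral_indic// setIT.
have mII : measurable (I `*` I) by exact: measurableX.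
have mth2 : measurable_fun setT th2.
  apply: measurable_funM; first by apply: measurableT_comp => //; exact: measurable_fst.
  by apply: measurableT_comp; [exact: measurable_indic|exact: measurable_snd].
have ik2 : (mu \x mu)%E.-integrable setT (EFin \o k2).
  by have := integrableB measurableT j1 j2; apply: eq_integrable.
have IIoo : ((mu \x mu)%E (I `*` I) < +oo)%E by exact: product_measure1_lty.
have th2M z : `|th2 z| <= M.
  rewrite /th2 indicE normrM; case: (_ \in _); rewrite ?normr1 ?mulr1//.
  by rewrite normr0 mulr0 ltW.
have th20 z : ~ (I `*` I) z -> th2 z = 0.
  move=> nI; rewrite /th2 indicE; have [zI|zI] := boolP (z.2 \in I); last by rewrite mulr0.
  by rewrite th0 ?mul0r// => z1; apply: nI; split => //; rewrite inE in zI.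
have Fk z : (I `*` I) z -> ((kap * (`|k2 z| - eps))%:E <= F z)%E.
  move=> [/= z1 z2]; rewrite /k2 !indicE !mem_set// !mul1r mulr1.
  by case: z z1 z2 => x y /= z1 z2; exact: kF.
have := averaging_bound mII IIoo ik2 mth2 M0 th2M th20 kap0 F0 Fk.
by rewrite [X in `|X|]E II normrM (ger0_norm (fine_ge0 (measure_ge0 mu I))).
Qed.

End averaging.

Section lower_bounds.
Context {R : realType}.
Local Notation leb1 := (@lebesgue_measure R).

(* Replaces |D^k u|^p by a quantity linear in |D^k u|, which can be paired with a
   test function for any version of the weak derivative. *)
Lemma powR_ge_linear (p eps y : R) : 1 <= p -> 0 < eps -> 0 <= y ->
  eps `^ (p - 1) * (y - eps) <= y `^ p.
Proof.
move=> p1 e0 y0; have p0 : 0 < p by rewrite (lt_le_trans ltr01).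
have [ye|ey] := leP y eps.
  by rewrite (le_trans _ (powR_ge0 _ _))// mulr_ge0_le0 ?powR_ge0// subr_le0.
rewrite -(mulr_powRB1 y0 p0) mulrC.
apply: ler_pM; rewrite ?powR_ge0 ?subr_ge0 ?(ltW ey)//.
  by rewrite gerBl ltW.
by apply: ge0_ler_powR; rewrite ?nnegrE ?subr_ge0// ltW.
Qed.

(** Both norms are infima of p-th roots over versions of a derivative. A bound on the quantity under
    the root, uniform in the version, passes to the p-th power of the norm. *)
Lemma le_ereal_inf_poweR (p B : R) (S : set (\bar R)) : 0 < p ->
  (forall y, S y -> exists2 y', y = (y' `^ p^-1)%E & (B%:E <= y')%E) ->
  (B%:E <= (ereal_inf S) `^ p)%E.
Proof.
move=> p0 hS; have [B0|B0] := leP B 0.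
  by rewrite (@le_trans _ _ 0%E) ?lee_fin// poweR_ge0.
have h : ((B `^ p^-1)%:E <= ereal_inf S)%E.
  apply: le_ereal_inf_tmp => y /hS[y' -> By'].
  rewrite -poweR_EFin; apply: gt0_ler_poweR => //.
  - by rewrite invr_ge0 ltW.
  - by rewrite in_itv /= leey lee_fin ltW.
  - by rewrite in_itv /= leey andbT (le_trans _ By')// lee_fin ltW.
rewrite -[B](powRr1 (ltW B0)) -(mulVf (lt0r_neq0 p0)) powRrM -poweR_EFin.
apply: gt0_ler_poweR => //; first exact: ltW.
- by rewrite in_itv /= leey lee_fin powR_ge0.
- by rewrite in_itv /= leey andbT (le_trans _ h)// lee_fin powR_ge0.
Qed.

Section space.
Variable d : nat.
Local Notation Rd := 'rV[R]_d.
Local Notation lebd := (@lebesgue_rV R d).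
Variables (i0 : 'I_d) (s p lam M : R) (chi : Rd -> R).
Hypotheses (p1 : 1 <= p) (s0 : 0 <= s) (lam0 : 0 < lam) (M0 : 0 < M).
Hypotheses (schi : smooth chi) (chi0 : forall x, ~ rbox lam x -> chi x = 0).
Hypotheses (chiM : forall x, `|chi x| <= M) (intchi : \int[lebd]_x chi x = 0).

Let l := Num.truncn s.
Let r := s - l%:R.

(** Points of the box of half-side lam are at distance at most 2 lam sqrt(d), so the kernel is at
    least (2 lam sqrt(d))^-(rp+d). The factor (2 lam)^d of the volume cancels part of it; this
    constant is what remains besides lam^-(rp). *)
Definition space_cst : R :=
  if r == 0 then 1 else 2 `^ (- (r * p)) * Num.sqrt d%:R `^ (- (r * p + d%:R)).

Definition dchi : Rd -> R := iter_deriv [seq e_ i | i <- nseq l i0] chi.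

Lemma enorm_ge_coord (I : finType) (h : I -> R) a : `|h a| <= enorm h.
Proof.
rewrite -sqrtr_sqr /enorm; apply: ler_wsqrtr; rewrite (bigD1 a)//= lerDl.
by apply: sumr_ge0 => i _; exact: sqr_ge0.
Qed.

Lemma enorm_ge0 (I : finType) (h : I -> R) : 0 <= enorm h.
Proof. exact: sqrtr_ge0. Qed.

Lemma enorm_rbox (x y : Rd) : rbox lam x -> rbox lam y ->
  enorm ((x - y) 0) <= 2 * lam * Num.sqrt d%:R.
Proof.
move=> /rboxP hx /rboxP hy.
have l2 : 0 <= 2 * lam by rewrite mulr_ge0// ltW.
rewrite -{1}(ger0_norm l2) -sqrtr_sqr -sqrtrM ?sqr_ge0// /enorm; apply: ler_wsqrtr.
apply: (@le_trans _ _ (\sum_(i < d) (2 * lam) ^+ 2)).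
  apply: ler_sum => i _; rewrite -[leLHS]real_normK ?num_real//.
  apply: lerXn2r; rewrite ?nnegrE// !mxE (le_trans (ler_normB _ _))//.
  by have := hx i; have := hy i; lra.
by rewrite sumr_const card_ord mulr_natr.
Qed.

Let p0 : 0 < p. Proof. exact: lt_le_trans p1. Qed.

(** The tensor D^l h dominates its single component d_i0^l h, and pairing that component with chi
    moves all derivatives to chi, whatever the version. The mean zero of chi serves when s is not an
    integer. *)
Lemma dotW_Rd_lower_bound (h : Rd -> R) eps : 0 < eps ->
  ((space_cst * lam `^ (- (r * p)) * eps `^ (p - 1) / M *
     (`|\int[lebd]_x (h x * dchi x)| - M * eps * (2 * lam) ^+ d))%:E
   <= dotW_Rd s p h `^ p)%E.
Proof.
move=> e0; rewrite /dotW_Rd; apply: le_ereal_inf_poweR => // _ /= [H HW <-].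
eexists; first by reflexivity.
pose a : (Num.truncn s).-tuple 'I_d := nseq_tuple _ i0.
have [_ [mHa lHa] Ha] := HW a.
have tchi : test_function setT chi.
  split; first exact: schi.
  by exists (rbox lam); split => //; exact: rbox_compact.
pose V := fine (lebd (rbox lam)).
have VE : V = (2 * lam) ^+ d by rewrite /V lebesgue_rbox//= ltW.
have V0 : 0 < V by rewrite VE exprn_gt0// mulr_gt0.
(* The weak derivative is only locally integrable; restricted to the box that supports chi it is
   integrable. *)
pose k x := \1_(rbox lam) x * H x a.
have kE : `|\int[lebd]_x (chi x * k x)| = `|\int[lebd]_x (h x * dchi x)|.
  rewrite /dchi (Ha chi tchi) normrM normrX normrN normr1 expr1n mul1r; congr `|_|.
  apply: eq_Rintegral => x _; rewrite /k indicE.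
  have [_|xI] := boolP (x \in rbox lam); first by rewrite mul1r mulrC.
  by rewrite notin_setE in xI; rewrite (chi0 xI) mul0r mulr0.
have mk : measurable_fun setT k.
  apply: measurable_funM; last exact: mHa.
  by apply: measurable_indic; exact: measurable_rbox.
have ik : lebd.-integrable setT (EFin \o k).
  apply/integrableP; split; first exact/measurable_EFinP.
  apply: le_lt_trans (lHa _ (@rbox_compact _ _ lam)).
  rewrite [leRHS]integral_mkcond; apply: le_integral_ge0 => x _; first by rewrite lee_fin.
  by rewrite patchE /= /k indicE; case: ifPn; rewrite ?mul1r// mul0r normr0.
have mchi : measurable_fun setT chi.
  by apply: continuous_measurable_rV; exact: smooth_continuous.
have mI := @measurable_rbox R d lam.
have Ioo := @rbox_lty R d lam.
have k1 x : rbox lam x -> k x = H x a by move=> Ix; rewrite /k indicE mem_set// mul1r.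
rewrite /space_cst -/l -/r; case: ifPn => [r0|r0].
  have := @averaging_bound _ _ _ lebd (rbox lam) k chi (fun x => (enorm (H x) `^ p)%:E) M
    (eps `^ (p - 1)) eps mI Ioo ik mchi M0 chiM chi0 (powR_ge0 _ _).
  rewrite kE -/V => hb; apply: le_trans (hb _ _); last 2 first.
  - by move=> x; rewrite lee_fin powR_ge0.
  - move=> x Ix; rewrite lee_fin k1//; apply: le_trans (powR_ge_linear p1 e0 (enorm_ge0 _)) => //.
    by rewrite ler_wpM2l ?powR_ge0// lerD2r; exact: (enorm_ge_coord (H x) a).
  rewrite lee_fin (eqP r0) mul0r oppr0 powRr0 !mul1r -VE le_eqVlt; apply/orP; left; apply/eqP.
  by field; rewrite gt_eqF.
pose q := r * p + d%:R.
pose del := 2 * lam * Num.sqrt d%:R.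
have d0 : (0 < d)%N by case: (d) i0 => // -[].
have sd0 : 0 < Num.sqrt d%:R :> R by rewrite sqrtr_gt0 ltr0n.
have del0 : 0 < del by rewrite /del !mulr_gt0.
have r00 : 0 <= r by rewrite /r subr_ge0 truncn_le.
have q0 : 0 < q.
  by apply: ltr_wpDl; [rewrite mulr_ge0// ltW|rewrite ltr0n].
pose F (z : Rd * Rd) := (enorm (fun b => H z.1 b - H z.2 b) `^ p
           / enorm ((z.1 - z.2) 0) `^ q)%:E.
have F0 z : (0 <= F z)%E by rewrite lee_fin divr_ge0// powR_ge0.
have kF x y : rbox lam x -> rbox lam y ->
    ((del `^ (- q) * eps `^ (p - 1) * (`|k x - k y| - eps))%:E <= F (x, y))%E.
  move=> Ix Iy; rewrite k1// k1// lee_fin /=.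
  have hD := enorm_ge_coord (fun b => H x b - H y b) a.
  set e1 := enorm _ in hD *; set D := H x a - H y a in hD *.
  have e10 : 0 <= e1 by exact: enorm_ge0.
  have hd : enorm ((x - y) 0) <= del by exact: enorm_rbox.
  (* The kernel estimate needs x and y distinct; on the diagonal the left-hand side is not positive
     and F is nonnegative. *)
  have [e2|e2] := eqVneq (enorm ((x - y) 0)) 0.
    have xy : x = y.
      apply/rowP => i; apply/eqP; rewrite -subr_eq0 -normr_eq0.
      have := enorm_ge_coord ((x - y) 0) i; rewrite e2 !mxE => h'.
      by rewrite eq_le h' normr_ge0.
    rewrite /D xy subrr normr0 sub0r (@le_trans _ _ 0)//.
      by rewrite mulr_ge0_le0 ?mulr_ge0 ?powR_ge0// oppr_le0 ltW.
    by rewrite divr_ge0 ?powR_ge0.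
  have e20 : 0 < enorm ((x - y) 0) by rewrite lt_neqAle eq_sym e2 enorm_ge0.
  rewrite powRN -mulrA [leLHS]mulrC.
  apply: (@le_trans _ _ (e1 `^ p * (del `^ q)^-1)).
    rewrite ler_wpM2r ?invr_ge0 ?powR_ge0//.
    apply: le_trans (powR_ge_linear p1 e0 e10).
    by rewrite ler_wpM2l ?powR_ge0// lerD2r.
  rewrite ler_wpM2l ?powR_ge0// lef_pV2 ?posrE ?powR_gt0//.
  by apply: ge0_ler_powR; rewrite ?nnegrE ?enorm_ge0// ltW.
have := @averaging_bound2 _ _ _ lebd (rbox lam) k chi F M
    (del `^ (- q) * eps `^ (p - 1)) eps mI Ioo ik mchi M0 chiM chi0 intchi
    (mulr_ge0 (powR_ge0 _ _) (powR_ge0 _ _)) F0 kF.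
rewrite kE -/V; apply: le_trans; rewrite lee_fin le_eqVlt; apply/orP; left; apply/eqP.
have delE : del `^ (- q) = 2 `^ (- (r * p)) * Num.sqrt d%:R `^ (- q) * lam `^ (- (r * p)) / V.
  rewrite /del powRM ?mulr_ge0 ?ltW// [X in X * _ = _](_ : _ =
    (2 * lam) `^ (- (r * p)) / V); last first.
    have l2 : 2 * lam != 0 by rewrite lt0r_neq0 ?mulr_gt0.
    rewrite /q opprD powRD; last by rewrite l2 implybT.
    congr (_ * _).
    by rewrite powRN VE powR_mulrn// mulr_ge0// ltW.
  by rewrite powRM ?ltW//; ring.
rewrite -VE delE -/q; move: (2 `^ _) (Num.sqrt _ `^ _) (lam `^ _) (eps `^ _) => A B C D.
by field; rewrite !gt_eqF.
Qed.

End space.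
End lower_bounds.

(** * Lower bound for the norm in time *)

Section time.
Context {R : realType} (d : nat).
Local Notation leb1 := (@lebesgue_measure R).
Local Notation Rd := 'rV[R]_d.
Local Notation lebd := (@lebesgue_rV R d).
Local Notation mQ := (measurableTypeR R * Rd)%type.
Variables (s p T kap e lam t0 tau M : R) (X : (Rd -> R) -> \bar R).
Variables (th : R -> R) (psi : Rd -> R).
Hypotheses (p1 : 1 <= p) (s0 : 0 <= s) (tau0 : 0 < tau) (M0 : 0 < M).
Hypotheses (kap0 : 0 <= kap) (e0 : 0 <= e).
Hypotheses (I0 : 0 < t0 - tau) (IT : t0 + tau < T).
Hypotheses (sth : smooth th) (spsi : smooth psi).
Hypotheses (th0 : forall t, ~ `[t0 - tau, t0 + tau]%classic t -> th t = 0).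
Hypotheses (psi0 : forall x, ~ rbox lam x -> psi x = 0).
Hypotheses (thM : forall t, `|th t| <= M) (intth : \int[leb1]_t th t = 0).
Hypothesis X0 : forall h, (0 <= X h)%E.
Hypothesis HX : forall h,
  ((kap * (`|\int[lebd]_x (h x * psi x)| - e))%:E <= X h `^ p)%E.

Let k := Num.truncn s.
Let r := s - k%:R.
Let I : set R := `[t0 - tau, t0 + tau]%classic.
Let QB := @qbox R d (t0 - tau) (t0 + tau) lam.

Let p0 : 0 < p. Proof. exact: lt_le_trans p1. Qed.

Lemma smooth_fst (f : R -> R) : smooth f -> smooth (fun z : R * Rd => f z.1).
Proof.
move=> sf; apply: (@smooth_affine R (R * Rd)%type R fst fst) => //.
by move=> z; exact: cvg_fst.
Qed.

Lemma smooth_snd (f : Rd -> R) : smooth f -> smooth (fun z : R * Rd => f z.2).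
Proof.
move=> sf; apply: (@smooth_affine R (R * Rd)%type Rd snd snd) => //.
by move=> z; exact: cvg_snd.
Qed.

Lemma iter_deriv_time (n : nat) (f : R -> R) (g : Rd -> R) : smooth f -> smooth g ->
  iter_deriv (nseq n ((1, 0) : R * Rd)) (fun z => f z.1 * g z.2) =
  (fun z => iter_deriv (nseq n (1 : R)) f z.1 * g z.2).
Proof.
move=> sf sg; elim: n => [|n IH] //=.
have sn : smooth (iter_deriv (nseq n (1 : R)) f).
  by elim: n {IH} => [|n IH] //=; exact: smooth_derive.
rewrite IH; apply/funext => -[t x].
have h1 : is_derive (t, x) ((1, 0) : R * Rd) (fun z : R * Rd => iter_deriv (nseq n (1 : R)) f z.1)
    ('D_1 (iter_deriv (nseq n (1 : R)) f) t).
  apply: (@is_derive_affine R (R * Rd)%type R fst fst) => //.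
  exact: smooth_is_derive.
have h2 : is_derive (t, x) ((1, 0) : R * Rd) (fun z : R * Rd => g z.2) 0.
  apply: (@is_derive_affine R (R * Rd)%type Rd snd snd) => //.
  exact: derive_dir0.
have [_ ->] := is_deriveM h1 h2.
by rewrite scaler0 add0r /GRing.scale /= mulrC.
Qed.

Let phi (z : R * Rd) := th z.1 * psi z.2.

Let QB_QT : QB `<=` QT T.
Proof.
move=> [t x] [/= It _]; split => //=; move: It; rewrite /= !in_itv /= => /andP[h1 h2].
by rewrite (lt_le_trans I0 h1) (le_lt_trans h2 IT).
Qed.

Let phi0 z : ~ QB z -> phi z = 0.
Proof.
move=> Qz; rewrite /phi; have [It|/th0 ->] := pselect (I z.1); last by rewrite mul0r.
have [Ix|/psi0 ->] := pselect (rbox lam z.2); last by rewrite mulr0.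
by exfalso; apply: Qz.
Qed.

Let tphi : test_function (QT T) phi.
Proof.
split; first by apply: smoothM; [exact: smooth_fst|exact: smooth_snd].
by exists QB; split => //; exact: qbox_compact.
Qed.

(** Through [HX] the norm X is only seen by pairing with one fixed psi. This reduces the
    vector-valued norm to the scalar function J(t), the pairing of G(t) with psi, to which the
    averaging bounds apply with th. *)
Lemma dotW_time_lower_bound (g : R -> Rd -> R) :
  (((2 * tau) `^ (- (r * p)) * kap *
     (`|\int[(leb1 \x lebd)%E]_(z in QT T)
         (g z.1 z.2 * (iter_deriv (nseq k (1 : R)) th z.1 * psi z.2))| / M -
      e * (2 * tau)))%:E <= dotW_time s p T X g `^ p)%E.
Proof.
rewrite /dotW_time; apply: le_ereal_inf_poweR => // _ /= [G [_ [mG lG] HG] <-].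
eexists; first by reflexivity.
rewrite -/k -/r.
have mI : measurable (I : set (measurableTypeR R)) by exact: measurable_itv.
have Ioo : (leb1 I < +oo)%E by exact: lebesgue_itv_lty.
have IE : leb1 I = (2 * tau)%:E.
  rewrite /I lebesgue_measure_itv /= lte_fin ifT; last by move: (tau0) => h; lra.
  by congr EFin; ring.
have mQB : measurable (QB : set mQ) by exact: measurable_qbox.
have spsi_c : continuous psi by exact: smooth_continuous.
have [C C0 psiC] := compact_continuous_bounded (@rbox_compact R d lam) spsi_c.
have mth : measurable_fun setT (th : measurableTypeR R -> R).
  by apply: continuous_measurable_fun; exact: smooth_continuous.
have psiC' x : `|psi x| <= C.
  by have [/psiC//|/psi0 ->] := pselect (rbox lam x); rewrite normr0 ltW.
(* G is only locally integrable on the open cylinder, and [QB] is a compact subset that supports the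
   test function. *)
pose GQ : mQ -> R := (fun z : mQ => G z.1 z.2) \_ QB.
have iGQ : (leb1 \x lebd)%E.-integrable setT (EFin \o GQ).
  rewrite (_ : EFin \o GQ = (EFin \o (fun z : mQ => G z.1 z.2)) \_ QB); last first.
    by rewrite /GQ -restrict_EFin.
  have [+ _] := @integrable_mkcond _ _ _ (leb1 \x lebd)%E QB (EFin \o (fun z : mQ => G z.1 z.2)) mQB.
  apply; apply/integrableP; split.
    by apply/measurable_EFinP; apply: measurable_funS mG => //; exact: measurable_QT.
  exact: (lG QB QB_QT (@qbox_compact _ _ _ _ _)).
have mGQ : measurable_fun setT GQ by apply/measurable_EFinP; exact: measurable_int iGQ.
pose f (z : mQ) := GQ z * psi z.2.
have mf : measurable_fun setT f.
  apply: measurable_funM => //.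
  by apply: measurableT_comp => //; exact: continuous_measurable_rV.
have bdd_int (g1 : mQ -> R) (h : mQ -> R) (c : R) : (leb1 \x lebd)%E.-integrable setT (EFin \o g1) ->
    measurable_fun setT h -> (forall z, `|h z| <= c) ->
    (leb1 \x lebd)%E.-integrable setT (EFin \o (fun z => h z * g1 z)).
  move=> ig mh hc; apply: (@le_integrable _ _ _ (leb1 \x lebd)%E setT measurableT _
      (fun z => c%:E * (`|g1 z|)%:E)%E).
  - apply/measurable_EFinP; apply: measurable_funM => //.
    by apply/measurable_EFinP; exact: measurable_int ig.
  - move=> z _ /=; rewrite lee_fin !normrM normr_id.
    apply: ler_wpM2r => //; apply: (le_trans (hc z)); exact: ler_norm.
  - by apply: integrableZl => //; exact: integrable_norm.
have mpsi2 : measurable_fun setT (fun z : mQ => psi z.2).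
  by apply: measurableT_comp => //; exact: continuous_measurable_rV.
have intf : (leb1 \x lebd)%E.-integrable setT (EFin \o f).
  have h := bdd_int GQ (fun z => psi z.2) C iGQ mpsi2 (fun z => psiC' z.2).
  by rewrite (_ : EFin \o f = EFin \o (fun z => psi z.2 * GQ z))//; apply/funext => z /=; rewrite mulrC.
have [N [mN N0 hN]] := ae_integrable1 intf.
(* For t in the null set N the section of G need not be integrable, and
   then J t - J t' is not the pairing of G t - G t' with psi. *)
pose iN (t : measurableTypeR R) : R := \1_(~` N) t.
have miN : measurable_fun setT iN by apply: measurable_indic; exact: measurableC.
have iN1 t : `|iN t| <= 1 by rewrite /iN indicE; case: (_ \in _); rewrite ?normr1// normr0.
have iN0 t : N t -> iN t = 0 by move=> Nt; rewrite /iN indicE memNset//= => h; exact: h.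
have iN1E t : ~ N t -> iN t = 1 by move=> Nt; rewrite /iN indicE mem_set.
pose fN (z : mQ) := iN z.1 * f z.
have miN1 : measurable_fun setT (fun z : mQ => iN z.1) by apply: measurableT_comp.
have intfN : (leb1 \x lebd)%E.-integrable setT (EFin \o fN).
  exact: (bdd_int f (fun z => iN z.1) 1 intf miN1 (fun z => iN1 z.1)).
have isec t : lebd.-integrable setT (fun x => (fN (t, x))%:E).
  have [Nt|Nt] := pselect (N t).
    rewrite (_ : (fun _ => _) = cst 0%E); first exact: integrable0.
    by apply/funext => x; rewrite /fN iN0 ?mul0r.
  rewrite (_ : (fun _ => _) = (fun x => (EFin \o f) (t, x))).
    by apply: contrapT => h; apply: Nt; apply: hN => h'; exact: h.
  by apply/funext => x; rewrite /fN iN1E ?mul1r.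
pose J t := \int[lebd]_x fN (t, x).
have iJ : leb1.-integrable setT (EFin \o J) by exact: (integrable_Rfubini12 intfN).
pose I' : set (measurableTypeR R) := I `\` N.
have mI' : measurable I' by exact: measurableD.
have I'E : leb1 I' = (2 * tau)%:E.
  rewrite -IE /I' (measureDI leb1 mI mN) [X in (_ = _ + X)%E](_ : _ = 0%E) ?adde0//.
  by apply: (@subset_measure0 _ _ _ leb1 _ N) => //; exact: measurableI.
have I'oo : (leb1 I' < +oo)%E by rewrite I'E ltry.
have JG t : I' t -> J t = \int[lebd]_x (G t x * psi x).
  move=> [It Nt]; apply: eq_Rintegral => x _; rewrite /fN iN1E// mul1r /f /GQ patchE.
  have [_|] := boolP ((t, x) \in QB) => //; rewrite notin_setE => h.
  by rewrite (psi0 (x := x)) ?mulr0// => h'; apply: h.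
have iG t : I' t -> lebd.-integrable setT (EFin \o (fun x => G t x * psi x)).
  move=> [It Nt]; have := isec t; apply: eq_integrable => // x _ /=; congr EFin.
  rewrite /fN iN1E// mul1r /f /GQ patchE.
  have [_|] := boolP ((t, x) \in QB) => //; rewrite notin_setE => h.
  by rewrite (psi0 (x := x)) ?mulr0// => h'; apply: h.
(* Vanishing off I' = I \ N restricts the estimates to times at which J is the true pairing, and
   changes no integral since N is null. *)
pose th' t := iN t * th t.
have mth' : measurable_fun setT th' by exact: measurable_funM.
have th'0 t : ~ I' t -> th' t = 0.
  move=> h; rewrite /th'; have [It|/th0 ->] := pselect (I t); last by rewrite mulr0.
  by rewrite iN0 ?mul0r//; apply: contrapT => Nt; apply: h.
have th'M t : `|th' t| <= M.
  by rewrite normrM (le_trans _ (thM t))// ler_piMl.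
have aeN : {ae leb1, forall t, iN t = 1}.
  by exists N; split => // t /= h; apply: contrapT => Nt; apply: h; exact: iN1E.
have intth' : \int[leb1]_t th' t = 0.
  rewrite -intth /Rintegral; congr fine; apply: ae_eq_integral => //; try exact/measurable_EFinP.
  by apply: filterS aeN => t /= h _; rewrite /th' h mul1r.
have AE : `|\int[leb1]_t (th' t * J t)| = `|\int[(leb1 \x lebd)%E]_(z in QT T)
         (g z.1 z.2 * (iter_deriv (nseq k (1 : R)) th z.1 * psi z.2))|.
  have := HG phi tphi; rewrite {1}/phi iter_deriv_time// => ->.
  rewrite normrM normrX normrN normr1 expr1n mul1r; congr `|_|; symmetry.
  have ith'f : (leb1 \x lebd)%E.-integrable setT (EFin \o (fun z => th' z.1 * fN z)).
    by apply: (bdd_int fN (fun z => th' z.1) M intfN) => //; exact: measurableT_comp.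
  have GE : (fun z : mQ => G z.1 z.2 * phi z) \_ (QT T) = (fun z => th z.1 * f z).
    apply/funext => z; rewrite patchE /f /GQ patchE.
    have [zQ|] := boolP (z \in QB).
      by rewrite mem_set; [rewrite /phi mulrCA|apply: QB_QT; rewrite inE in zQ].
    rewrite notin_setE => Qz; rewrite phi0// !mulr0.
    by case: ifP => _; rewrite mul0r mulr0.
  transitivity (\int[(leb1 \x lebd)%E]_z (th' z.1 * fN z)).
    rewrite [LHS]Rintegral_mkcond GE /Rintegral; congr fine; apply: ae_eq_integral => //.
    - apply/measurable_EFinP; apply: measurable_funM => //; exact: measurableT_comp.
    - exact: measurable_int ith'f.
    - exists (N `*` setT); split.
      + exact: measurableX.
      + have N0' : leb1 N = 0%E by exact: N0.
        apply: (etrans (product_measure1E leb1 lebd mN measurableT)).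
        by apply: (etrans (congr1 (fun x => x * lebd setT)%E N0')); rewrite mul0e.
      + move=> [t x] /= h; split => //=; apply: contrapT => Nt; apply: h => _.
        by rewrite /th' /fN /= iN1E// !mul1r.
  rewrite (Rfubini12 ith'f).
    apply: eq_Rintegral => t _.
    exact: (RintegralZl (f := fun x => fN (t, x)) (th' t) measurableT (isec t)).
  move=> t; rewrite (_ : (fun _ => _) = (fun x => (th' t)%:E * (fN (t, x))%:E)%E)//.
  exact: integrableZl.
rewrite -AE.
have X00 h : (0 <= X h `^ p)%E by exact: poweR_ge0.
have IT' t : I' t -> `]0%R, T[%classic t.
  move=> [+ _]; rewrite /I /= !in_itv /= => /andP[h1 h2].
  by rewrite (lt_le_trans I0 h1) (le_lt_trans h2 IT).
case: ifPn => [r0|r0].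
  pose F := (fun t => X (G t) `^ p)%E \_ `]0, T[.
  have F0 t : (0 <= F t)%E by rewrite /F patchE; case: ifP.
  have kF t : I' t -> ((kap * (`|J t| - e))%:E <= F t)%E.
    by move=> It; rewrite /F patchE mem_set ?JG//; exact: IT'.
  have := @averaging_bound _ _ _ leb1 I' J th' F M kap e
    mI' I'oo iJ mth' M0 th'M th'0 kap0 F0 kF.
  rewrite [fine (_ I')](congr1 fine I'E : _ = 2 * tau) [X in _ -> (_ <= X)%E]integral_mkcond; apply: le_trans.
  by rewrite lee_fin (eqP r0) mul0r oppr0 powRr0 mul1r.
pose F := (fun z : R * R => X (fun x => (G z.1 x - G z.2 x)%R) `^ p
           * ((`|z.1 - z.2| `^ (r * p + 1))^-1)%:E)%E \_ (`]0, T[ `*` `]0, T[).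
have F0 z : (0 <= F z)%E.
  by rewrite /F patchE; case: ifP => // _; rewrite mule_ge0// lee_fin invr_ge0 powR_ge0.
have r00 : 0 <= r by rewrite /r subr_ge0 truncn_le.
have q0 : 0 < r * p + 1 by apply: ltr_wpDl => //; rewrite mulr_ge0// ltW.
(* On I x I the kernel is at least (2 tau)^-(rp+1); the extra power 1 is compensated below by the
   length 2 tau of I. *)
pose kap' := (2 * tau) `^ (- (r * p + 1)) * kap.
have kF t t' : I' t -> I' t' -> ((kap' * (`|J t - J t'| - e))%:E <= F (t, t'))%E.
  move=> It It'; rewrite /F patchE mem_set; last by split; exact: IT'.
  have [tt'|tt'] := eqVneq t t'.
    rewrite tt' subrr normr0 sub0r (@le_trans _ _ 0%E)//.
      by rewrite lee_fin mulr_ge0_le0 ?oppr_le0// mulr_ge0// powR_ge0.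
    by rewrite mule_ge0// lee_fin invr_ge0 powR_ge0.
  have dt0 : 0 < `|t - t'| by rewrite normr_gt0 subr_eq0.
  have dt1 : `|t - t'| <= 2 * tau.
    move: It It' => [+ _] [+ _]; rewrite /I /= !in_itv /= => /andP[h1 h2] /andP[h3 h4].
    by rewrite ler_norml; apply/andP; split; lra.
  have JE : J t - J t' = \int[lebd]_x ((G t x - G t' x) * psi x).
    rewrite !JG// -RintegralB//; try exact: iG.
    by apply: eq_Rintegral => x _; rewrite mulrBl.
  have := HX (fun x => G t x - G t' x); rewrite -JE => h.
  (* The factors can be compared separately only when the lower bound is positive; otherwise F >= 0
     suffices. *)
  have [B0|B0] := leP (kap * (`|J t - J t'| - e)) 0.
    rewrite (@le_trans _ _ 0%E)//.
      by rewrite lee_fin /kap' -mulrA mulr_ge0_le0// powR_ge0.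
    by rewrite mule_ge0// lee_fin invr_ge0 powR_ge0.
  rewrite /kap' -mulrA mulrC EFinM; apply: lee_pmul => //; rewrite ?lee_fin ?powR_ge0//; first exact: ltW.
  rewrite powRN lef_pV2 ?posrE ?powR_gt0//; last by rewrite mulr_gt0.
  by apply: ge0_ler_powR => //; rewrite ?nnegrE// ltW// mulr_gt0.
have := @averaging_bound2 _ _ _ leb1 I' J th' F M kap' e
    mI' I'oo iJ mth' M0 th'M th'0 intth' (mulr_ge0 (powR_ge0 _ _) kap0) F0 kF.
rewrite [fine (_ I')](congr1 fine I'E : _ = 2 * tau) [X in _ -> (_ <= X)%E]integral_mkcond; apply: le_trans.
rewrite lee_fin /kap' /= opprD powRD; last by rewrite lt0r_neq0 ?implybT// mulr_gt0.
rewrite [_ `^ (- 1)]powRN powRr1 ?mulr_ge0 ?(ltW tau0)//.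
rewrite le_eqVlt; apply/orP; left; apply/eqP.
move: (_ `^ _) (`|\int[leb1]_t _|) => A B.
by field; rewrite !gt_eqF.
Qed.

End time.

(** * The scaled family *)

Section bump_derivatives.
Context {R : realType}.

Definition dbump (n : nat) : R -> R := iter_deriv (nseq n (1 : R)) (expbump 1).

Lemma smooth_iter_deriv (V : normedModType R) (vs : seq V) (f : V -> R) :
  smooth f -> smooth (iter_deriv vs f).
Proof. by move=> sf; elim: vs => [|v vs IH] //=; exact: smooth_derive. Qed.

Lemma iter_deriv_nseqS (V : normedModType R) n (v : V) (f : V -> R) :
  iter_deriv (nseq n v) ('D_v f) = iter_deriv (nseq n.+1 v) f.
Proof. by elim: n => [|n IH] //=; rewrite IH. Qed.

Lemma smooth_dbump n : smooth (dbump n).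
Proof. by apply: smooth_iter_deriv; exact: smooth_bump. Qed.

Lemma dbump_supp n s : ~ `[-1, 1]%classic s -> dbump n s = 0.
Proof.
elim: n s => [|n IH] s hs.
  rewrite /dbump /= expbump0// leNgt; apply/negP => h; apply: hs => /=.
  by rewrite in_itv /=; move: h; rewrite ltr_norml => /andP[/ltW -> /ltW ->].
have cI : closed `[-1 : R, 1]%classic by exact: itv_closed.
exact: (is_derive_closed_support cI IH (smooth_is_derive s 1 (smooth_dbump n)) hs).
Qed.

(** If the next derivative vanished identically, [dbump n] would be constant, hence equal to its
    value at 2, outside the support, which is 0. *)
Lemma dbump_neq0 n : exists s, dbump n s != 0.
Proof.
elim: n => [|n [s hs]].
  by exists 0; rewrite /dbump /= gt_eqF// expbump_gt0// normr0.
apply: contrapT => h.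
have D0 y : dbump n.+1 y = 0.
  by apply: contrapT => /eqP hy; apply: h; exists y.
suff E : dbump n s = dbump n 2.
  move/eqP: hs; apply; rewrite E; apply: dbump_supp => /=.
  by rewrite in_itv /= => /andP[_]; lra.
have dn y : is_derive (y : R) (1 : R) (dbump n) 0.
  by rewrite -(D0 y); exact: (smooth_is_derive y 1 (smooth_dbump n)).
have [] := @MVT_segment R (dbump n) (fun=> 0) (Num.min s 2) (Num.max s 2).
- by rewrite ge_min !le_max lexx ?orbT.
- by apply: continuous_subspaceT; apply: smooth_continuous; exact: smooth_dbump.
move=> c _; rewrite mul0r => /eqP; rewrite subr_eq0.
by case: (leP s 2) => _ /eqP.
Qed.

Lemma dbump_sign_ex n : exists x : R * R * R * R,
  let: (s, rho, kap, sg) := x in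
  [/\ `|s| <= 1, 0 < rho <= 1, 0 < kap, `|sg| = 1 &
      forall y, `|y - s| <= rho -> kap <= sg * dbump n y].
Proof.
have [s hs] := dbump_neq0 n.
have s1 : `|s| <= 1.
  apply: contrapT => h; move/eqP: hs; apply; apply: dbump_supp => /=.
  by rewrite in_itv /= -ler_norml.
have [k0 cB] : 0 < `|dbump n s| / 2 /\ continuous (dbump n).
  split; first by rewrite divr_gt0// normr_gt0.
  by apply: smooth_continuous; exact: smooth_dbump.
have /cvgrPdist_le /(_ _ k0) /nbhs_ballP [e /= e0 he] := cB s.
(* Near s the derivative stays within half of |dbump n s| of its value, so its sign persists. The
   half radius keeps the closed interval inside the open ball; the cap 1, with |s| <= 1, keeps
   [nbump] supported in [-2, 2]. *)
exists (s, Num.min (e / 2) 1, `|dbump n s| / 2, Num.sg (dbump n s)).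
have r0 : 0 < Num.min (e / 2) 1 by rewrite lt_min ltr01 divr_gt0.
split => //; first by rewrite r0 ge_min lexx orbT.
  by rewrite normr_sg hs.
move=> y; rewrite le_min => /andP[hy _].
have : `|dbump n s - dbump n y| <= `|dbump n s| / 2.
  by apply: he; rewrite /ball /= distrC (le_lt_trans hy)//; move: (e0); lra.
case: sgrP => [h|h|h]; first by rewrite h eqxx in hs.
  by rewrite ler_norml mul1r => /andP[h1 h2]; lra.
by rewrite ler_norml mulN1r => /andP[h1 h2]; lra.
Qed.

Definition dbump_data n := projT1 (cid (dbump_sign_ex n)).
Definition bcen n : R := (dbump_data n).1.1.1.
Definition brad n : R := (dbump_data n).1.1.2.
Definition blow n : R := (dbump_data n).1.2.
Definition bsgn n : R := (dbump_data n).2.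

Lemma dbump_sign n : [/\ `|bcen n| <= 1, 0 < brad n <= 1, 0 < blow n, `|bsgn n| = 1 &
  forall y, `|y - bcen n| <= brad n -> blow n <= bsgn n * dbump n y].
Proof.
by rewrite /bcen /brad /blow /bsgn /dbump_data; case: cid => -[[[]]].
Qed.

Lemma brad_gt0 n : 0 < brad n. Proof. by case: (dbump_sign n) => _ /andP[]. Qed.
Lemma blow_gt0 n : 0 < blow n. Proof. by case: (dbump_sign n). Qed.
Lemma normr_bsgn n : `|bsgn n| = 1. Proof. by case: (dbump_sign n). Qed.
Lemma blow_le n y : `|y - bcen n| <= brad n -> blow n <= bsgn n * dbump n y.
Proof. by have [_ _ _ _] := dbump_sign n; apply. Qed.

(** Each of 1/(1+s) and 1/(1-s) is at most 2 there, whence the exponent -4. *)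
Lemma expbump_half (s : R) : `|s| <= 2^-1 -> expR (- 4) <= expbump 1 s.
Proof.
have E : 2^-1 = 1 / 2 :> R by rewrite div1r.
rewrite E => h; have h1 : `|s| < 1 by rewrite (le_lt_trans h)//; lra.
rewrite expbumpE// ler_expR lerN2 !div1r.
move: h; rewrite ler_norml => /andP[ha hb].
have i1 : (1 + s)^-1 <= 2 by rewrite invf_ple ?posrE; lra.
have i2 : (1 - s)^-1 <= 2 by rewrite invf_ple ?posrE; lra.
lra.
Qed.

(* expbump c moved to the interval where [dbump n] has a constant sign *)
Definition nbump (c : R) (n : nat) (y : R) : R := expbump c ((y - bcen n) / brad n).

Lemma nbump_ge0 c n y : 0 <= nbump c n y.
Proof. exact: expbump_ge0. Qed.

Lemma smooth_nbump c n : 0 < c -> smooth (nbump c n).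
Proof.
move=> c0; apply: (@smooth_affine R R R (fun y => (y - bcen n) / brad n) (fun v => v / brad n)).
- move=> y; apply: cvgMl; apply: cvgB; [exact: cvg_id|exact: cvg_cst].
- by move=> x h v; rewrite addrAC mulrDl scalerAl.
- exact: smooth_bump.
Qed.

Lemma nbump_neq0 c n y : nbump c n y != 0 -> `|y - bcen n| <= brad n.
Proof.
apply: contraR; rewrite -ltNge => h; apply/eqP/expbump0.
by rewrite normrM normfV (gtr0_norm (brad_gt0 n)) ler_pdivlMr ?brad_gt0// mul1r ltW.
Qed.

Lemma nbump_supp c n y : 2 < `|y| -> nbump c n y = 0.
Proof.
move=> h; apply: contrapT => /eqP/nbump_neq0 h1.
have [h2 /andP[_ h3] _ _ _] := dbump_sign n.
have := ler_normD (y - bcen n) (bcen n); rewrite subrK.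
by move: h h1 h2 h3; lra.
Qed.

Lemma nbump_half n y : `|y - bcen n| <= brad n / 2 -> expR (- 4) <= nbump 1 n y.
Proof.
move=> h; apply: expbump_half.
by rewrite normrM normfV (gtr0_norm (brad_gt0 n)) ler_pdivrMr ?brad_gt0// mulrC.
Qed.

Lemma nbump_powR m n y : 0 < m -> nbump 1 n y `^ m = nbump m n y.
Proof. exact: expbump_powR. Qed.

End bump_derivatives.

Section scaling.
Context {R : realType}.

Lemma iter_deriv_scale (V W : normedModType R) (A : V -> W) (L : V -> W) v v' (b c : R) n (f : W -> R) :
  (forall x h v, A (x + h *: v) = A x + h *: L v) -> L v = c *: v' -> smooth f ->
  iter_deriv (nseq n v) (fun x => b * f (A x)) =
  (fun x => b * c ^+ n * iter_deriv (nseq n v') f (A x)).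
Proof.
move=> AL Lv sf; elim: n => [|n IH] /=; first by apply/funext => x; rewrite expr0 mulr1.
rewrite IH; apply/funext => x.
have sfn : smooth (iter_deriv (nseq n v') f) by exact: smooth_iter_deriv.
have h : is_derive x v (iter_deriv (nseq n v') f \o A) (c * 'D_v' (iter_deriv (nseq n v') f) (A x)).
  apply: (is_derive_affine AL); rewrite Lv; apply: derive_scale_dir.
  exact: smooth_derivable.
have [_ ->] := is_deriveZ (b * c ^+ n) h.
by rewrite /GRing.scale /= exprSr !mulrA.
Qed.

Lemma signed_integral_ge d (Om : measurableType d) (mu : {measure set Om -> \bar R})
    (f : Om -> R) (B : set Om) (c sg : R) :
  mu.-integrable setT (EFin \o f) -> measurable B -> (mu B < +oo)%E -> `|sg| = 1 ->
  (forall x, 0 <= sg * f x) -> 0 <= c -> (forall x, B x -> c <= sg * f x) ->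
  c * fine (mu B) <= `|\int[mu]_x f x|.
Proof.
move=> intf mB Boo sg1 f0 c0 fB.
rewrite -[leRHS]mul1r -sg1 -normrM -RintegralZl//; apply: le_trans (ler_norm _).
have ig : mu.-integrable setT (fun x => (sg * f x)%:E) by exact: (integrableZl measurableT sg intf).
rewrite -lee_fin EFinM fineK ?ge0_fin_numE// /Rintegral fineK; last exact: integrable_fin_num ig.
rewrite -(setIT B) -integral_indic// -ge0_integralZl//; last first.
  by apply/measurable_EFinP; exact: measurable_indic.
apply: le_integral_ge0 => x _; first by rewrite mule_ge0// lee_fin.
rewrite -EFinM lee_fin indicE; have [|_] := boolP (x \in B); last by rewrite mulr0.
by rewrite inE mulr1 => /fB.
Qed.

End scaling.

(** * The profile U and the sign of its pairing with the tests *)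

Section profile.
Context {R : realType} {d : nat}.
Local Notation Rd := 'rV[R]_d.
Variables (i0 : 'I_d) (k l : nat).

(** The multi-index of the n-fold derivative in the direction i0. *)
Definition dord (n : nat) (i : 'I_d) : nat := if i == i0 then n else 0.

Lemma smooth_coord (f : R -> R) (i : 'I_d) : smooth f -> smooth (fun x : Rd => f (x 0 i)).
Proof.
move=> sf; apply: (@smooth_affine R Rd R (fun x => x 0 i) (fun x => x 0 i)) => //.
- exact: coord_continuous.
- by move=> x h v; rewrite !mxE.
Qed.

Definition cube_bump (x : Rd) : R := \prod_i expbump 1 (x 0 i).

Lemma smooth_cube_bump : smooth cube_bump.
Proof. by apply: smooth_prod => i; apply: smooth_coord; exact: smooth_bump. Qed.

Lemma iter_deriv_cube_bump n :
  iter_deriv (nseq n (e_ i0)) cube_bump = (fun x => \prod_i dbump (dord n i) (x 0 i)).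
Proof.
pose Q (x : Rd) := \prod_i (if i != i0 then expbump 1 (x 0 i) else 1).
have E m (x : Rd) : \prod_i dbump (dord m i) (x 0 i) = dbump m (x 0 i0) * Q x.
  rewrite (bigD1 i0)//= {1}/dord eqxx /Q -big_mkcond /=; congr (_ * _).
  by apply: eq_bigr => i /negbTE hi; rewrite /dord hi.
have sQ : smooth Q.
  apply: smooth_prod => i; case: (i != i0); last exact: smooth_cst.
  by apply: smooth_coord; exact: smooth_bump.
elim: n => [|n IH].
  by apply/funext => x; apply: eq_bigr => i _; rewrite /dord; case: ifP.
apply/funext => x; rewrite /= IH; under eq_fun do rewrite E.
rewrite E.
have h1 : is_derive x (e_ i0) (fun x : Rd => dbump n (x 0 i0)) (dbump n.+1 (x 0 i0)).
  apply: (@is_derive_affine R Rd R (fun x => x 0 i0) (fun x => x 0 i0)).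
    by move=> y h v; rewrite !mxE.
  rewrite mxE !eqxx; exact: (smooth_is_derive (x 0 i0) 1 (smooth_dbump n)).
have h2 : is_derive x (e_ i0) Q 0.
  apply/is_derive_lineP.
  rewrite (_ : (fun h => _) = fun=> Q x); first exact: is_derive_cst.
  apply/funext => h; apply: eq_bigr => i _; case: ifPn => // hi.
  by rewrite !mxE (negbTE hi) andbF mulr0 addr0.
have [_ ->] := is_deriveM h1 h2.
by rewrite scaler0 add0r /GRing.scale /= mulrC.
Qed.

(** Each factor sits where the matching factor of the differentiated test keeps its sign. The orders
    are k+1 and l+1 because the tests are already first derivatives. *)
Definition profile (c : R) (z : R * Rd) : R :=
  nbump c k.+1 z.1 * \prod_i nbump c (dord l.+1 i) (z.2 0 i).

Lemma smooth_profile c : 0 < c -> smooth (profile c).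
Proof.
move=> c0; apply: smoothM.
  by apply: (@smooth_fst R d (nbump c k.+1)); exact: smooth_nbump.
apply: (@smooth_snd R d (fun x => \prod_i nbump c (dord l.+1 i) (x 0 i))).
by apply: smooth_prod => i; apply: smooth_coord; exact: smooth_nbump.
Qed.

Lemma profile_ge0 c z : 0 <= profile c z.
Proof. by rewrite mulr_ge0 ?nbump_ge0// prodr_ge0// => i _; exact: nbump_ge0. Qed.

Lemma profile_powR m z : 0 < m -> profile 1 z `^ m = profile m z.
Proof.
move=> m0; rewrite /profile powRM ?nbump_ge0//; last first.
  by rewrite prodr_ge0// => i _; exact: nbump_ge0.
rewrite nbump_powR//; congr (_ * _).
suff [] : 0 <= \prod_i nbump 1 (dord l.+1 i) (z.2 0 i) /\
  (\prod_i nbump 1 (dord l.+1 i) (z.2 0 i)) `^ m = \prod_i nbump m (dord l.+1 i) (z.2 0 i) by [].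
elim/big_rec2: _ => [|i y1 y2 _ [y10 <-]]; first by rewrite powR1.
by rewrite powRM ?nbump_ge0// nbump_powR// mulr_ge0// nbump_ge0.
Qed.

Lemma profile_supp c z : ~ qbox (-2) 2 2 z -> profile c z = 0.
Proof.
move=> hz; apply: contrapT => /eqP; rewrite mulf_eq0 negb_or => /andP[h1 /prodf_neq0 h2].
apply: hz; split; rewrite /= ?in_itv /=.
  rewrite -ler_norml leNgt; apply: contra h1 => h; apply/eqP; exact: nbump_supp.
apply/rboxP => i; rewrite leNgt; apply: contra (h2 i isT) => h; apply/eqP; exact: nbump_supp.
Qed.

Definition profile_sgn : R := bsgn k.+1 * \prod_(i < d) bsgn (dord l.+1 i).

Lemma normr_profile_sgn : `|profile_sgn| = 1.
Proof.
rewrite normrM normr_bsgn mul1r normr_prod big1// => i _; exact: normr_bsgn.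
Qed.

Definition profile_low : R := expR (-4) ^+ d.+1.
Definition test_low : R := blow k.+1 * \prod_(i < d) blow (dord l.+1 i).

Definition test_fun (z : R * Rd) : R :=
  dbump k.+1 z.1 * \prod_i dbump (dord l.+1 i) (z.2 0 i).

(** Half radii: there each of the d+1 factors of the profile is at least e^-4, and each factor of
    the test is bounded below. *)
Definition profile_core : set (R * Rd) :=
  [set z : R * Rd | `|z.1 - bcen k.+1| <= brad k.+1 / 2 /\
           forall i, `|z.2 0 i - bcen (dord l.+1 i)| <= brad (dord l.+1 i) / 2].

Lemma profile_low_gt0 : 0 < profile_low.
Proof. by rewrite exprn_gt0// expR_gt0. Qed.

Lemma test_low_gt0 : 0 < test_low.
Proof. by rewrite mulr_gt0 ?blow_gt0// prodr_gt0// => i _; exact: blow_gt0. Qed.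

Lemma test_fun_sgn z : profile_sgn * test_fun z =
  (bsgn k.+1 * dbump k.+1 z.1) *
  \prod_i (bsgn (dord l.+1 i) * dbump (dord l.+1 i) (z.2 0 i)).
Proof. by rewrite big_split /= /profile_sgn /test_fun mulrACA. Qed.

Lemma profile_test_ge0 z : 0 < profile 1 z -> 0 <= profile_sgn * test_fun z.
Proof.
move=> hz; have : profile 1 z != 0 by rewrite gt_eqF.
rewrite mulf_eq0 negb_or => /andP[h1 /prodf_neq0 h2]; rewrite test_fun_sgn.
apply: mulr_ge0; first by rewrite (le_trans (ltW (blow_gt0 k.+1)))// blow_le// (nbump_neq0 h1).
apply: prodr_ge0 => i _.
rewrite (le_trans (ltW (blow_gt0 (dord l.+1 i))))//; apply: blow_le.
by apply: (@nbump_neq0 _ 1); exact: h2.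
Qed.

Lemma profile_core_ge z : profile_core z -> profile_low <= profile 1 z.
Proof.
move=> [h1 h2]; rewrite /profile_low exprS; apply: ler_pM; rewrite ?exprn_ge0 ?expR_ge0//.
  exact: nbump_half.
rewrite -{1}(card_ord d) -prodr_const; apply: ler_prod => i _.
by rewrite expR_ge0 nbump_half.
Qed.

Lemma test_core_ge z : profile_core z -> test_low <= profile_sgn * test_fun z.
Proof.
move=> [h1 h2]; rewrite test_fun_sgn; apply: ler_pM.
- exact: ltW (blow_gt0 _).
- by rewrite prodr_ge0// => i _; exact: ltW (blow_gt0 _).
- by apply: blow_le; apply: le_trans h1 _; move: (@brad_gt0 R k.+1) => h; lra.
apply: ler_prod => i _; rewrite (ltW (blow_gt0 _)) /=; apply: blow_le; apply: le_trans (h2 i) _.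
by move: (@brad_gt0 R (dord l.+1 i)) => h; lra.
Qed.

End profile.

Section scaled_solution.
Context {R : realType} {d : nat}.
Local Notation leb1 := (@lebesgue_measure R).
Local Notation Rd := 'rV[R]_d.
Local Notation lebd := (@lebesgue_rV R d).
Local Notation mQ := (measurableTypeR R * Rd)%type.
Variables (i0 : 'I_d) (k l : nat) (m : R).
Hypothesis m1 : 1 < m.
Let m0 : 0 < m. Proof. exact: lt_trans m1. Qed.

Definition rescale (t0 tau lam : R) (z : R * Rd) : R * Rd :=
  ((z.1 - t0) / tau, lam^-1 *: z.2).

Lemma rescale_line t0 tau lam x h v :
  rescale t0 tau lam (x + h *: v) = rescale t0 tau lam x + h *: (v.1 / tau, lam^-1 *: v.2).
Proof.
rewrite /rescale /=; congr (_, _) => /=.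
  by rewrite addrAC mulrDl /GRing.scale /= mulrA.
by rewrite scalerDr !scalerA mulrC.
Qed.

Lemma continuous_rescale t0 tau lam : continuous (rescale t0 tau lam).
Proof.
apply: continuous_pair_fun.
  by move=> z; apply: cvgMl; apply: cvgB; [exact: cvg_fst|exact: cvg_cst].
by move=> z; apply: cvgZr; exact: cvg_snd.
Qed.

Lemma rescale_qbox t0 tau lam z : 0 < tau -> 0 < lam ->
  qbox (-2) 2 2 (rescale t0 tau lam z) ->
  qbox (t0 - 2 * tau) (t0 + 2 * tau) (2 * lam) z.
Proof.
move=> tau0 lam0 [/= + /rboxP hx]; rewrite in_itv /= ler_pdivlMr// ler_pdivrMr// => /andP[h1 h2].
split; first by rewrite /= in_itv /=; apply/andP; split; lra.
apply/rboxP => i; have := hx i; rewrite mxE normrM gtr0_norm ?invr_gt0// mulrC.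
by rewrite ler_pdivrMr.
Qed.

(** The pair (b, c) = (a, 1) gives u and (a^m, m) gives u^m. *)
Definition scaled (b c t0 tau lam : R) (z : R * Rd) : R :=
  b * profile i0 k l c (rescale t0 tau lam z).

Lemma smooth_scaled b c t0 tau lam : 0 < c -> smooth (scaled b c t0 tau lam).
Proof.
move=> c0; apply: smoothM; first exact: smooth_cst.
apply: (smooth_affine (@continuous_rescale t0 tau lam) (@rescale_line t0 tau lam)).
exact: smooth_profile.
Qed.

Lemma scaled_supp b c t0 tau lam z : 0 < tau -> 0 < lam ->
  ~ qbox (t0 - 2 * tau) (t0 + 2 * tau) (2 * lam) z -> scaled b c t0 tau lam z = 0.
Proof.
move=> tau0 lam0 hz; rewrite /scaled profile_supp ?mulr0// => h; apply: hz.
exact: rescale_qbox h.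
Qed.

(** The time derivative produces a/tau and the Laplacian a^m/lam^2. The assumed balance makes these
    equal, so the whole source is a rescaled copy of one fixed function. *)
Lemma source_scaled (a t0 tau lam : R) z : 0 < tau -> 0 < lam ->
  a `^ m / lam ^+ 2 = a / tau ->
  source (scaled a 1 t0 tau lam) (scaled (a `^ m) m t0 tau lam) z =
  a / tau * source (profile i0 k l 1) (profile i0 k l m) (rescale t0 tau lam z).
Proof.
move=> tau0 lam0 am.
have AL := @rescale_line t0 tau lam.
have s1 : smooth (profile i0 k l (1 : R)) by exact: smooth_profile.
have s2 : smooth (profile i0 k l m) by exact: smooth_profile.
have Lt : (fun v : R * Rd => (v.1 / tau, lam^-1 *: v.2)) (1, 0) = tau^-1 *: (1, 0).
  by congr (_, _); rewrite /= ?scaler0// /GRing.scale /= mulr1 mul1r.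
have Lx i : (fun v : R * Rd => (v.1 / tau, lam^-1 *: v.2)) (0, e_ i) = lam^-1 *: (0, e_ i).
  by congr (_, _); rewrite /= mul0r /GRing.scale /= mulr0.
have et := iter_deriv_scale a 1 AL Lt s1.
have ex i := iter_deriv_scale (a `^ m) 2 AL (Lx i) s2.
rewrite /= expr1 in et.
rewrite /source /dt /dx mulrBr; congr (_ - _).
  exact: (congr1 (fun f => f z) et).
rewrite -am mulr_sumr; apply: eq_bigr => i _.
by rewrite -[in RHS]exprVn; exact: (congr1 (fun f => f z) (ex i)).
Qed.

Lemma continuous_source (u w : R * Rd -> R) : smooth u -> smooth w -> continuous (source u w).
Proof.
move=> su sw; apply: continuous_subf; first exact: smooth_continuous (smooth_derive _ su).
apply: continuous_sumf => i; apply: smooth_continuous; do 2! apply: smooth_derive.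
exact: sw.
Qed.

Lemma source_supp (u w : R * Rd -> R) a b L z : smooth u -> smooth w ->
  (forall z, w z = u z `^ m) -> (forall z, ~ qbox a b L z -> u z = 0) ->
  ~ qbox a b L z -> source u w z = 0.
Proof.
move=> su sw wu u0 hz; rewrite /source (derive_supp su u0)// sub0r big1 ?oppr0// => i _.
exact: (derive2_w_supp m1 sw wu u0).
Qed.

Lemma source_profile_bound : exists2 C : R, 0 < C &
  forall z, `|source (profile i0 k l 1) (profile i0 k l m) z| <= C.
Proof.
have s1 : smooth (profile i0 k l (1 : R)) by exact: smooth_profile.
have s2 : smooth (profile i0 k l m) by exact: smooth_profile.
have [C C0 hC] := compact_continuous_bounded (@qbox_compact R d (-2) 2 2) (continuous_source s1 s2).
exists C => // z; have [/hC//|hz] := pselect (qbox (-2) 2 2 z).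
rewrite (@source_supp _ _ (-2) 2 2 _ s1 s2) ?normr0 ?ltW//.
- by move=> y; rewrite profile_powR.
- by move=> y hy; exact: profile_supp.
Qed.

Variables (T a tau lam : R).
Hypotheses (a0 : 0 < a) (tau0 : 0 < tau) (lam0 : 0 < lam) (tauT : tau < T / 4).
Hypothesis am : a `^ m / lam ^+ 2 = a / tau.

Let u := scaled a 1 (T / 2) tau lam.
Let w := scaled (a `^ m) m (T / 2) tau lam.
Let S := source u w.

Let su : smooth u. Proof. exact: smooth_scaled. Qed.
Let sw : smooth w. Proof. exact: smooth_scaled. Qed.
Let wu z : w z = u z `^ m.
Proof. by rewrite /w /u /scaled powRM ?profile_ge0 ?profile_powR// ltW. Qed.
Let usupp z : ~ qbox (T / 2 - 2 * tau) (T / 2 + 2 * tau) (2 * lam) z -> u z = 0.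
Proof. exact: scaled_supp. Qed.

(** The profile lives in [-2, 2], so the solution has time support of half-width 2 tau around T/2;
    this is where tau < T/4 is used. *)
Let lo0 : 0 < T / 2 - 2 * tau. Proof. by move: tauT; lra. Qed.
Let upT : T / 2 + 2 * tau < T. Proof. by move: tauT; lra. Qed.

Lemma scaled_entropy_solution :
  entropy_solution m T (fun=> 0) (fun t x => S (t, x)) (fun t x => u (t, x)).
Proof.
apply: (classical_entropy_solution m1 lo0 upT su sw _ wu usupp).
by move=> z; rewrite /u /scaled mulr_ge0 ?profile_ge0// ltW.
Qed.

Lemma scaled_source_integrable :
  (leb1 \x lebd)%E.-integrable (QT T) (fun z => (S (z.1, z.2))%:E).
Proof.
apply: (integrableS measurableT) => //; first exact: measurable_QT.
rewrite (_ : (fun _ => _) = EFin \o S); last by apply/funext => -[].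
apply: continuous_qbox_integrable; first exact: continuous_source.
by move=> z; exact: (source_supp su sw wu usupp).
Qed.

(** The source is at most C a/tau on a box of measure 4 tau (4 lam)^d, so tau cancels. *)
Lemma scaled_source_norm (C : R) : 0 < C ->
  (forall z, `|source (profile i0 k l 1) (profile i0 k l m) z| <= C) ->
  (\int[leb1]_(t in `]0%R, T[) \int[lebd]_x `|S (t, x)|%:E <=
   (C * 4 ^+ d.+1 * a * lam ^+ d)%:E)%E.
Proof.
move=> C0 hC.
pose I : set R := `[T / 2 - 2 * tau, T / 2 + 2 * tau]%classic.
have mI : measurable (I : set (measurableTypeR R)) by exact: measurable_itv.
have IE : leb1 I = (4 * tau)%:E.
  rewrite /I lebesgue_measure_itv /= lte_fin ifT; last by move: (tau0) => h; lra.
  by congr EFin; ring.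
have BE : lebd (rbox (2 * lam)) = ((4 * lam) ^+ d)%:E.
  by rewrite lebesgue_rbox ?mulr_ge0 ?ltW// mulrA -natrM.
have at0 : 0 <= a / tau by apply: divr_ge0; exact: ltW.
have ca : 0 <= a / tau * C by apply: mulr_ge0 => //; exact: ltW.
have Sb t x : `|S (t, x)| <= a / tau * C * \1_I t * \1_(rbox (2 * lam)) x.
  have [hz|hz] := pselect (qbox (T / 2 - 2 * tau) (T / 2 + 2 * tau) (2 * lam) (t, x)).
    have e1 : \1_I t = 1 :> R by rewrite indicE mem_set//; case: hz.
    have e2 : \1_(rbox (2 * lam)) x = 1 :> R by rewrite indicE mem_set//; case: hz.
    rewrite e1 e2 !mulr1 /S source_scaled// normrM (ger0_norm at0).
    exact: ler_wpM2l.
  by rewrite /S (source_supp su sw wu usupp hz) normr0 mulr_ge0// mulr_ge0.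
have inner t : (\int[lebd]_x `|S (t, x)|%:E <= (a / tau * C * (4 * lam) ^+ d)%:E * (\1_I t)%:E)%E.
  apply: (@le_trans _ _ (\int[lebd]_x ((a / tau * C * \1_I t)%:E * (\1_(rbox (2 * lam)) x)%:E))%E).
    apply: le_integral_ge0 => x _; first by rewrite lee_fin normr_ge0.
    rewrite -EFinM lee_fin; exact: Sb.
  rewrite ge0_integralZl//; last first.
  - by rewrite lee_fin mulr_ge0.
  - by apply/measurable_EFinP; apply: measurable_indic; exact: measurable_rbox.
  rewrite integral_indic//; last exact: measurable_rbox.
  by rewrite setIT [X in (_ * X)%E]BE -!EFinM lee_fin mulrAC.
apply: (@le_trans _ _ (\int[leb1]_t ((a / tau * C * (4 * lam) ^+ d)%:E * (\1_I t)%:E))%E).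
  rewrite integral_mkcond; apply: le_integral_ge0 => t _; rewrite patchE.
    by case: ifP => // _; apply: integral_ge0 => x _; rewrite lee_fin.
  case: ifP => // _; rewrite ?inner// mule_ge0// lee_fin// mulr_ge0// exprn_ge0// mulr_ge0// ltW//.
rewrite ge0_integralZl//; last first.
- by rewrite lee_fin mulr_ge0// exprn_ge0// mulr_ge0// ltW.
- by apply/measurable_EFinP; apply: measurable_indic.
rewrite integral_indic// setIT [X in (_ * X)%E]IE -EFinM lee_fin le_eqVlt; apply/orP; left; apply/eqP.
by rewrite exprMn exprS; field; rewrite gt_eqF.
Qed.

End scaled_solution.

Section space_time_lower_bound.
Context {R : realType} (d : nat).
Local Notation leb1 := (@lebesgue_measure R).
Local Notation Rd := 'rV[R]_d.
Local Notation lebd := (@lebesgue_rV R d).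

Lemma space_cst_gt0 s p : (0 < d)%N -> 0 < @space_cst R d s p.
Proof.
move=> d0; rewrite /space_cst; case: ifP => // _.
by rewrite mulr_gt0// powR_gt0// sqrtr_gt0 ltr0n.
Qed.

Lemma iter_deriv_closed_supp (V : normedModType R) (K : set V) vs (f : V -> R) :
  closed K -> smooth f -> (forall x, ~ K x -> f x = 0) ->
  forall x, ~ K x -> iter_deriv vs f x = 0.
Proof.
move=> cK sf f0; elim: vs => [|v vs IH] //= x Kx.
have h := smooth_is_derive x v (smooth_iter_deriv vs sf).
exact: (is_derive_closed_support cK IH h Kx).
Qed.

(** The space bound is affine in a pairing with the fixed function [dchi], which is exactly the
    hypothesis on X in the time bound. *)
Lemma dotW_tx_lower_bound (i0 : 'I_d) (st sx p T t0 tau lam M M' eps : R) (th : R -> R) (chi : Rd -> R)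
    (g : R -> Rd -> R) :
  1 <= p -> 0 <= st -> 0 <= sx -> 0 < tau -> 0 < lam -> 0 < M -> 0 < M' -> 0 < eps ->
  0 < t0 - tau -> t0 + tau < T ->
  smooth th -> (forall t, ~ `[t0 - tau, t0 + tau]%classic t -> th t = 0) ->
  (forall t, `|th t| <= M') -> \int[leb1]_t th t = 0 ->
  smooth chi -> (forall x, ~ rbox lam x -> chi x = 0) ->
  (forall x, `|chi x| <= M) -> \int[lebd]_x chi x = 0 ->
  (((2 * tau) `^ (- ((st - (Num.truncn st)%:R) * p)) *
    (space_cst d sx p * lam `^ (- ((sx - (Num.truncn sx)%:R) * p)) * eps `^ (p - 1) / M) *
    (`|\int[(leb1 \x lebd)%E]_(z in QT T) (g z.1 z.2 *
         (iter_deriv (nseq (Num.truncn st) (1 : R)) th z.1 * dchi i0 sx chi z.2))| / M' -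
     M * eps * (2 * lam) ^+ d * (2 * tau)))%:E <= dotW_tx st sx p T g `^ p)%E.
Proof.
move=> p1 st0 sx0 tau0 lam0 M0 M'0 e0 I0 IT sth th0 thM ith schi chi0 chiM ichi.
have d0 : (0 < d)%N by case: (d) i0 => // -[].
apply: (@dotW_time_lower_bound R d st p T _ _ lam t0) => //.
- by rewrite !mulr_ge0 ?invr_ge0 ?powR_ge0 ?(ltW M0)// ltW// space_cst_gt0.
- by rewrite !mulr_ge0 ?exprn_ge0 ?mulr_ge0// ltW.
- exact: smooth_iter_deriv.
- apply: iter_deriv_closed_supp => //.
  exact: compact_closed (@norm_hausdorff _ _) (@rbox_compact R d lam).
- by move=> h; exact: dotW_Rd_lower_bound.
Qed.

End space_time_lower_bound.

(** * Test functions of mean zero at the scales tau and lam *)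

Section scaled_tests.
Context {R : realType} {d : nat}.
Local Notation leb1 := (@lebesgue_measure R).
Local Notation Rd := 'rV[R]_d.
Local Notation lebd := (@lebesgue_rV R d).
Local Notation mQ := (measurableTypeR R * Rd)%type.
Variables (i0 : 'I_d) (k l : nat).

(** A derivative of a bump rather than the bump itself, so that its integral vanishes; likewise for
    [space_test]. *)
Definition time_test (t0 tau t : R) : R := dbump 1 ((t - t0) / tau).
Definition space_test (lam : R) (x : Rd) : R := 'D_(e_ i0) (@cube_bump R d) (lam^-1 *: x).

Lemma shift_line (t0 tau x h v : R) :
  (x + h *: v - t0) / tau = (x - t0) / tau + h *: (v / tau).
Proof. by rewrite addrAC mulrDl scalerAl. Qed.

Lemma scale_line (lam : R) (x : Rd) h v :
  lam^-1 *: (x + h *: v) = lam^-1 *: x + h *: (lam^-1 *: v).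
Proof. by rewrite scalerDr !scalerA mulrC. Qed.

Lemma smooth_time (f : R -> R) t0 tau : smooth f -> smooth (fun t : R => f ((t - t0) / tau)).
Proof.
apply: (@smooth_affine R R R (fun t => (t - t0) / tau) (fun v => v / tau)); last exact: shift_line.
by move=> y; apply: cvgMl; apply: cvgB; [exact: cvg_id|exact: cvg_cst].
Qed.

Lemma smooth_space (f : Rd -> R) lam : smooth f -> smooth (fun x : Rd => f (lam^-1 *: x)).
Proof.
apply: (@smooth_affine R Rd Rd (fun x => lam^-1 *: x) (fun x => lam^-1 *: x)); last exact: scale_line.
by move=> y; exact: (cvgZr (f := id) cvg_id).
Qed.

Lemma iter_deriv_time_test n t0 tau t :
  iter_deriv (nseq n (1 : R)) (time_test t0 tau) t = tau^-1 ^+ n * dbump n.+1 ((t - t0) / tau).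
Proof.
have Lv : (fun v : R => v / tau) 1 = tau^-1 *: (1 : R) by rewrite /GRing.scale /= mulr1 mul1r.
have := iter_deriv_scale 1 n (@shift_line t0 tau) Lv (@smooth_dbump R 1).
rewrite /dbump /= iter_deriv_nseqS /= => h.
rewrite [LHS](_ : _ = iter_deriv (nseq n (1:R)) (fun x : R => 1 * 'D_1 (expbump 1) ((x - t0) / tau)) t).
  by rewrite h mul1r.
by congr iter_deriv; apply/funext => y; rewrite mul1r.
Qed.

Lemma iter_deriv_space_test n lam x :
  iter_deriv (nseq n (e_ i0)) (space_test lam) x =
  lam^-1 ^+ n * \prod_i dbump (dord i0 n.+1 i) ((lam^-1 *: x) 0 i).
Proof.
have sc : smooth ('D_(e_ i0) (@cube_bump R d)) by apply: smooth_derive; exact: smooth_cube_bump.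
have := iter_deriv_scale 1 n (@scale_line lam) (erefl (lam^-1 *: e_ i0)) sc.
rewrite iter_deriv_nseqS iter_deriv_cube_bump => h.
rewrite [LHS](_ : _ = iter_deriv (nseq n (e_ i0)) (fun x : Rd => 1 * 'D_(e_ i0) (@cube_bump R d) (lam^-1 *: x)) x).
  by rewrite h mul1r.
by congr iter_deriv; apply/funext => y; rewrite mul1r.
Qed.

Lemma time_test_supp t0 tau t : 0 < tau ->
  ~ `[t0 - tau, t0 + tau]%classic t -> time_test t0 tau t = 0.
Proof.
move=> tau0 ht; apply: dbump_supp => h; apply: ht; move: h => /=.
by rewrite !in_itv /= ler_pdivlMr// ler_pdivrMr// => /andP[h1 h2]; apply/andP; split; lra.
Qed.

Lemma cube_bump_supp (x : Rd) : ~ rbox 1 x -> cube_bump x = 0.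
Proof.
move=> hx; apply: contrapT => /eqP/prodf_neq0 h; apply: hx; apply/rboxP => i.
rewrite leNgt; apply: contra (h i isT) => h1; apply/eqP; apply: expbump0; exact: ltW.
Qed.

Lemma rbox_scale lam (x : Rd) : 0 < lam -> rbox 1 (lam^-1 *: x) -> rbox lam x.
Proof.
move=> lam0 /rboxP h; apply/rboxP => i; have := h i.
by rewrite mxE normrM gtr0_norm ?invr_gt0// mulrC ler_pdivrMr// mul1r.
Qed.

Lemma space_test_supp lam x : 0 < lam -> ~ rbox lam x -> space_test lam x = 0.
Proof.
move=> lam0 hx.
apply: (@iter_deriv_closed_supp _ _ (rbox 1) [:: e_ i0] (@cube_bump R d)).
- exact: compact_closed (@norm_hausdorff _ _) (@rbox_compact R d 1).
- exact: smooth_cube_bump.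
- exact: cube_bump_supp.
- by move=> h; apply: hx; exact: (rbox_scale lam0 h).
Qed.

Lemma int_time_test t0 tau : 0 < tau -> \int[leb1]_t time_test t0 tau t = 0.
Proof.
move=> tau0.
apply: (@Rintegral_derivative_R R (fun t => tau * expbump 1 ((t - t0) / tau)) _ (t0 - tau) (t0 + tau)).
- by lra.
- move=> x.
  have h : is_derive (x : R) (1 : R) (expbump 1 \o (fun t : R => (t - t0) / tau)) (tau^-1 * dbump 1 ((x - t0) / tau)).
    apply: (is_derive_affine (@shift_line t0 tau)).
    rewrite [X in is_derive _ X](_ : _ = tau^-1 *: (1 : R)); last first.
      by rewrite /GRing.scale /= mulr1 mul1r.
    apply: derive_scale_dir; apply: smooth_derivable; exact: smooth_bump.
  have := is_deriveZ tau h; congr is_derive.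
  by rewrite /GRing.scale /= mulrA divff ?mul1r// gt_eqF.
- apply: smooth_continuous; apply: smooth_time; exact: smooth_dbump.
- move=> x hx; have := @dbump_supp R 0 ((x - t0) / tau); rewrite /dbump /= => ->; rewrite ?mulr0//.
  move=> h; apply: hx; move: h => /=.
  by rewrite !in_itv /= ler_pdivlMr// ler_pdivrMr// => /andP[h1 h2]; apply/andP; split; lra.
Qed.

Lemma int_space_test lam : 0 < lam -> \int[lebd]_x space_test lam x = 0.
Proof.
move=> lam0.
apply: (@Rintegral_derivative_rV R d (fun x => lam * cube_bump (lam^-1 *: x)) _ i0 lam).
- move=> x.
  have h : is_derive x (e_ i0) (@cube_bump R d \o (fun x : Rd => lam^-1 *: x)) (lam^-1 * space_test lam x).
    apply: (is_derive_affine (@scale_line lam)).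
    apply: derive_scale_dir; apply: smooth_derivable; exact: smooth_cube_bump.
  have := is_deriveZ lam h; congr is_derive.
  by rewrite /GRing.scale /= mulrA divff ?mul1r// gt_eqF.
- apply: smooth_continuous; apply: (@smooth_space ('D_(e_ i0) (@cube_bump R d))); apply: smooth_derive; exact: smooth_cube_bump.
- move=> x hx; rewrite cube_bump_supp ?mulr0// => h; apply: hx; exact: (rbox_scale lam0 h).
Qed.

Lemma time_test_bound : exists2 M : R, 0 < M & forall t0 tau t, `|time_test t0 tau t| <= M.
Proof.
have [M M0 h] := compact_continuous_bounded (@segment_compact R (-1) 1)
  (smooth_continuous (@smooth_dbump R 1)).
exists M => // t0 tau t; rewrite /time_test.
have [/h//|/dbump_supp ->] := pselect (`[-1, 1]%classic ((t - t0) / tau)).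
by rewrite normr0 ltW.
Qed.

Lemma space_test_bound : exists2 M : R, 0 < M & forall lam x, `|space_test lam x| <= M.
Proof.
have sc : smooth ('D_(e_ i0) (@cube_bump R d)) by apply: smooth_derive; exact: smooth_cube_bump.
have [M M0 h] := compact_continuous_bounded (@rbox_compact R d 1) (smooth_continuous sc).
exists M => // lam x; rewrite /space_test.
have [/h//|hx] := pselect (rbox 1 (lam^-1 *: x)).
have := space_test_supp ltr01 hx; rewrite /space_test invr1 scale1r => ->.
by rewrite normr0 ltW.
Qed.

End scaled_tests.

(** * Lower bound for the norms of the scaled family *)

Section scaled_lower_bound.
Context {R : realType} {d : nat}.
Local Notation leb1 := (@lebesgue_measure R).
Local Notation Rd := 'rV[R]_d.
Local Notation lebd := (@lebesgue_rV R d).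
Local Notation mQ := (measurableTypeR R * Rd)%type.

(** The volume of [profile_core]: an interval of radius [brad]/2 has length [brad]. *)
Definition core_volume (i0 : 'I_d) (k l : nat) : R :=
  brad k.+1 * \prod_(i < d) brad (dord i0 l.+1 i).

Lemma core_volume_gt0 i0 k l : 0 < core_volume i0 k l.
Proof. by rewrite mulr_gt0 ?brad_gt0// prodr_gt0// => i _; exact: brad_gt0. Qed.

Lemma rescaled_core_measure (i0 : 'I_d) (k l : nat) (t0 tau lam : R) : 0 < tau -> 0 < lam ->
  let B := rescale t0 tau lam @^-1` profile_core i0 k l : set mQ in
  measurable B /\ (leb1 \x lebd)%E B = (core_volume i0 k l * (tau * lam ^+ d))%:E.
Proof.
move=> tau0 lam0 B.
pose I : set R := `[t0 + tau * (bcen k.+1 - brad k.+1 / 2), t0 + tau * (bcen k.+1 + brad k.+1 / 2)]%classic.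
pose A i : set R := `[lam * (bcen (dord i0 l.+1 i) - brad (dord i0 l.+1 i) / 2),
  lam * (bcen (dord i0 l.+1 i) + brad (dord i0 l.+1 i) / 2)]%classic.
pose Q : set Rd := [set x | forall i, A i (x 0 i)].
have BE : B = I `*` Q.
  apply/seteqP; split => -[t x].
    move=> [/= h1 h2]; split => [|i] /=.
      move: h1; rewrite ler_distl /I /= in_itv /= => /andP[+ +].
      rewrite ler_pdivlMr// ler_pdivrMr// => h3 h4; apply/andP; split; lra.
    have := h2 i; rewrite mxE ler_distl /A /= in_itv /= [lam^-1 * _]mulrC => /andP[+ +].
    by rewrite ler_pdivlMr// ler_pdivrMr// => h3 h4; apply/andP; split; lra.
  move=> [/= h1 h2]; split => [|i] /=.
    move: h1; rewrite /I /= in_itv /= => /andP[h3 h4].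
    by rewrite /rescale /= ler_distl ler_pdivlMr// ler_pdivrMr//; apply/andP; split; lra.
  have := h2 i; rewrite /A /= in_itv /= => /andP[h3 h4].
  by rewrite /rescale /= mxE [lam^-1 * _]mulrC ler_distl ler_pdivlMr// ler_pdivrMr//; apply/andP; split; lra.
have mI : measurable (I : set (measurableTypeR R)) by exact: measurable_itv.
have mQ' : measurable Q by apply: measurable_rV_box => i; exact: measurable_itv.
split; first by rewrite BE; exact: measurableX.
have itvE (x y : R) : x < y -> leb1 `[x, y]%classic = (y - x)%:E.
  by move=> xy; rewrite lebesgue_measure_itv /= lte_fin xy -EFinB.
have IE : leb1 I = (tau * brad k.+1)%:E.
  rewrite itvE; first by congr EFin; field.
  by rewrite ltrD2l ltr_pM2l// ltrD2l; move: (@brad_gt0 R k.+1); lra.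
have AE i : leb1 (A i) = (lam * brad (dord i0 l.+1 i))%:E.
  rewrite itvE; first by congr EFin; field.
  by rewrite ltr_pM2l// ltrD2l; move: (@brad_gt0 R (dord i0 l.+1 i)); lra.
have QE : lebd Q = (lam ^+ d * \prod_(i < d) brad (dord i0 l.+1 i))%:E.
  rewrite (lebesgue_rV_box (fun i => measurable_itv _)).
  under eq_bigr do rewrite AE.
  by rewrite prodEFin big_split /= prodr_const card_ord.
rewrite BE; apply: (etrans (product_measure1E leb1 lebd mI mQ')).
rewrite [X in (X * _)%E]IE [X in (_ * X)%E]QE -EFinM; congr EFin.
by rewrite /core_volume; ring.
Qed.

Lemma spow_ge0E (mu u : R) : 0 < mu -> 0 <= u -> spow mu u = u `^ mu.
Proof. by move=> mu0 u0; rewrite /spow ger0_norm// mulrC mulr_powRB1. Qed.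

Variables (i0 : 'I_d) (st sx mu p T : R).
Hypotheses (p1 : 1 <= p) (mu1 : 1 <= mu) (st0 : 0 <= st) (sx0 : 0 <= sx).
Let k := Num.truncn st.
Let l := Num.truncn sx.

Let mu0 : 0 < mu. Proof. exact: lt_le_trans mu1. Qed.

(** Where u > 0 the integrand has the constant sign [profile_sgn], so nothing cancels and the
    integral is at least its part over the rescaled core, estimated by the minima of the factors
    there. *)
Lemma scaled_test_integral (a tau lam : R) :
  0 < a -> 0 < tau -> 0 < lam -> tau < T / 4 ->
  (a * @profile_low R d) `^ mu * (tau^-1 ^+ k * lam^-1 ^+ l * @test_low R d i0 k l) *
    (core_volume i0 k l * (tau * lam ^+ d)) <=
  `|\int[(leb1 \x lebd)%E]_(z in QT T)
     (spow mu (scaled i0 k l a 1 (T / 2) tau lam (z.1, z.2)) *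
       (iter_deriv (nseq k (1 : R)) (time_test (T / 2) tau) z.1 *
        dchi i0 sx (space_test i0 lam) z.2))|.
Proof.
move=> a0 tau0 lam0 tauT.
set u := scaled i0 k l a 1 (T / 2) tau lam.
set f := (fun z : R * Rd => _ * (_ * _)).
have u0 z : 0 <= u z by rewrite /u /scaled mulr_ge0 ?profile_ge0// ltW.
have usupp z : ~ qbox (T / 2 - 2 * tau) (T / 2 + 2 * tau) (2 * lam) z -> u z = 0.
  exact: scaled_supp.
have lo0 : 0 < T / 2 - 2 * tau by move: tauT; lra.
have upT : T / 2 + 2 * tau < T by move: tauT; lra.
have fsupp z : ~ qbox (T / 2 - 2 * tau) (T / 2 + 2 * tau) (2 * lam) z -> f z = 0.
  move=> hz; rewrite /f -surjective_pairing usupp//.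
  by rewrite /spow mulr0 mul0r.
have su : smooth u by exact: smooth_scaled.
have sth : smooth (iter_deriv (nseq k (1 : R)) (time_test (T / 2) tau)).
  apply: smooth_iter_deriv; apply: (@smooth_time _ (dbump 1)); exact: smooth_dbump.
have sc : smooth (dchi i0 sx (space_test i0 lam)).
  apply: smooth_iter_deriv; apply: (@smooth_space _ _ ('D_(e_ i0) (@cube_bump R d))).
  by apply: smooth_derive; exact: smooth_cube_bump.
have cf : continuous f.
  apply: continuous_mulf; last first.
    apply: continuous_mulf.
      exact: (smooth_continuous (@smooth_fst R d _ sth)).
    exact: (smooth_continuous (@smooth_snd R d _ sc)).
  rewrite (_ : (fun z => _) = (fun z => `|u z| `^ mu)); last first.
    by apply/funext => -[t x] /=; rewrite spow_ge0E// ger0_norm.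
  move=> z; apply: (@continuous_comp _ _ _ u (fun v => `|v| `^ mu)).
    exact: smooth_continuous.
  exact: continuous_normr_powR.
rewrite (Rintegral_QT lo0 upT fsupp).
have [mB BE] := @rescaled_core_measure i0 k l (T / 2) tau lam tau0 lam0.
set B := rescale (T / 2) tau lam @^-1` profile_core i0 k l in mB BE.
pose cc := tau^-1 ^+ k * lam^-1 ^+ l.
have cc0 : 0 <= cc by rewrite mulr_ge0 ?exprn_ge0// invr_ge0 ltW.
have fE z : f z = spow mu (u z) * (cc * test_fun i0 k l (rescale (T / 2) tau lam z)).
  rewrite /f -surjective_pairing iter_deriv_time_test /dchi map_nseq iter_deriv_space_test /test_fun /cc.
  by congr (_ * _); rewrite mulrACA.
have sgf z : @profile_sgn R d i0 k l * f z =
    (u z `^ mu) * (cc * (profile_sgn i0 k l * test_fun i0 k l (rescale (T / 2) tau lam z))).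
  rewrite fE spow_ge0E//; move: (_ `^ _) (profile_sgn _ _ _) (test_fun _ _ _ _) => A1 A2 A3.
  by ring.
have := @signed_integral_ge R _ mQ (leb1 \x lebd)%E f B
  ((a * @profile_low R d) `^ mu * (cc * @test_low R d i0 k l)) (@profile_sgn R d i0 k l).
rewrite [fine _](congr1 fine BE : _ = core_volume i0 k l * (tau * lam ^+ d)); apply => //.
- exact: (continuous_qbox_integrable cf fsupp).
- by rewrite [X in (X < _)%E]BE ltry.
- exact: normr_profile_sgn.
- move=> z; rewrite sgf; have [uz|uz] := eqVneq (u z) 0.
    by rewrite uz powR0 ?gt_eqF// mul0r.
  rewrite mulr_ge0 ?powR_ge0// mulr_ge0//; apply: profile_test_ge0.
  rewrite lt_neqAle profile_ge0 andbT eq_sym; apply: contra uz => /eqP h.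
  by rewrite /u /scaled h mulr0.
- by rewrite mulr_ge0 ?powR_ge0// mulr_ge0// ltW// test_low_gt0.
- move=> z hz; rewrite sgf; apply: ler_pM; rewrite ?powR_ge0//.
  + by rewrite mulr_ge0// ltW// test_low_gt0.
  + apply: ge0_ler_powR; rewrite ?nnegrE//; first exact: ltW.
      by rewrite mulr_ge0 ?ltW// profile_low_gt0.
    by rewrite /u /scaled ler_pM2l//; exact: profile_core_ge.
  + by rewrite ler_wpM2l//; exact: test_core_ge.
Qed.

Lemma scaled_dotW_lower_bound : exists2 c : R, 0 < c & forall s L al : R, expR s < T / 4 ->
  ((c * expR (mu * p * al + (1 - st * p) * s + (d%:R - sx * p) * L))%:E <=
   dotW_tx st sx p T (fun t x =>
     spow mu (scaled i0 k l (expR al) 1 (T / 2) (expR s) (expR L) (t, x))) `^ p)%E.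
Proof.
have [M M0 hM] := @space_test_bound R d i0.
have [M' M'0 hM'] := @time_test_bound R.
have d0 : (0 < d)%N by case: (d) i0 => // -[].
pose c1 := @profile_low R d `^ mu * @test_low R d i0 k l * core_volume i0 k l.
have c10 : 0 < c1.
  apply: mulr_gt0; last exact: core_volume_gt0.
  apply: mulr_gt0; last exact: test_low_gt0.
  by apply: powR_gt0; exact: profile_low_gt0.
(* Chosen so that the subtracted term M eps (2 lam)^d (2 tau) is exactly half of the lower bound of
   A / M'; see [bracket]. *)
pose c2 := c1 / (4 * M * M' * 2 ^+ d).
have c20 : 0 < c2 by apply: divr_gt0 => //; rewrite !mulr_gt0// exprn_gt0.
pose r := sx - l%:R.
pose r' := st - k%:R.
pose cs := space_cst d sx p.
have cs0 : 0 < cs by exact: space_cst_gt0.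
exists (2 `^ (- (r' * p)) * (cs * c2 `^ (p - 1) / M) * (c1 / (2 * M'))).
  apply: mulr_gt0; last by apply: divr_gt0 => //; exact: mulr_gt0.
  apply: mulr_gt0; first exact: powR_gt0.
  by apply: divr_gt0 => //; apply: mulr_gt0 => //; exact: powR_gt0.
move=> s L al sT.
set tau := expR s in sT *; set lam := expR L; set a := expR al.
have [tau0 lam0 a0] : [/\ 0 < tau, 0 < lam & 0 < a] by rewrite !expR_gt0.
(* A multiple of a^mu tau^-k lam^-l, the natural size of the derivative of u^mu of orders k in time
   and l in space; with it the affine minorant keeps the scaling of a p-th power. *)
pose eps := c2 * expR (mu * al - k%:R * s - l%:R * L).
have eps0 : 0 < eps by rewrite mulr_gt0// expR_gt0.
have lo0 : 0 < T / 2 - tau by move: tau0 sT; lra.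
have upT : T / 2 + tau < T by move: tau0 sT; lra.
have sth : smooth (time_test (T / 2) tau).
  apply: (@smooth_time _ (dbump 1)); exact: smooth_dbump.
have sc : smooth (space_test i0 lam).
  apply: (@smooth_space _ _ ('D_(e_ i0) (@cube_bump R d))).
  by apply: smooth_derive; exact: smooth_cube_bump.
have := @dotW_tx_lower_bound R d i0 st sx p T (T / 2) tau lam M M' eps
  (time_test (T / 2) tau) (space_test i0 lam)
  (fun t x => spow mu (scaled i0 k l a 1 (T / 2) tau lam (t, x)))
  p1 st0 sx0 tau0 lam0 M0 M'0 eps0 lo0 upT sth (fun t => time_test_supp tau0) (hM' _ _)
  (int_time_test _ tau0) sc (fun x => @space_test_supp _ _ i0 lam x lam0) (hM _) (int_space_test i0 lam0).
apply: le_trans; rewrite lee_fin -/k -/l -/r -/r' -/cs.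
have hA := scaled_test_integral a0 tau0 lam0 sT.
set A := `| _ | in hA *.
have {}hA : c1 * expR (mu * al + (1 - k%:R) * s + (d%:R - l%:R) * L) <= A.
  apply: le_trans hA; rewrite le_eqVlt; apply/orP; left; apply/eqP.
  rewrite powRM ?(ltW a0) ?(ltW profile_low_gt0)// /c1.
  have -> : expR (mu * al + (1 - k%:R) * s + (d%:R - l%:R) * L) =
      a `^ mu * (tau^-1 ^+ k * lam^-1 ^+ l) * (tau * lam ^+ d).
    rewrite /a /tau /lam -!expRN -!expRM_natl -expRM -!expRD; congr expR; ring.
  move: (a `^ mu) (tau^-1 ^+ k) (lam^-1 ^+ l) (_ `^ mu) (test_low _ _ _) (core_volume _ _ _) => *.
  by ring.
have bracket : c1 / (2 * M') * expR (mu * al + (1 - k%:R) * s + (d%:R - l%:R) * L) <=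
    A / M' - M * eps * (2 * lam) ^+ d * (2 * tau).
  have -> : M * eps * (2 * lam) ^+ d * (2 * tau) =
      c1 / (2 * M') * expR (mu * al + (1 - k%:R) * s + (d%:R - l%:R) * L).
    have -> : expR (mu * al + (1 - k%:R) * s + (d%:R - l%:R) * L) =
        expR (mu * al - k%:R * s - l%:R * L) * (tau * lam ^+ d).
      rewrite /tau /lam -!expRM_natl -!expRD; congr expR; ring.
    have n2 : 2 ^+ d != 0 :> R by rewrite expf_neq0.
    rewrite /eps /c2 exprMn; move: (expR (_ - _)) (lam ^+ d) (2 ^+ d) n2 => E1 E2 E3 n2.
    by field; rewrite n2 !gt_eqF.
  move: hA; set X := expR _ => hA.
  have h : c1 * X / M' <= A / M' by rewrite ler_pM2r ?invr_gt0.
  have -> : c1 / (2 * M') * X = c1 * X / M' / 2 by field; rewrite gt_eqF.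
  by move: h; move: (_ / M') (_ / M') => *; lra.
pose Kp := (2 * tau) `^ (- (r' * p)) * (cs * lam `^ (- (r * p)) * eps `^ (p - 1) / M).
have Kp0 : 0 <= Kp.
  by rewrite /Kp !mulr_ge0 ?powR_ge0 ?invr_ge0 ?(ltW M0) ?(ltW cs0).
apply: le_trans (ler_wpM2l Kp0 bracket); rewrite le_eqVlt; apply/orP; left; apply/eqP.
rewrite /Kp powRM ?(ltW tau0)// /eps powRM ?(ltW c20) ?expR_ge0//.
(* The powers recombine through k + r' = st and l + r = sx: the p - 1 powers in eps and the single
   one in the pairing make p. *)
have -> : expR (mu * p * al + (1 - st * p) * s + (d%:R - sx * p) * L) =
   tau `^ (- (r' * p)) * lam `^ (- (r * p)) * expR (mu * al - k%:R * s - l%:R * L) `^ (p - 1) *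
   expR (mu * al + (1 - k%:R) * s + (d%:R - l%:R) * L).
  by rewrite /tau /lam -!expRM -!expRD; congr expR; rewrite /r /r'; ring.
move: (tau `^ _) (lam `^ _) (c2 `^ _) (expR _ `^ _) (2 `^ _) => *.
by ring.
Qed.

End scaled_lower_bound.

(** * The exponents *)

(** L runs over the whole line, which forces its coefficient to vanish; s is only free towards -oo,
    which fixes just the sign of Y. *)
Lemma bounded_linear_exponents (R : realType) (X Y K s0 : R) :
  (forall L s, s < s0 -> X * L + Y * s <= K) -> X = 0 /\ 0 <= Y.
Proof.
move=> h; have X0 : X = 0.
  apply: contrapT => /eqP X0.
  (* This L makes X L + Y (s0 - 1) equal to K + 1. *)
  have := h ((K - Y * (s0 - 1) + 1) / X) (s0 - 1).
  rewrite mulrCA mulfV// mulr1 => h1.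
  have : s0 - 1 < s0 by lra.
  by move=> /h1; lra.
split => //; rewrite leNgt; apply/negP => Y0.
(* For Y < 0 any s <= (K + 1)/Y gives Y s >= K + 1; the minimum also ensures s < s0. *)
have hK := h 0 (Num.min (s0 - 1) ((K + 1) / Y)).
have h1 : Num.min (s0 - 1) ((K + 1) / Y) < s0 by rewrite gt_min; apply/orP; left; lra.
have := hK h1; rewrite mulr0 add0r.
have h2 : Num.min (s0 - 1) ((K + 1) / Y) <= (K + 1) / Y by rewrite ge_min lexx orbT.
have h3 : Y * ((K + 1) / Y) <= Y * Num.min (s0 - 1) ((K + 1) / Y) by rewrite ler_nM2l.
by move: h3; rewrite mulrCA mulfV ?lt_eqF// mulr1 => h3 h4; lra.
Qed.

Lemma scaling_exponents (R : realType) (d : nat) (T m mu p st sx c : R) :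
  (1 <= d)%N -> 0 < T -> 1 < m -> 1 <= mu -> 1 <= p -> 0 <= st -> 0 <= sx -> 0 < c ->
  (forall (u0 : 'rV[R]_d -> R) (S u : R -> 'rV[R]_d -> R),
        (@lebesgue_rV R d).-integrable setT (EFin \o u0) ->
        (@lebesgue_measure R \x lebesgue_rV d)%E.-integrable (QT T)
          (fun z => (S z.1 z.2)%:E) ->
        entropy_solution m T u0 S u ->
        (dotW_tx st sx p T (fun t x => spow mu (u t x)) `^ p <=
         c%:E *
         (\int[lebesgue_rV d]_x `|u0 x|%:E +
          \int[lebesgue_measure]_(t in `]0%R, T[)
            \int[lebesgue_rV d]_x `|S t x|%:E))%E) ->
  (m - 1) * (sx * p) = 2 * (mu * p - 1) /\ p * (mu + (m - 1) * st) <= m.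
Proof.
move=> d1 T0 m1 mu1 p1 st0 sx0 c0 hest.
case: d d1 hest => // d' _; set d := d'.+1 => hest.
pose i0 : 'I_d := ord0.
pose k := Num.truncn st.
pose l := Num.truncn sx.
have m10 : 0 < m - 1 by rewrite subr_gt0.
have [cl cl0 hlow] := @scaled_dotW_lower_bound R d i0 st sx mu p T p1 mu1 st0 sx0.
have [C C0 hC] := @source_profile_bound R d i0 k l m m1.
pose Ct := c * (C * 4 ^+ d.+1).
have Ct0 : 0 < Ct by rewrite mulr_gt0// mulr_gt0// exprn_gt0.
have T40 : 0 < T / 4 by rewrite divr_gt0.
(* X and Y are the coefficients of L = ln lam and s = ln tau in ln(lower bound / upper bound),
   constants aside, once ln a = (2 L - s)/(m - 1) is inserted. The dimension cancels, as both sides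
   carry lam^d. *)
pose X := 2 * (mu * p - 1) / (m - 1) - sx * p.
pose Y := 1 - st * p - (mu * p - 1) / (m - 1).
have key L s : s < ln (T / 4) -> X * L + Y * s <= ln (Ct / cl).
  move=> hs; pose al := (2 * L - s) / (m - 1).
  have sT : expR s < T / 4 by rewrite -[ltRHS]lnK ?posrE// ltr_expR.
  have am : expR al `^ m / expR L ^+ 2 = expR al / expR s.
    rewrite -expRM -expRM_natl -!expRN -!expRD; congr expR.
    by rewrite /al; field; rewrite gt_eqF.
  have a0 : 0 < expR al by exact: expR_gt0.
  have tau0 : 0 < expR s by exact: expR_gt0.
  have lam0 : 0 < expR L by exact: expR_gt0.
  have i0' : (@lebesgue_rV R d).-integrable setT (EFin \o (fun=> 0 : R)).
    exact: (integrable0 (@lebesgue_rV R d) setT).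
  have := hest (fun=> 0) _ _ i0' (@scaled_source_integrable R d i0 k l m m1 T _ _ _ a0 tau0 lam0)
    (@scaled_entropy_solution R d i0 k l m m1 T _ _ _ a0 tau0 lam0 sT).
  rewrite [Z in (_ * (Z + _))%E](_ : _ = 0%E); last first.
    by apply: integral0_eq => x _; rewrite normr0.
  rewrite add0e => hup.
  have := le_trans (hlow s L al sT) hup.
  have hS := @scaled_source_norm R d i0 k l m m1 T _ _ _ a0 tau0 lam0 am C C0 hC.
  have c0' : (0 <= c%:E)%E by rewrite lee_fin ltW.
  move=> /le_trans /(_ (lee_wpmul2l c0' hS)); rewrite -EFinM lee_fin.
  have -> : c * (C * 4 ^+ d.+1 * expR al * expR L ^+ d) = Ct * expR (al + d%:R * L).
    by rewrite expRD expRM_natl /Ct; ring.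
  have -> : expR (mu * p * al + (1 - st * p) * s + (d%:R - sx * p) * L) =
      expR (X * L + Y * s) * expR (al + d%:R * L).
    by rewrite -expRD; congr expR; rewrite /X /Y /al; field; rewrite gt_eqF.
  rewrite mulrA ler_pM2r ?expR_gt0// mulrC -ler_pdivlMr// => h.
  by rewrite -ler_expR lnK// posrE divr_gt0.
have [X0 Y0] := bounded_linear_exponents key.
split.
  move: X0; rewrite /X => /eqP; rewrite subr_eq0 => /eqP <-.
  by field; rewrite gt_eqF.
have : 0 <= (m - 1) * Y by rewrite mulr_ge0// ltW.
have -> : (m - 1) * Y = m - p * (mu + (m - 1) * st).
  by rewrite /Y; field; rewrite gt_eqF.
by rewrite subr_ge0.
Qed.

Theorem lemma3p1 (R : realType) (d : nat) (T m mu p st sx : R)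
    (hd : (1 <= d)%N) (hT : 0 < T) (hm : 1 < m) (hmu : 1 <= mu <= m)
    (hp : 1 <= p) (hst : 0 <= st) (hsx : 0 <= sx)
    (hest : exists2 c : R, 0 < c &
      forall (u0 : 'rV[R]_d -> R) (S u : R -> 'rV[R]_d -> R),
        (@lebesgue_rV R d).-integrable setT (EFin \o u0) ->
        (@lebesgue_measure R \x lebesgue_rV d)%E.-integrable (QT T)
          (fun z => (S z.1 z.2)%:E) ->
        entropy_solution m T u0 S u ->
        (dotW_tx st sx p T (fun t x => spow mu (u t x)) `^ p <=
         c%:E *
         (\int[lebesgue_rV d]_x `|u0 x|%:E +
          \int[lebesgue_measure]_(t in `]0%R, T[)
            \int[lebesgue_rV d]_x `|S t x|%:E))%E) :
  [/\ p <= m / (mu + (m - 1) * st) /\ m / (mu + (m - 1) * st) <= m / mu,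
      st <= (m - mu * p) / (p * (m - 1)) /\
        (m - mu * p) / (p * (m - 1)) <= (m - mu) / (m - 1),
      [/\ sx = (mu * p - 1) / p * (2 / (m - 1)),
          (mu * p - 1) / p * (2 / (m - 1)) <= 2 * (mu - st) / m &
          2 * (mu - st) / m <= 2 * mu / m] &
      st = (m - mu) / (m - 1) -> p = 1 /\ sx = 2 * (mu - 1) / (m - 1)].
Proof.
have [c c0 hc] := hest; have /andP[mu1 mum] := hmu.
have [Esx Est] := scaling_exponents hd hT hm mu1 hp hst hsx c0 hc.
have m10 : 0 < m - 1 by rewrite subr_gt0.
have p0 : 0 < p by rewrite (lt_le_trans ltr01).
have mu0 : 0 < mu by rewrite (lt_le_trans ltr01).
have m0 : 0 < m by rewrite (lt_trans ltr01).
have mst0 : 0 <= (m - 1) * st by rewrite mulr_ge0// ltW.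
have D0 : 0 < mu + (m - 1) * st by rewrite ltr_pwDl.
have sxE : sx = (mu * p - 1) / p * (2 / (m - 1)).
  have -> : sx = (m - 1) * (sx * p) / ((m - 1) * p) by field; rewrite !gt_eqF.
  by rewrite Esx; field; rewrite !gt_eqF.
have Em : (m - mu * p) / (p * (m - 1)) = (m / p - mu) / (m - 1) by field; rewrite !gt_eqF.
(* All remaining inequalities follow from this one together with p >= 1 and st >= 0. *)
have hmp : mu + (m - 1) * st <= m / p by rewrite ler_pdivlMr// mulrC.
split.
- split; first by rewrite ler_pdivlMr.
  by rewrite ler_pM2l// lef_pV2 ?posrE// lerDl.
- rewrite Em; split.
    by rewrite ler_pdivlMr// mulrC; lra.
  rewrite ler_pM2r ?invr_gt0// lerD2r ler_pdivrMr//.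
  by rewrite ler_peMr// ltW.
- split => //.
    have -> : (mu * p - 1) / p * (2 / (m - 1)) = 2 * (mu - p^-1) / (m - 1).
      by field; rewrite !gt_eqF.
    rewrite ler_pdivrMr// mulrAC ler_pdivlMr//.
    rewrite -!mulrA ler_pM2l//.
    (* With q = 1/p the cross-multiplied inequality m (mu - q) <= (m - 1)(mu - st) is a
       rearrangement of mu + (m - 1) st <= m q. *)
    move: hmp; move: p^-1 => q; nra.
  by rewrite ler_pM2r ?invr_gt0// ler_pM2l// gerBl.
- move=> stE.
  have p1 : p = 1.
    apply/eqP; rewrite eq_le hp andbT.
    (* For this st the sum mu + (m - 1) st equals m, so the inequality reads p m <= m. *)
    move: Est; rewrite stE mulrCA mulfV ?gt_eqF// mulr1.
    by rewrite addrCA subrr addr0 => h; rewrite -(ler_pM2r m0) mul1r.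
  split => //; rewrite sxE p1; field; rewrite gt_eqF//.
Qed.
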